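(* Let $X$ be a reflexive Hilbert M-polyfold. Then there exists a strong Riemannian metric on $X$.
   Context: All vector spaces are real. sc-Banach spaces. An sc-structure on a Banach space $E$ is a decreasing sequence of Banach spaces $E=E_0\supseteq E_1\supseteq\cdots$ (norms $\|\cdot\|_m$) such that each inclusion $E_{m+1}\hookrightarrow E_m$ is compact and $E_\infty=\bigcap_m E_m$ is dense in every $E_m$. Then $E$ is an sc-Banach space. Finite-dimensional spaces carry only the constant sc-structure. $E\oplus F$ has sc-structure $\{E_m\oplus F_m\}$. A subset $A\subseteq E$ has the filtration $A_m=A\cap E_m$, and $A^k$ denotes $A_k$ with filtration $\{A_{k+m}\}_{m\ge0}$. A linear map $L:E\to F$ is an sc-operator if $L(E_m)\subseteq F_m$ and $L|_{E_m}:E_m\to F_m$ is continuous for all $m$; it is an sc-isomorphism if it is bijective with inverse an sc-operator. A closed convex $C\subseteq E$ is a partial quadrant if some sc-isomorphism $L:E\to\mathbb{R}^n\oplus W$ has $L(C)=[0,\infty)^n\oplus W$. An open tuple $(U,C,E)$ consists of an sc-Banach space $E$, a partial quadrant $C\subseteq E$ and a relatively open $U\subseteq C$. Its tangent bundle is $(TU,TC,TE)$ with $TU=U^1\oplus E$, $TC=C^1\oplus E$, $TE=E^1\oplus E$. sc-smoothness. Let $(U,C,E)$, $(V,D,F)$ be open tuples. A map $f:U\to V$ is sc$^0$ (sc-continuous) if $f(U_m)\subseteq V_m$ and $f|_{U_m}:U_m\to V_m$ is continuous for all $m$. It is sc$^1$ if it is sc$^0$; for every $x\in U_1$ there is a bounded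 linear $Df(x):E\to F$ with $\|f(x+h)-f(x)-Df(x)h\|_0/\|h\|_1\to0$ as $\|h\|_1\to0$ (with $h\in E_1$, $x+h\in U_1$); and $Tf:TU\to TV$, $Tf(x,h)=(f(x),Df(x)h)$, is sc$^0$. It is sc$^k$ if it is sc$^{k-1}$ and $T^{k-1}f$ is sc$^1$; sc-smooth means sc$^k$ for all $k$. Retracts and M-polyfolds. An sc-smooth retraction is an sc-smooth $r:U\to U$ with $r\circ r=r$; $(O,C,E)$ with $O=r(U)$ is an sc-smooth retract. For $x\in O_1$, $T_xO=\operatorname{Im}Dr(x)\subseteq E_0$ (with the induced sc-structure), and $TO=Tr(TU)$. A map $f:O\to P$ between sc-smooth retracts is sc-smooth if $f\circ r$ is sc-smooth, and then $Tf=T(f\circ r)|_{TO}$. A chart on a set $X$ is a bijection $\phi:V\to O$ from a subset $V\subseteq X$ onto an sc-smooth retract $(O,C,E)$. An sc-smooth atlas is a family of charts $(V_\alpha,\phi_\alpha,(O_\alpha,C_\alpha,E_\alpha))$ covering $X$ such that each $\phi_\alpha(V_\alpha\cap V_\beta)$ is relatively open in $O_\alpha$ and the transition maps are sc-smooth diffeomorphisms. $X$ with a maximal sc-smooth atlas is an M-polyfold if the topology generated by the chart domains of the maximal atlas is paracompact and Hausdorff. $X_m$ is the set of points $p$ with $\phi(p)\in O_m$ in a (any) chart. Maps between M-polyfolds are sc-smooth if they are so in charts. For $p\in X_1$, $T_pX$ is the set of equivalence classes of pairs (chart around $p$, vector in $T_{\phi(p)}O$), identified via differentials of transition maps; it is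 isomorphic to $\operatorname{Im}Dr(\phi(p))$. $TX=\bigsqcup_{p\in X_1}T_pX$ is an M-polyfold with charts $T\phi:TV\to TO$; similarly for the fibrewise direct sum $TX\oplus TX$. Reflexive and Hilbert. A reflexive sc-Banach space is one for which all $E_n$ ($n\ge0$) are reflexive; a reflexive M-polyfold is one modeled on reflexive sc-Banach spaces. A Hilbert M-polyfold is one modeled on sc-Banach spaces $E$ whose zeroth scale $E_0$ is a Hilbert space. Strong Riemannian metric. A strong Riemannian metric on a reflexive M-polyfold $X$ is a map $g:TX\oplus TX\to\mathbb{R}$ that is sc-smooth and such that for each $p\in X_1$ the restriction $g_p:T_pX\oplus T_pX\to\mathbb{R}$ is bilinear, sc-continuous and symmetric, the map $v_p\mapsto g_p(v_p,\cdot)$ is a topological vector space isomorphism from $T_pX$ onto $(T_pX)^*$ (the continuous functionals on the zeroth level of $T_pX$), and $g_p(v_p,v_p)>0$ for all $v_p\in T_pX$ with $v_p\ne0$. *)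

(* Defs.v *)
From HB Require Import structures.
From mathcomp Require Import all_boot all_order all_algebra.
From mathcomp Require Import all_classical all_reals all_analysis.

Set Implicit Arguments.
Unset Strict Implicit.
Unset Printing Implicit Defensive.

Import Order.TTheory GRing.Theory Num.Theory.
Import numFieldNormedType.Exports.

Local Open Scope classical_set_scope.
Local Open Scope ring_scope.

(** Products and row vectors as Banach spaces (instances missing from the
    library). *)

HB.saturate prod.

Section prod_complete.
Variables (T U : completeType).

Lemma prod_complete (F : set_system (T * U)) :
  ProperFilter F -> cauchy F -> cvg F.
Proof.
move=> FF Fc.
have c1 : cauchy (fst @ F).
  move=> A entA; rewrite near_simpl -near2E near_map2.
  apply: (Fc [set xy | A (xy.1.1, xy.2.1)]).
  exists (A, setT); first by split => //; exact: filterT.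
  by move=> [[a b] [c d]] /= [? _]; exists ((a, c), (b, d)).
have c2 : cauchy (snd @ F).
  move=> A entA; rewrite near_simpl -near2E near_map2.
  apply: (Fc [set xy | A (xy.1.2, xy.2.2)]).
  exists (setT, A); first by split => //; exact: filterT.
  by move=> [[a b] [c d]] /= [_ ?]; exists ((a, c), (b, d)).
move/cauchy_cvg: c1 => c1; move/cauchy_cvg: c2 => c2.
apply/cvg_ex; exists (lim (fst @ F), lim (snd @ F)).
move: c1 c2 => + + A [[B C] [/= nB nC] BC] => /(_ _ nB) FB /(_ _ nC) FC.
have {}FB : F [set x | B x.1] by [].
have {}FC : F [set x | C x.2] by [].
change (F A).
by apply: filterS2 FB FC => -[a b] /= ? ?; exact: BC.
Qed.

End prod_complete.

HB.instance Definition _ (R : realType) (V W : completeNormedModType R) :=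
  Uniform_isComplete.Build (V * W)%type (@prod_complete V W).

HB.instance Definition _ (R : realType) (m n : nat) :=
  Uniform_isComplete.Build 'M[R]_(m, n) cauchy_cvg.

(** * sc-Banach spaces *)

Section scale.
Context {R : realType}.
Variables (E : nat -> completeNormedModType R).
Variable (sc_incl : forall m, {linear E m.+1 -> E m}).

Fixpoint emb_to0 m : E m -> E 0%N :=
  if m is m'.+1 then fun x => emb_to0 (sc_incl m' x) else id.

Definition scale_infty m : set (E m) :=
  [set x | forall k, exists y : E k, emb_to0 y = emb_to0 x].

End scale.

(** The decreasing sequence of Banach spaces is given by Banach spaces and
    injective linear maps [sc_incl]; a subset or a point of the space lives in
    [E 0], and [E_m] is the range of the composite embedding [sc_emb m]. *)
Record scBanach (R : realType) := ScBanach {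
  sc_scale :> nat -> completeNormedModType R;
  sc_incl : forall m, {linear sc_scale m.+1 -> sc_scale m};
  sc_incl_inj : forall m, injective (sc_incl m);
  sc_incl_compact : forall m,
    compact (closure (sc_incl m @` [set x | `|x| <= 1]));
  sc_infty_dense : forall m, dense (scale_infty sc_incl (m := m)) }.

Section sc_basic.
Context {R : realType}.
Implicit Types E F W : scBanach R.

Definition sc_emb E m : E m -> E 0%N := emb_to0 (sc_incl E) (m := m).

Definition sc_level E m : set (E 0%N) := range (@sc_emb E m).

(** The inverse of [sc_emb m] on [sc_level E m]. *)
Definition sc_lift E m (x : E 0%N) : E m := xget 0 [set y | sc_emb y = x].

Definition sc_trace E (A : set (E 0%N)) m : set (E m) := [set x | A (sc_emb x)].

Lemma const_dense (V : completeNormedModType R) m :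
  dense (scale_infty (E := fun=> V) (fun=> idfun) (m := m)).
Proof.
have embE k (x : V) :
    emb_to0 (E := fun=> V) (fun=> idfun) (m := k) x = x.
  by elim: k => //=.
move=> O [x Ox] _; exists x; split => // k; exists x; by rewrite !embE.
Qed.

Definition sc_const (V : completeNormedModType R)
    (cV : compact (closure [set x : V | `|x| <= 1])) : scBanach R.
Proof.
refine (@ScBanach R (fun=> V) (fun=> idfun) _ _ (const_dense (V := V))).
- by move=> m x y.
- by move=> m; rewrite image_id.
Defined.

Lemma unit_ball_closed (V : normedModType R) :
  closure [set x : V | `|x| <= 1] = [set x : V | `|x| <= 1].
Proof.
symmetry; apply/closure_id.
have -> : [set x : V | `|x| <= 1] = closed_ball_ (fun x : V => `|x|) 0 1.
  by apply/seteqP; split => x; rewrite /closed_ball_ /= sub0r normrN.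
exact: closed_closed_ball_.
Qed.

Lemma real_unit_ball_compact : compact (closure [set x : R^o | `|x| <= 1]).
Proof.
rewrite unit_ball_closed.
have -> : [set x : R^o | `|x| <= 1] = `[-1, 1]%classic.
  by apply/seteqP; split => x /=; rewrite in_itv /= ler_norml.
exact: segment_compact.
Qed.

Lemma rV_unit_ball_compact n :
  compact (closure [set x : 'rV[R]_n | `|x| <= 1]).
Proof.
apply: bounded_closed_compact; last exact: closed_closure.
rewrite unit_ball_closed; exists 1; split => // M M1 x /= x1.
exact: le_trans x1 (ltW M1).
Qed.

Definition sc_real : scBanach R := sc_const real_unit_ball_compact.

Definition sc_rV n : scBanach R := sc_const (@rV_unit_ball_compact n).

(** [E^1] *)
Section shift.
Variable E : scBanach R.

Lemma shift_emb m (x : E m.+1) : sc_emb x =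
  sc_incl E 0%N (@emb_to0 R (fun k => E k.+1) (fun k => sc_incl E k.+1) m x).
Proof. by rewrite /sc_emb; elim: m x => //= m IH x; rewrite -IH. Qed.

Lemma shift_dense m :
  dense (scale_infty (E := fun k => E k.+1) (fun k => sc_incl E k.+1) (m := m)).
Proof.
move=> O O0 oO; have [x [Ox xoo]] := @sc_infty_dense _ E m.+1 O O0 oO.
exists x; split => // k; have [y yx] := xoo k.+1; exists y.
by apply: (@sc_incl_inj _ E 0%N); rewrite -!shift_emb.
Qed.

Definition sc_shift : scBanach R :=
  @ScBanach R (fun m => E m.+1) (fun m => sc_incl E m.+1)
    (fun m => @sc_incl_inj _ E m.+1) (fun m => @sc_incl_compact _ E m.+1)
    shift_dense.

End shift.

(** [E (+) F] *)
Section sum.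
Variables E F : scBanach R.

Definition sum_incl m (x : E m.+1 * F m.+1) : E m * F m :=
  (sc_incl E m x.1, sc_incl F m x.2).

Lemma sum_incl_linear m : linear (@sum_incl m).
Proof. by move=> k [a b] [c d]; rewrite /sum_incl /= !linearP. Qed.

HB.instance Definition _ m := GRing.isLinear.Build R (E m.+1 * F m.+1)%type
  (E m * F m)%type *:%R (@sum_incl m) (@sum_incl_linear m).

Lemma sum_incl_inj m : injective (@sum_incl m).
Proof. by move=> [a b] [c d] [/sc_incl_inj -> /sc_incl_inj ->]. Qed.

Lemma sum_incl_compact m :
  compact (closure (@sum_incl m @` [set x | `|x| <= 1])).
Proof.
set A := closure (sc_incl E m @` [set x | `|x| <= 1]).
set B := closure (sc_incl F m @` [set x | `|x| <= 1]).
have cAB : compact (A `*` B) by apply: compact_setX; exact: sc_incl_compact.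
apply: (subclosed_compact _ cAB); first exact: closed_closure.
move=> p pcl; split=> [C nC|C nC].
- have [|_ [[[a b] /= ab1 <-] /= Ca]] := pcl (fst @^-1` C).
    by apply: cvg_fst; exact: nC.
  exists (sc_incl E m a); split => //; exists a => //=.
  by apply: le_trans ab1; rewrite prod_normE le_max lexx.
- have [|_ [[[a b] /= ab1 <-] /= Ca]] := pcl (snd @^-1` C).
    by apply: cvg_snd; exact: nC.
  exists (sc_incl F m b); split => //; exists b => //=.
  by apply: le_trans ab1; rewrite prod_normE le_max lexx orbT.
Qed.

Let sumE m : completeNormedModType R := (E m * F m)%type.
Let sumI m : {linear sumE m.+1 -> sumE m} := @sum_incl m.

Lemma sum_emb m (x : sumE m) :
  @emb_to0 R sumE sumI m x = (sc_emb x.1, sc_emb x.2).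
Proof. by elim: m x => [[]//|m IH x] /=; rewrite IH. Qed.

Lemma sum_dense m : dense (@scale_infty R sumE sumI m).
Proof.
move=> O [[a b] Oab] oO.
have [[A B] /= [nA nB] AB] : nbhs (a, b) O by apply: open_nbhs_nbhs; split.
have [x [Ax xoo]] : (A^° `&` @scale_infty _ E (sc_incl E) m) !=set0.
  apply: sc_infty_dense; last exact: open_interior.
  by exists a; exact: nA.
have [y [By yoo]] : (B^° `&` @scale_infty _ F (sc_incl F) m) !=set0.
  apply: sc_infty_dense; last exact: open_interior.
  by exists b; exact: nB.
exists (x, y); split.
  by apply: AB; split => /=; exact: interior_subset.
move=> k; have [x' ex] := xoo k; have [y' ey] := yoo k.
by exists (x', y'); rewrite !sum_emb /=; congr (_, _).
Qed.

Definition sc_sum : scBanach R :=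
  @ScBanach R (fun m => (E m * F m)%type)
    (fun m => @sum_incl m) sum_incl_inj sum_incl_compact sum_dense.

End sum.

Definition sc_tangent E : scBanach R := sc_sum (sc_shift E) E.

End sc_basic.

Arguments sc_emb {R E m} _.
Arguments sc_level {R} E m.
Arguments sc_lift {R E} m _.
Arguments sc_trace {R E} A m.
Arguments sc_real {R}.
Arguments sc_rV {R} n.

(** * sc-smoothness *)

Section sc_smooth.
Context {R : realType}.

(** In what follows a map between subsets [U] of [E 0] and [V] of [F 0] is
    a function [E 0 -> F 0] whose values outside [U] are irrelevant. *)

Definition sc0 (E F : scBanach R) (U : set (E 0%N)) (V : set (F 0%N))
    (f : E 0%N -> F 0%N) :=
  forall m, (forall x, (U `&` sc_level E m) x -> (V `&` sc_level F m) (f x)) /\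
    {within sc_trace U m, continuous (fun x : E m => sc_lift m (f (sc_emb x)))}.

Definition is_sc_derivative (E F : scBanach R) (U : set (E 0%N))
    (f : E 0%N -> F 0%N) (x : E 1%N) (A : E 0%N -> F 0%N) :=
  [/\ linear A, continuous A &
    (fun h : E 1%N =>
       `|f (sc_emb (x + h)) - f (sc_emb x) - A (sc_emb h)| / `|h|)
      @ within [set h | sc_trace U 1 (x + h)] 0^' --> (0 : R)].

Definition sc_D (E F : scBanach R) (U : set (E 0%N)) (f : E 0%N -> F 0%N)
    (x : E 1%N) : E 0%N -> F 0%N :=
  xget (fun=> 0) [set A | is_sc_derivative U f x A].

Definition tangent_set (E : scBanach R) (U : set (E 0%N)) :
    set (sc_tangent E 0%N) :=
  [set xh | U (sc_emb (xh.1 : E 1%N))].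

Definition tangent_map (E F : scBanach R) (U : set (E 0%N)) (f : E 0%N -> F 0%N)
    (xh : sc_tangent E 0%N) : sc_tangent F 0%N :=
  (sc_lift 1 (f (sc_emb (xh.1 : E 1%N))), sc_D U f xh.1 xh.2).

Definition sc1 (E F : scBanach R) (U : set (E 0%N)) (V : set (F 0%N))
    (f : E 0%N -> F 0%N) :=
  [/\ sc0 U V f,
      forall x : E 1%N, sc_trace U 1 x -> exists A, is_sc_derivative U f x A &
      sc0 (tangent_set U) (tangent_set V) (tangent_map U f)].

Fixpoint iter_sc_tangent k (E : scBanach R) : scBanach R :=
  if k is k'.+1 then iter_sc_tangent k' (sc_tangent E) else E.

Fixpoint iter_tangent_set k (E : scBanach R) (U : set (E 0%N)) :
    set (iter_sc_tangent k E 0%N) :=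
  match k return set (iter_sc_tangent k E 0%N) with
  | 0 => U
  | k'.+1 => @iter_tangent_set k' _ (tangent_set U)
  end.

Fixpoint iter_tangent_map k (E F : scBanach R) (U : set (E 0%N))
    (f : E 0%N -> F 0%N) : iter_sc_tangent k E 0%N -> iter_sc_tangent k F 0%N :=
  match k return iter_sc_tangent k E 0%N -> iter_sc_tangent k F 0%N with
  | 0 => f
  | k'.+1 => @iter_tangent_map k' _ _ (tangent_set U) (tangent_map U f)
  end.

Fixpoint sck k (E F : scBanach R) (U : set (E 0%N)) (V : set (F 0%N))
    (f : E 0%N -> F 0%N) : Prop :=
  if k is k'.+1 then
    sck k' U V f /\ sc1 (@iter_tangent_set k' E U) (@iter_tangent_set k' F V)
                        (@iter_tangent_map k' E F U f)
  else sc0 U V f.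

Definition sc_smooth (E F : scBanach R) (U : set (E 0%N)) (V : set (F 0%N))
    (f : E 0%N -> F 0%N) :=
  forall k, sck k U V f.

(** * Partial quadrants, open tuples, retracts *)

Definition sc_operator (E F : scBanach R) (L : E 0%N -> F 0%N) :=
  linear L /\ sc0 setT setT L.

Definition sc_iso (E F : scBanach R) (L : E 0%N -> F 0%N) :=
  sc_operator L /\
  exists L', [/\ sc_operator L', cancel L L' & cancel L' L].

Definition partial_quadrant (E : scBanach R) (C : set (E 0%N)) :=
  [/\ closed C, convex_set C &
    exists n (W : scBanach R) (L : E 0%N -> sc_sum (sc_rV n) W 0%N),
      sc_iso L /\
      L @` C = [set aw : 'rV[R]_n * W 0%N | forall i, 0 <= aw.1 ord0 i]].

Definition relatively_open (T : topologicalType) (A U : set T) :=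
  exists2 O, open O & U = A `&` O.

Record open_tuple := OpenTuple {
  ambient : scBanach R;
  quadrant : set (ambient 0%N);
  odom : set (ambient 0%N);
  quadrantP : partial_quadrant quadrant;
  odom_open : relatively_open quadrant odom }.

Arguments quadrant o _ : clear implicits.
Arguments odom o _ : clear implicits.

Record retract := Retract {
  rtuple :> open_tuple;
  retraction : ambient rtuple 0%N -> ambient rtuple 0%N;
  retraction_smooth : sc_smooth (odom rtuple) (odom rtuple) retraction;
  retraction_idem : forall x, odom rtuple x ->
    retraction (retraction x) = retraction x }.

Arguments retraction r _ : clear implicits.

Definition rimage (O : retract) : set (ambient O 0%N) :=
  retraction O @` odom O.

(** [T_xO], for [x] in [O_1] *)
Definition rtangent (O : retract) (x : ambient O 1%N) : set (ambient O 0%N) :=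
  range (sc_D (odom O) (retraction O) x).

End sc_smooth.

Arguments open_tuple : clear implicits.
Arguments retract : clear implicits.
Arguments quadrant {R} o _.
Arguments odom {R} o _.
Arguments retraction {R} r _.
Arguments rimage {R} O _.
Arguments rtangent {R} O x _.

(** * M-polyfolds *)

(** The map [f] on [D], expressed through the injective coordinates [phi] on
    [D]: [f \o phi^-1] on [phi @` D]. *)
Definition read_through (Y A : Type) (B : pointedType) (D : Y -> Prop)
    (phi : Y -> A) (f : Y -> B) : A -> B :=
  fun a => get [set b | exists y, [/\ D y, phi y = a & b = f y]].

Section charts.
Context {R : realType}.

Record chart (X : Type) := Chart {
  cdom : set X;
  cretract :> retract R;
  ccoord : X -> ambient cretract 0%N;
  ccoord_bij : set_bij cdom (rimage cretract) ccoord }.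

Arguments cdom {X} c _.
Arguments ccoord {X} c _.

Variable X : Type.
Implicit Types c : chart X.

Definition transition c c' : ambient c 0%N -> ambient c' 0%N :=
  read_through (cdom c `&` cdom c') (ccoord c) (ccoord c').

Arguments transition c c' _ : clear implicits.

Definition overlap c c' : set (ambient c 0%N) :=
  ccoord c @` (cdom c `&` cdom c').

Arguments overlap c c' _ : clear implicits.

(** The relatively open subset [overlap c c'] of the retract [rimage c] is the
    image of the restriction of [retraction c] to [overlap_dom c c']. *)
Definition overlap_dom c c' : set (ambient c 0%N) :=
  odom c `&` retraction c @^-1` overlap c c'.

Arguments overlap_dom c c' _ : clear implicits.

Definition transition_open_smooth c c' :=
  relatively_open (rimage c) (overlap c c') /\
  sc_smooth (overlap_dom c c') (odom c') (transition c c' \o retraction c).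

Definition chart_compatible c c' :=
  transition_open_smooth c c' /\ transition_open_smooth c' c.

(** [X] with the topology generated by the domains of the charts in [A]. As
    the type [chart X] quantifies over Banach spaces, it is too large for
    [set (chart X)] to be well-formed. *)
Definition chart_space (A : chart X -> Prop) : Type := X.

HB.instance Definition _ A := gen_eqMixin (chart_space A).
HB.instance Definition _ A := gen_choiceMixin (chart_space A).
HB.instance Definition _ A := @isSubBaseTopological.Build (chart_space A)
  (set X) [set V | exists2 c, A c & V = cdom c] id.

End charts.

Arguments chart R X : clear implicits.
Arguments cdom {R X} c _.
Arguments ccoord {R X} c _.
Arguments transition {R X} c c' _.
Arguments overlap_dom {R X} c c' _.

Definition paracompact (T : topologicalType) :=
  forall U : set (set T), (forall A, U A -> open A) ->
    \bigcup_(A in U) A = setT ->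
  exists V : set (set T),
    [/\ forall B, V B -> open B,
        \bigcup_(B in V) B = setT,
        forall B, V B -> exists2 A, U A & B `<=` A &
        forall x : T, exists2 N, nbhs x N &
          finite_set [set B | V B /\ B `&` N !=set0]].

Record Mpolyfold (R : realType) := MPolyfold {
  point_of :> Type;
  atlas : chart R point_of -> Prop;
  atlas_cover : forall p, exists2 c, atlas c & cdom c p;
  atlas_compatible : forall c c', atlas c -> atlas c' -> chart_compatible c c';
  atlas_maximal : forall c,
    (forall c', atlas c' -> chart_compatible c c') -> atlas c;
  Mpolyfold_paracompact : paracompact (chart_space atlas);
  Mpolyfold_hausdorff : hausdorff_space (chart_space atlas) }.

Definition modeled_on (R : realType) (P : scBanach R -> Prop)
    (X : Mpolyfold R) :=
  forall p : X, exists c, [/\ atlas c, cdom c p & P (ambient c)].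

(** * Reflexive and Hilbert M-polyfolds *)

Section duality.
Context {R : realType} {V : normedModType R}.
Variable S : set V.

(** The topological dual of the linear subspace [S] of [V]; functionals are
    identified when they agree on [S]. *)
Definition cont_dual : set (V -> R) :=
  [set l | (forall k x y, S x -> S y -> l (k *: x + y) = k * l x + l y) /\
           {within S, continuous l}].

Definition dual_norm (l : V -> R) : R :=
  sup [set `|l x| | x in S `&` [set x | `|x| <= 1]].

End duality.

(** Every continuous linear form on the dual is the evaluation at a point. *)
Definition reflexive_space (R : realType) (V : normedModType R) :=
  forall Phi : (V -> R) -> R,
    (forall k l l', cont_dual setT l -> cont_dual setT l' ->
      Phi (fun x => k * l x + l' x) = k * Phi l + Phi l') ->
    (exists M, forall l, cont_dual setT l ->
      `|Phi l| <= M * dual_norm setT l) ->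
  exists x, forall l, cont_dual setT l -> Phi l = l x.

(** The norm comes from an inner product. *)
Definition hilbert_space (R : realType) (V : completeNormedModType R) :=
  exists ip : V -> V -> R,
    [/\ forall k x y z, ip (k *: x + y) z = k * ip x z + ip y z,
        forall x y, ip x y = ip y x &
        forall x, ip x x = `|x| ^+ 2].

Definition reflexive_Mpolyfold (R : realType) : Mpolyfold R -> Prop :=
  modeled_on (fun E => forall n, reflexive_space (E n)).

Definition Hilbert_Mpolyfold (R : realType) : Mpolyfold R -> Prop :=
  modeled_on (fun E => hilbert_space (E 0%N)).

(** * Tangent spaces *)

Section tangent.
Context {R : realType}.
Variable X : Mpolyfold R.
Implicit Types (p : X) (c : chart R X).

Definition in_level m p :=
  exists c, [/\ atlas c, cdom c p & sc_level (ambient c) m (ccoord c p)].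

(** The coordinates of [p] in [X_1], as a point of [E_1] *)
Definition coord1 c p : ambient c 1%N := sc_lift 1 (ccoord c p).

Arguments coord1 c p : clear implicits.

Definition chart_vector := {c : chart R X & ambient c 0%N}.

Definition vector_at p (a : chart_vector) :=
  let: existT c v := a in
  [/\ atlas c, cdom c p & rtangent c (coord1 c p) v].

Definition same_vector p (a b : chart_vector) :=
  let: existT c v := a in let: existT c' v' := b in
  v' = sc_D (overlap_dom c c') (transition c c' \o retraction c)
            (coord1 c p) v.

Definition tangent p : Type :=
  {S : chart_vector -> Prop | exists2 a, vector_at p a &
    S = (fun b => vector_at p b /\ same_vector p a b)}.

(** The representative of a tangent vector in the chart [c] around [p]; this
    bijection onto [rtangent (coord1 c p)] carries the linear, topological and
    sc-structures of the latter to [T_pX]. *)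
Definition tangent_coord c p (t : tangent p) : ambient c 0%N :=
  get [set v | sval t (existT _ c v)].

(** [TX (+) TX] *)
Record double_tangent := DoubleTangent {
  foot : X;
  foot_level : in_level 1 foot;
  vec1 : tangent foot;
  vec2 : tangent foot }.

(** The chart of [TX (+) TX] induced by a chart [c] of [X] takes its values in
    the retract of [E^1 (+) E (+) E] with the retraction
    [(x, v, w) |-> (r x, Dr(x) v, Dr(x) w)]. *)
Definition double_model c : scBanach R :=
  sc_sum (sc_tangent (ambient c)) (ambient c).

Definition double_dom c (t : double_tangent) : Prop := cdom c (foot t).

Definition double_coord c (t : double_tangent) : double_model c 0%N :=
  (coord1 c (foot t), tangent_coord c (vec1 t), tangent_coord c (vec2 t)).

Definition double_odom c : set (double_model c 0%N) :=
  [set xvw | odom c (sc_emb (xvw.1.1 : ambient c 1%N))].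

Definition double_retraction c (xvw : double_model c 0%N) :
    double_model c 0%N :=
  let: (x, v, w) := xvw in
  let Dr := sc_D (odom c) (retraction c) x in
  (sc_lift 1 (retraction c (sc_emb (x : ambient c 1%N))), Dr v, Dr w).

Definition double_smooth (g : double_tangent -> R) :=
  forall c, atlas c ->
    sc_smooth (F := sc_real) (@double_odom c) setT
      (read_through (@double_dom c) (@double_coord c) g
         \o @double_retraction c).

(** * Strong Riemannian metrics *)

(** [g_p] in the chart [c] around [p] *)
Definition fiber_form (g : double_tangent -> R) p (hp : in_level 1 p) c :
    sc_sum (ambient c) (ambient c) 0%N -> sc_real 0%N :=
  read_through (fun=> True)
    (fun t : tangent p * tangent p =>
       (tangent_coord c t.1, tangent_coord c t.2))
    (fun t => g (DoubleTangent hp t.1 t.2)).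

Definition bilinear_on (V : lmodType R) (S : set V) (G : V * V -> R) :=
  (forall k x y z, S x -> S y -> S z ->
    G (k *: x + y, z) = k * G (x, z) + G (y, z)) /\
  (forall k x y z, S x -> S y -> S z ->
    G (x, k *: y + z) = k * G (x, y) + G (x, z)).

(** For [G] bilinear on the linear subspace [S], the map [v |-> G(v, .)] is a
    linear homeomorphism of [S] onto its dual. *)
Definition dual_iso (V : normedModType R) (S : set V) (G : V * V -> R) :=
  [/\ forall v, S v -> cont_dual S (fun w => G (v, w)),
      forall v v', S v -> S v' ->
        (forall w, S w -> G (v, w) = G (v', w)) -> v = v',
      forall l, cont_dual S l ->
        exists2 v, S v & forall w, S w -> G (v, w) = l w,
      forall v, S v -> forall e, 0 < e -> exists2 d, 0 < d &
        forall v', S v' -> `|v' - v| < d ->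
          dual_norm S (fun w => G (v', w) - G (v, w)) < e &
      forall v, S v -> forall e, 0 < e -> exists2 d, 0 < d &
        forall v', S v' ->
          dual_norm S (fun w => G (v', w) - G (v, w)) < d -> `|v' - v| < e].

Definition strong_Riemannian_metric (g : double_tangent -> R) :=
  double_smooth g /\
  forall p (hp : in_level 1 p) c, atlas c -> cdom c p ->
    let S := rtangent c (coord1 c p) in
    let G := fiber_form g hp (c := c) in
    [/\ bilinear_on S G,
        sc0 (S `*` S : set (sc_sum (ambient c) (ambient c) 0%N)) setT G,
        forall v w, S v -> S w -> G (v, w) = G (w, v),
        dual_iso S G &
        forall v, S v -> v != 0 -> 0 < G (v, v)].

End tangent.

(* Main.v *)
(** The Hilbert norm is smooth on [E_0], so that [beta (q ^ 2 - |x - d| ^ 2)], with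
    [beta] the flat function [exp(-1/t)], is an sc-smooth bump function in any
    Hilbert chart; as [E_1 -> E_0] is compact with dense image, [E_0] is separable
    and countably many such bumps suffice for each chart domain. Paracompactness
    and Milnor's trick turn them into a locally finite family of sc-smooth
    functions [a_i >= 0] on [X] without common zero, each supported in a Hilbert
    chart [phi_i]. The sum of the [a_i <d phi_i, d phi_i>] is an sc-smooth metric,
    no normalization of the [a_i] being needed. In a fibre it is a bounded form
    that is coercive on the closed subspace [Im Dr], hence strong by the Riesz
    representation theorem.

    The sc-calculus needed is the chain rule, whose proof combines the mean value
    inequality with the compactness of the inclusions [E_1 -> E_0], together with
    the smoothness of operators and of bounded bilinear maps; the latter two
    classes are stable under the tangent functor, so that [sc^k] follows by
    induction on [k]. *)
From HB Require Import structures.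
Require Import Defs.
From mathcomp Require Import all_boot all_order all_algebra.
From mathcomp Require Import all_classical all_reals all_analysis.
From mathcomp Require Import ring lra.

Set Implicit Arguments.
Unset Strict Implicit.
Unset Printing Implicit Defensive.

Import Order.TTheory GRing.Theory Num.Theory.
Import numFieldNormedType.Exports.

Local Open Scope classical_set_scope.
Local Open Scope ring_scope.

Arguments sc_emb {R E m} _ : simpl never.

(** * Linear maps and embeddings of levels *)

(** Smoothness is only ever tested on relatively open subsets of cones, never on a retract: a
    function on [X] is read as [f \o phi^-1 \o r], a transition map as [phi' \o phi^-1 \o r].
    Differentiating such a map absorbs [Dr], so the differentials [tlin p c c'] form a cocycle whose
    diagonal terms are the projections onto the tangent spaces; the facts about tangent vectors come
    from this cocycle. [sc_D] is picked by choice, so computing it means exhibiting one derivative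
    and invoking uniqueness, for which the domain must span in the sense of [sc_cone]. Uniqueness
    also lets tangent maps be restricted and glued. Translation by a point outside [E_oo] is not an
    sc-map, so a ball about an arbitrary centre is described by expanding the inner product. The
    bumps inside one chart domain are infinitely many and overlap, so a locally finite cover does
    not yet make them a locally finite family. One positive weight at [p] already makes the form
    coercive there, with a constant depending on [p] and on the chart; no uniformity in [p] is asked
    for. *)

Section linear_maps.
Context {R : realType}.

Section algebra.
Variables (V W : lmodType R) (f : V -> W) (lf : linear f).

Lemma lin0 : f 0 = 0.
Proof. by have := lf (-1) 0 0; rewrite scaler0 addr0 scaleN1r addNr. Qed.

Lemma linD x y : f (x + y) = f x + f y.
Proof. by rewrite -[x in LHS]scale1r lf scale1r. Qed.

Lemma linZ a x : f (a *: x) = a *: f x.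
Proof. by rewrite -[a *: x]addr0 lf lin0 addr0. Qed.

Lemma linN x : f (- x) = - f x.
Proof. by rewrite -scaleN1r linZ scaleN1r. Qed.

Lemma linB x y : f (x - y) = f x - f y.
Proof. by rewrite linD linN. Qed.

End algebra.

Lemma linear_comp (V W Z : lmodType R) (f : V -> W) (g : W -> Z) :
  linear f -> linear g -> linear (g \o f).
Proof. by move=> lf lg a x y /=; rewrite lf lg. Qed.

Lemma linear_bound (V W : normedModType R) (f : V -> W) :
  linear f -> continuous f -> exists2 M : R, 0 < M & forall x, `|f x| <= M * `|x|.
Proof.
move=> lf cf; pose L := GRing.isLinear.Build R V W *:%R f lf.
pose F : {linear V -> W} := HB.pack f L.
have /linear_boundedP/pinfty_ex_gt0 [M M0 MB] : bounded_near F (nbhs 0).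
  exact/linear_bounded_continuous.
by exists M.
Qed.

Lemma linear_continuous_of_bound (V W : normedModType R) (f : V -> W) (M : R) :
  linear f -> (forall x, `|f x| <= M * `|x|) -> continuous f.
Proof.
move=> lf fM x; apply/cvgrPdist_lt => e e0.
have M0 : 0 < Num.max M 1 by rewrite lt_max ltr01 orbT.
near=> y; rewrite -linB //; apply: le_lt_trans (fM _) _.
apply: (@le_lt_trans _ _ (Num.max M 1 * `|x - y|)).
  by rewrite ler_wpM2r // le_max lexx.
rewrite -ltr_pdivlMl //; near: y.
by apply: cvgr_dist_lt => //; rewrite mulrC divr_gt0.
Unshelve. all: by end_near. Qed.

End linear_maps.

Section cvg_eps.
Context {R : realType}.
Variables (V W : normedModType R).

Lemma withinP (A : set V) (f : V -> W) :
  {within A, continuous f} <->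
  (forall x, A x -> forall e, 0 < e -> exists2 d : R, 0 < d &
     forall y, A y -> `|y - x| < d -> `|f y - f x| < e).
Proof.
rewrite subspace_continuousP; split => cf x Ax.
  move=> e e0; have := cf x Ax.
  move=> /cvgrPdist_lt /(_ _ e0); rewrite near_withinE => /nbhs_normP [d /= d0 H].
  exists d => // y Ay yx; rewrite distrC; apply: H => //=; by rewrite distrC.
apply/cvgrPdist_lt => e e0; rewrite near_withinE.
have [d d0 H] := cf _ Ax e e0; apply/nbhs_normP; exists d => //= y /= yx Ay.
by rewrite distrC; apply: H => //; rewrite distrC.
Qed.

Lemma open_ball (O : set V) x : open O -> O x ->
  exists2 d : R, 0 < d & forall y, `|y - x| < d -> O y.
Proof.
move=> oO Ox; have /nbhs_normP [d /= d0 H] : nbhs x O by apply: open_nbhs_nbhs.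
by exists d => // y yx; apply: H => /=; rewrite distrC.
Qed.

Lemma ball_openP (O : set V) : (forall x, O x ->
  exists2 d : R, 0 < d & forall y, `|y - x| < d -> O y) -> open O.
Proof.
move=> H; rewrite openE => x Ox; apply/nbhs_normP.
have [d d0 dH] := H _ Ox; exists d => //= y /=; rewrite distrC; exact: dH.
Qed.

End cvg_eps.

Lemma within_comp {R : realType} (V W Z : normedModType R) (A : set V)
    (B : set W) (f : V -> W) (g : W -> Z) :
  (forall x, A x -> B (f x)) -> {within A, continuous f} ->
  {within B, continuous g} -> {within A, continuous (g \o f)}.
Proof.
move=> AB /withinP cf /withinP cg; apply/withinP => x Ax e e0.
have [d d0 H] := cg _ (AB _ Ax) _ e0; have [d' d'0 H'] := cf _ Ax _ d0.
by exists d' => // y Ay yx; apply: H (AB _ Ay) _; exact: H'.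
Qed.

Section embedding.
Context {R : realType}.
Implicit Types E F : scBanach R.

(** The record asks the inclusions to be compact but not continuous; continuity follows because the
    image of the unit ball, having compact closure, is bounded. *)
Lemma incl_continuous E m : continuous (sc_incl E m).
Proof.
apply/linear_bounded_continuous/ex_bound.
have /compact_bounded [M [Mr MB]] := @sc_incl_compact _ E m.
exists (M + 1); apply/nbhs_norm0P; exists 1 => //= x /= x1.
apply: (MB (M + 1)); first by rewrite ltrDl.
by apply: subset_closure; exists x => //=; exact: ltW.
Qed.

Lemma emb_linear E m : linear (@sc_emb R E m).
Proof.
elim: m => [//|m IH] k x y.
by rewrite /sc_emb /= linearP; exact: IH.
Qed.

Lemma embD E m (x y : E m) : sc_emb (x + y) = sc_emb x + sc_emb y.
Proof. exact: linD (emb_linear (m := m)) x y. Qed.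

Lemma embZ E m (t : R) (x : E m) : sc_emb (t *: x) = t *: sc_emb x.
Proof. exact: linZ (emb_linear (m := m)) t x. Qed.

Lemma embB E m (x y : E m) : sc_emb (x - y) = sc_emb x - sc_emb y.
Proof. exact: linB (emb_linear (m := m)) x y. Qed.

Lemma emb0 E m : sc_emb (0 : E m) = 0.
Proof. exact: lin0 (emb_linear (m := m)). Qed.

Lemma emb_continuous E m : continuous (@sc_emb R E m).
Proof.
elim: m => [x|m IH x]; first exact: cvg_id.
apply: (@continuous_comp _ _ _ (sc_incl E m) (@sc_emb R E m)).
  exact: incl_continuous.
exact: IH.
Qed.

Lemma emb_inj E m : injective (@sc_emb R E m).
Proof.
elim: m => [//|m IH] x y /=; rewrite /sc_emb /= => h.
by apply: (@sc_incl_inj _ E m); apply: IH.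
Qed.

Lemma emb_bound E m : exists2 M : R, 0 < M & forall x : E m, `|sc_emb x| <= M * `|x|.
Proof. exact: linear_bound (emb_linear (m := m)) (@emb_continuous E m). Qed.

Lemma liftK E m (y : E m) : sc_lift m (sc_emb y) = y.
Proof. by rewrite /sc_lift; apply: emb_inj; case: xgetP => [x _ //|/(_ y) []]. Qed.

Lemma lift_eq E m (y : E m) x : sc_emb y = x -> sc_lift m x = y.
Proof. by move=> <-; exact: liftK. Qed.

Lemma emb_lift E m x : sc_level E m x -> sc_emb (sc_lift m x) = x.
Proof. by case=> y _ <-; rewrite liftK. Qed.

Lemma lift0 E (x : E 0%N) : sc_lift 0 x = x.
Proof. exact: lift_eq. Qed.

Lemma level_emb E m (y : E m) : sc_level E m (sc_emb y).
Proof. by exists y. Qed.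

Lemma emb_shift E m (x : sc_shift E m) :
  sc_emb (E := E) (m := 1) (@sc_emb R (sc_shift E) m x)
  = sc_emb (E := E) (m := m.+1) x.
Proof. by rewrite [RHS]shift_emb. Qed.

Lemma emb_sum E F m (x : sc_sum E F m) : sc_emb x = (sc_emb x.1, sc_emb x.2).
Proof. exact: sum_emb. Qed.

Lemma level_shift E m (x : E 1%N) :
  sc_level (sc_shift E) m x <-> sc_level E m.+1 (sc_emb x).
Proof.
split=> [[y _ <-]|[y _ yx]]; first by exists y => //; rewrite -emb_shift.
by exists y => //; apply: (@emb_inj E 1); rewrite (@emb_shift E m y).
Qed.

Lemma level_sum E F m (x : sc_sum E F 0%N) :
  sc_level (sc_sum E F) m x <-> sc_level E m x.1 /\ sc_level F m x.2.
Proof.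
split=> [[y _ <-]|]; first by rewrite emb_sum; split; exact: level_emb.
by case: x => a b /= [[y _ <-] [z _ <-]]; exists (y, z) => //; rewrite emb_sum.
Qed.

Lemma emb_const (V : completeNormedModType R) (cV : _) m (x : V) :
  @sc_emb R (sc_const (V := V) cV) m x = x.
Proof. by elim: m x => //= m IH x; rewrite -[RHS]IH. Qed.

Lemma level_const (V : completeNormedModType R) (cV : _) m (x : V) :
  sc_level (sc_const (V := V) cV) m x.
Proof. by exists x => //; rewrite emb_const. Qed.

Lemma level_densely E : dense [set x | forall m, sc_level E m x].
Proof.
move=> O O0 oO; have [x [Ox xi]] := @sc_infty_dense _ E 0 O O0 oO.
by exists x; split => // m; have [y ey] := xi m; exists y.
Qed.

Lemma dense_eq (V W : normedModType R) (D : set V) (f g : V -> W) :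
  dense D -> continuous f -> continuous g ->
  (forall x, D x -> f x = g x) -> f =1 g.
Proof.
move=> dD cf cg fg x; apply/eqP; rewrite -subr_eq0 -normr_le0.
apply/ler_addgt0Pr => e e0; rewrite add0r; apply: contrapT => /negP.
rewrite -ltNge => xe.
pose h y := `|f y - g y|.
have ch : continuous h.
  by move=> y; apply: cvg_norm; apply: cvgB; [exact: cf|exact: cg].
have [||y [/= ye Dy]] := dD [set y | e < h y].
- by exists x.
- apply: (@open_comp _ _ h [set t | e < t]); last exact: open_gt.
  by move=> y _; exact: ch.
by move: ye; rewrite /= /h fg // subrr normr0 ltNge (ltW e0).
Qed.

End embedding.

(** * Sc-derivatives and the chain rule *)

Section derivative.
Context {R : realType}.
Implicit Types E F G : scBanach R.

(** The convexity and spanning properties of partial quadrants that make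
    sc-derivatives unique; unlike the partial quadrants themselves, they visibly
    pass to products and to tangent sets. *)
Definition sc_cone E (K : set (E 0%N)) :=
  [/\ forall x y, K x -> K y -> K (x + y),
      forall (t : R) x, 0 <= t -> K x -> K (t *: x) &
      forall m (x : E m), exists y z : E m,
        [/\ K (sc_emb y), K (sc_emb z) & x = y - z]].

Definition sc_domain E (U : set (E 0%N)) :=
  exists2 K, sc_cone K & relatively_open K U.

Lemma sc_domainT E : sc_domain (E := E) setT.
Proof.
exists setT; last by exists setT; [exact: openT|rewrite setTI].
by split=> // m x; exists x, 0; rewrite subr0.
Qed.

Lemma sc_domainI E (U O : set (E 0%N)) : sc_domain U -> open O ->
  sc_domain (U `&` O).
Proof.
move=> [K cK [Q oQ ->]] oO; exists K => //; exists (Q `&` O).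
  exact: openI.
by rewrite setIA.
Qed.

Lemma sc_cone_prod E F (K : set (E 0%N)) (L : set (F 0%N)) :
  sc_cone K -> sc_cone L ->
  sc_cone (E := sc_sum E F) [set x : E 0%N * F 0%N | K x.1 /\ L x.2].
Proof.
move=> [KD KZ KB] [LD LZ LB]; split.
- by move=> [a b] [c d] /= [? ?] [? ?]; split; [exact: KD|exact: LD].
- by move=> t [a b] /= t0 [? ?]; split; [exact: KZ|exact: LZ].
- move=> m [a b]; have [a1 [a2 [? ? ->]]] := KB m a.
  have [b1 [b2 [? ? ->]]] := LB m b.
  by exists (a1, b1), (a2, b2); split => //; rewrite emb_sum.
Qed.

Lemma sc_domain_prod E F (U : set (E 0%N)) (V : set (F 0%N)) :
  sc_domain U -> sc_domain V ->
  sc_domain (E := sc_sum E F) [set x : E 0%N * F 0%N | U x.1 /\ V x.2].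
Proof.
move=> [K cK [N oN ->]] [L cL [Q oQ ->]].
exists [set x : E 0%N * F 0%N | K x.1 /\ L x.2]; first exact: sc_cone_prod.
exists [set x : E 0%N * F 0%N | N x.1 /\ Q x.2].
  apply: openI.
  - by apply: open_comp => // x _; exact: cvg_fst.
  - by apply: open_comp => // x _; exact: cvg_snd.
by apply/seteqP; split => x /=; tauto.
Qed.

Lemma sc_domain_shift E (U : set (E 0%N)) : sc_domain U ->
  sc_domain (E := sc_shift E) [set x : E 1%N | U (sc_emb x)].
Proof.
move=> [K [KD KZ KB] [N oN ->]]; exists [set x : E 1%N | K (sc_emb x)].
  split=> [x y Kx Ky|t x t0 Kx|m x]; rewrite /mkset.
  - by rewrite embD; exact: KD.
  - by rewrite embZ; exact: KZ.
  - have [y [z [Ky Kz ->]]] := KB m.+1 x; exists y, z; split => //.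
    + by rewrite (@emb_shift _ E m y).
    + by rewrite (@emb_shift _ E m z).
exists [set x : E 1%N | N (sc_emb x)] => //.
by apply: open_comp => // x _; exact: emb_continuous.
Qed.

Lemma sc_domain_tangent E (U : set (E 0%N)) : sc_domain U ->
  sc_domain (tangent_set U).
Proof.
move=> dU; have := sc_domain_prod (sc_domain_shift dU) (sc_domainT E).
by congr sc_domain; apply/seteqP; split => x /=; rewrite /tangent_set; tauto.
Qed.

Lemma sc_cone_segment E (K : set (E 0%N)) x y (t : R) : sc_cone K ->
  0 <= t <= 1 -> K x -> K (x + y) -> K (x + t *: y).
Proof.
move=> [KD KZ _] /andP[t0 t1] Kx Kxy.
have -> : x + t *: y = (1 - t) *: x + t *: (x + y).
  by rewrite scalerBl scale1r scalerDr addrA subrK.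
by apply: KD; apply: KZ => //; rewrite subr_ge0.
Qed.

(** Convexity of the cone keeps the segment in [K], smallness of [y] keeps it in the open set. The
    chain rule applies the mean value inequality along such segments. *)
Lemma sc_domain_segment E (U : set (E 0%N)) (x : E 0%N) : sc_domain U -> U x ->
  exists2 d : R, 0 < d & forall y (t : R), `|y| < d -> U (x + y) ->
    0 <= t <= 1 -> U (x + t *: y).
Proof.
move=> [K cK [N oN ->]] [Kx Nx]; have [d d0 H] := open_ball oN Nx.
exists d => // y t yd [Ky _] t01; split; first exact: sc_cone_segment.
apply: H; rewrite addrC addKr normrZ; apply: le_lt_trans yd.
by case/andP: t01 => t0 t1; rewrite ger0_norm // ler_piMl.
Qed.

Section derivative_def.
Variables (E F : scBanach R) (U : set (E 0%N)) (f : E 0%N -> F 0%N).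

Lemma is_sc_derivativeP (x : E 1%N) (A : E 0%N -> F 0%N) :
  is_sc_derivative U f x A <->
  [/\ linear A, continuous A &
   forall e : R, 0 < e -> exists2 d : R, 0 < d & forall h : E 1%N, `|h| < d ->
     sc_trace U 1 (x + h) ->
     `|f (sc_emb (x + h)) - f (sc_emb x) - A (sc_emb h)| <= e * `|h|].
Proof.
split=> -[lA cA H]; split => //.
  move=> e e0; move/cvgrPdist_lt : H => /(_ _ e0); rewrite near_withinE.
  rewrite near_withinE => /nbhs_normP [d /= d0 H]; exists d => // h hd Uh.
  have [->|h0] := eqVneq h 0.
    by rewrite addr0 subrr emb0 (lin0 lA) subrr !normr0 mulr0.
  have hp : 0 < `|h| by rewrite normr_gt0.
  have := H h; rewrite /= sub0r normrN => /(_ hd h0 Uh).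
  by rewrite sub0r normrN ger0_norm ?divr_ge0 // ltr_pdivrMr // => /ltW.
apply/cvgrPdist_le => e e0; rewrite near_withinE near_withinE.
have [d d0 H'] := H _ e0; apply/nbhs_normP; exists d => //= h /=.
rewrite sub0r normrN => hd h0 Uh; rewrite sub0r normrN.
rewrite ger0_norm ?divr_ge0 // ler_pdivrMr ?normr_gt0 //; exact: H'.
Qed.

(** For [h] in the cone, [x + t h] stays in [U] for small [t > 0], so [t (A h - B h)] is [o(t)] and
    [A h = B h]. The cone spans [E 1], and [E 1] is dense in [E 0], where both maps are
    continuous. *)
Lemma sc_derivative_unique (x : E 1%N) (A B : E 0%N -> F 0%N) : sc_domain U ->
  sc_trace U 1 x ->
  is_sc_derivative U f x A -> is_sc_derivative U f x B -> A = B.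
Proof.
move=> [K cK [N oN UE]] Ux /is_sc_derivativeP [lA cA HA].
move=> /is_sc_derivativeP [lB cB HB].
have [Kx Nx] : (K `&` N) (sc_emb x) by rewrite -UE.
have [r r0 Nr] := open_ball oN Nx.
have [M M0 MB] := emb_bound E 1.
have [KD KZ KB] := cK.
have KE (h : E 1%N) : K (sc_emb h) -> A (sc_emb h) = B (sc_emb h).
  move=> Kh; apply/eqP; rewrite -subr_eq0 -normr_le0.
  have [->|h0] := eqVneq h 0.
    by rewrite emb0 (lin0 lA) (lin0 lB) subrr normr0.
  have hp : 0 < `|h| by rewrite normr_gt0.
  apply/ler_addgt0Pr => e e0; rewrite add0r.
  (* Two errors of size [e / (2 |h|) * t |h|] add up to [t * e], after which [t] cancels. *)
  have e'0 : 0 < e / (2 * `|h|) by rewrite divr_gt0 // mulr_gt0.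
  have [dA dA0 {}HA] := HA _ e'0; have [dB dB0 {}HB] := HB _ e'0.
  (* Short enough for both derivative estimates and, through the embedding bound [M], for [x + t h]
     to stay in [N]; the factor 2 makes the inequalities strict. *)
  pose t := Num.min (Num.min dA dB) (r / M) / (2 * `|h|).
  have m0 : 0 < Num.min (Num.min dA dB) (r / M).
    by rewrite !lt_min dA0 dB0 divr_gt0.
  have t0 : 0 < t by rewrite divr_gt0 // mulr_gt0.
  have th : t * `|h| < Num.min (Num.min dA dB) (r / M).
    rewrite /t invfM mulrA divfK ?gt_eqF // ltr_pdivrMr // mulr_natr.
    by rewrite mulr2n ltrDl.
  move: th; rewrite !lt_min => /andP[/andP[tA tB]].
  rewrite ltr_pdivlMr // => tr.
  have Uth : sc_trace U 1 (x + t *: h).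
    rewrite /sc_trace /= UE; split.
      by rewrite embD embZ; apply: KD => //; apply: KZ => //; exact: ltW.
    apply: Nr; rewrite embD [_ + _ - _]addrC addKr.
    by apply: le_lt_trans (MB _) _; rewrite normrZ gtr0_norm // mulrC.
  have nt : `|t *: h| = t * `|h| by rewrite normrZ gtr0_norm.
  have := HA (t *: h); rewrite nt => /(_ tA Uth).
  have := HB (t *: h); rewrite nt => /(_ tB Uth).
  rewrite embZ (linZ lA) (linZ lB) => hB hA.
  have : `|t *: A (sc_emb h) - t *: B (sc_emb h)| <=
         e / (2 * `|h|) * (t * `|h|) + e / (2 * `|h|) * (t * `|h|).
    set D := f _ - f _ in hA hB.
    have -> : t *: A (sc_emb h) - t *: B (sc_emb h) =
       (D - t *: B (sc_emb h)) - (D - t *: A (sc_emb h)).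
      by rewrite opprB [RHS]addrC addrA subrK.
    by apply: le_trans (ler_normB _ _) _; exact: lerD.
  rewrite -scalerBr normrZ gtr0_norm //.
  have -> : e / (2 * `|h|) * (t * `|h|) + e / (2 * `|h|) * (t * `|h|) = t * e.
    by field; rewrite gt_eqF.
  by rewrite ler_pM2l.
apply/funext.
apply: (dense_eq (@level_densely _ E)) => //.
move=> _ /(_ 1%N) [h _ <-].
have [y [z [Ky Kz ->]]] := KB _ h.
by rewrite embB (linB lA) (linB lB) !KE.
Qed.

Lemma sc_D_eq (x : E 1%N) (A : E 0%N -> F 0%N) : sc_domain U ->
  sc_trace U 1 x -> is_sc_derivative U f x A -> sc_D U f x = A.
Proof.
move=> dU Ux dA; rewrite /sc_D; case: xgetP => [B _ dB|/(_ A) //].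
exact: sc_derivative_unique dB dA.
Qed.

Lemma sc_DP (x : E 1%N) :
  (exists A, is_sc_derivative U f x A) -> is_sc_derivative U f x (sc_D U f x).
Proof. by case=> A dA; rewrite /sc_D; case: xgetP => [//|/(_ A)]. Qed.

End derivative_def.

Section derivative_change.
Variables (E F : scBanach R) (U : set (E 0%N)) (f : E 0%N -> F 0%N).

Lemma eq_is_sc_derivative (g : E 0%N -> F 0%N) (x : E 1%N) A :
  sc_trace U 1 x -> (forall y, U y -> f y = g y) ->
  is_sc_derivative U f x A -> is_sc_derivative U g x A.
Proof.
move=> Ux fg /is_sc_derivativeP [lA cA H]; apply/is_sc_derivativeP; split=> //.
move=> e e0; have [d d0 H'] := H _ e0; exists d => // h hd Uh.
by rewrite -!fg //; exact: H'.
Qed.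

Lemma is_sc_derivative_sub (U' : set (E 0%N)) (x : E 1%N) A :
  U' `<=` U -> is_sc_derivative U f x A -> is_sc_derivative U' f x A.
Proof.
move=> sU /is_sc_derivativeP [lA cA H]; apply/is_sc_derivativeP; split=> //.
move=> e e0; have [d d0 H'] := H _ e0; exists d => // h hd Uh.
by apply: H' => //; exact: sU.
Qed.

Lemma is_sc_derivative_local (O : set (E 0%N)) (x : E 1%N) A :
  open O -> O (sc_emb x) ->
  is_sc_derivative (U `&` O) f x A -> is_sc_derivative U f x A.
Proof.
move=> oO Ox /is_sc_derivativeP [lA cA H]; apply/is_sc_derivativeP; split=> //.
have [r r0 Nr] := open_ball oO Ox.
have [M M0 MB] := emb_bound E 1.
move=> e e0; have [d d0 H'] := H _ e0; exists (Num.min d (r / M)).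
  by rewrite lt_min d0 divr_gt0.
move=> h; rewrite lt_min ltr_pdivlMr // => /andP[hd hr] Uh; apply: H' => //.
split => //=; apply: Nr; rewrite embD [_ + _ - _]addrC addKr.
by apply: le_lt_trans (MB _) _; rewrite mulrC.
Qed.

End derivative_change.

(** No uniqueness is involved: [f] and [g] have the same set of derivatives at [x], and [xget]
    depends on that set only. *)
Lemma eq_sc_D E F (U : set (E 0%N)) (f g : E 0%N -> F 0%N) (x : E 1%N) :
  sc_trace U 1 x -> (forall y, U y -> f y = g y) -> sc_D U f x = sc_D U g x.
Proof.
move=> Ux fg; rewrite /sc_D; congr xget; apply/seteqP; split=> A /=.
  exact: eq_is_sc_derivative.
by apply: eq_is_sc_derivative => // y Uy; rewrite fg.
Qed.

End derivative.

(** The hypothesis is a Lipschitz estimate based at each [t], so [u] need not be differentiable. The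
    supremum [c] of the [s] with [|u s - u 0| <= M * s] has this property itself, and if [c < 1] the
    estimate based at [c] would produce a larger such [s]. *)
Lemma mean_value_inequality {R : realType} (V : normedModType R) (u : R -> V)
    (M : R) :
  (forall t, 0 <= t <= 1 -> exists2 d : R, 0 < d & forall s, 0 <= s <= 1 ->
     `|s - t| < d -> `|u s - u t| <= M * `|s - t|) ->
  `|u 1 - u 0| <= M.
Proof.
move=> H.
pose S := [set s : R | 0 <= s <= 1 /\ `|u s - u 0| <= M * s].
have S0 : S 0 by split; rewrite ?lexx ?ler01 // subrr normr0 mulr0.
have hS : has_sup S.
  by split; [exists 0|exists 1 => s [/andP[]]].
have [_ ubS] := hS; pose c := sup S.
have c01 : 0 <= c <= 1.
  apply/andP; split; first exact: (ub_le_sup ubS S0).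
  by apply: ge_sup => [|s [/andP[]]]; first by exists 0.
have [d d0 Hd] := H _ c01.
have [s Ss sc] := sup_adherent d0 hS.
have Sc : `|u c - u 0| <= M * c.
  have sc' : s <= c by exact: (ub_le_sup ubS Ss).
  case: Ss => s01 us.
  have := Hd _ s01; rewrite distrC ger0_norm ?subr_ge0 // => hs.
  have {}hs : `|u c - u s| <= M * (c - s).
    by rewrite distrC; apply: hs; rewrite ltrBlDr -ltrBlDl.
  have -> : u c - u 0 = (u c - u s) + (u s - u 0) by rewrite addrA subrK.
  apply: le_trans (ler_normD _ _) _.
  have -> : M * c = M * (c - s) + M * s by rewrite -mulrDr subrK.
  exact: lerD.
have [c1|c1] := leP 1 c.
  have {}c1 : c = 1 by apply/eqP; rewrite eq_le c1; case/andP: c01 => _ ->.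
  by move: Sc; rewrite c1 mulr1.
pose r := Num.min (d / 2) (1 - c).
have r0 : 0 < r by rewrite lt_min divr_gt0 // subr_gt0.
have rc1 : c + r <= 1 by rewrite -lerBrDl ge_min lexx orbT.
have r01 : 0 <= c + r <= 1.
  by rewrite rc1 addr_ge0 ?(ltW r0) //; case/andP: c01.
have : S (c + r).
  split=> //; have := Hd _ r01; rewrite [c + r - c]addrC addKr gtr0_norm //.
  have rd : r < d by rewrite gt_min ltr_pdivrMr // mulr_natr mulr2n ltrDl d0.
  move=> /(_ rd) hr.
  have -> : u (c + r) - u 0 = (u (c + r) - u c) + (u c - u 0).
    by rewrite addrA subrK.
  by apply: le_trans (ler_normD _ _) _; rewrite mulrDr addrC; exact: lerD.
by move/(ub_le_sup ubS); rewrite -/c gerDl leNgt r0.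
Qed.

(** * Sc-continuous maps *)

Section sc0_theory.
Context {R : realType}.
Implicit Types E F G : scBanach R.

(** Frees the levelwise maps from [sc_lift]: any [fm] lying over [f] will do, the embeddings being
    injective. *)
Lemma sc0P E F (U : set (E 0%N)) (V : set (F 0%N)) (f : E 0%N -> F 0%N) :
  sc0 U V f <-> forall m, exists fm : E m -> F m,
    (forall x, sc_trace U m x -> V (f (sc_emb x)) /\ sc_emb (fm x) = f (sc_emb x))
    /\ {within sc_trace U m, continuous fm}.
Proof.
split=> [sf m|sf m].
  have [H c] := sf m; exists (fun x : E m => sc_lift m (f (sc_emb x))).
  split=> // x Ux; have [|Vf lf] := H (sc_emb x).
    by split => //; exact: level_emb.
  by split => //; exact: emb_lift.
have [fm [H c]] := sf m; split.
  move=> x [Ux [y _ yx]]; move: Ux; rewrite -yx => Ux; have [Vf <-] := H _ Ux.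
  by split; [rewrite (H _ Ux).2; exact: Vf|exact: level_emb].
apply: subspace_eq_continuous c => x; rewrite inE => Ux.
by change (fm x = sc_lift m (f (sc_emb x))); rewrite -(H _ Ux).2 liftK.
Qed.

Lemma sc0_map E F (U : set (E 0%N)) (V : set (F 0%N)) f x :
  sc0 U V f -> U x -> V (f x).
Proof. by move=> sf Ux; case: ((sf 0%N).1 x) => //; split => //; exists x. Qed.

Lemma sc0_level E F (U : set (E 0%N)) (V : set (F 0%N)) f m x :
  sc0 U V f -> U x -> sc_level E m x -> sc_level F m (f x).
Proof. by move=> sf Ux lx; case: ((sf m).1 x). Qed.

Lemma sc0_emb E F (U : set (E 0%N)) (V : set (F 0%N)) f m (x : E m) :
  sc0 U V f -> sc_trace U m x ->
  sc_emb (sc_lift m (f (sc_emb x))) = f (sc_emb x).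
Proof.
by move=> sf Ux; apply: emb_lift; exact: sc0_level sf Ux (level_emb _).
Qed.

Lemma eq_sc0 E F (U : set (E 0%N)) (V : set (F 0%N)) (f g : E 0%N -> F 0%N) :
  (forall x, U x -> f x = g x) -> sc0 U V f -> sc0 U V g.
Proof.
move=> fg /sc0P sf; apply/sc0P => m; have [fm [H c]] := sf m.
by exists fm; split => // x Ux; rewrite -fg //; exact: H.
Qed.

Lemma sc0_comp E F G (U : set (E 0%N)) (V : set (F 0%N)) (W : set (G 0%N))
    (f : E 0%N -> F 0%N) (g : F 0%N -> G 0%N) :
  sc0 U V f -> sc0 V W g -> sc0 U W (g \o f).
Proof.
move=> /sc0P sf /sc0P sg; apply/sc0P => m.
have [fm [Hf cf]] := sf m; have [gm [Hg cg]] := sg m.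
have Vf x : sc_trace U m x -> sc_trace V m (fm x).
  by move=> Ux; rewrite /sc_trace /= (Hf _ Ux).2; exact: (Hf _ Ux).1.
exists (gm \o fm); split; last exact: within_comp Vf cf cg.
by move=> x Ux /=; rewrite -(Hf _ Ux).2; exact: Hg (Vf _ Ux).
Qed.

Lemma sc0_sub E F (U U' : set (E 0%N)) (V V' : set (F 0%N)) f :
  U' `<=` U -> (forall x, U' x -> V' (f x)) -> sc0 U V f -> sc0 U' V' f.
Proof.
move=> UU VV /sc0P sf; apply/sc0P => m; have [fm [H c]] := sf m.
exists fm; split=> [x Ux|].
  by split; [exact: VV|exact: (H _ (UU _ Ux)).2].
by apply: continuous_subspaceW c => x; exact: UU.
Qed.

Lemma sc0_eps E F (U : set (E 0%N)) (V : set (F 0%N)) f m (x : E m) (e : R) :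
  sc0 U V f -> sc_trace U m x -> 0 < e ->
  exists2 d : R, 0 < d & forall y : E m, sc_trace U m y -> `|y - x| < d ->
    `|sc_lift m (f (sc_emb y)) - sc_lift m (f (sc_emb x))| < e.
Proof. by move=> sf Ux e0; have /withinP H := (sf m).2; exact: H. Qed.

End sc0_theory.

Lemma subrACA (V : zmodType) (a b c d : V) :
  (a - b) - (c - d) = (a - c) - (b - d).
Proof. by rewrite !opprB [d - c]addrC addrACA [- b + d]addrC. Qed.

Section chain_rule.
Context {R : realType}.
Implicit Types E F G : scBanach R.

(** The compactness of [E 1 -> E 0] makes the difference quotients of [f]
    accumulate on a compact set, on which [Dg] is uniformly continuous; this
    replaces the continuity of [Dg] in operator norm, which sc-smoothness does
    not provide. *)
Lemma sc_derivative_uniform F G (V : set (F 0%N)) (W : set (G 0%N)) g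
    (y : F 1%N) (Q : set (F 0%N)) (e : R) :
  sc1 V W g -> sc_trace V 1 y -> compact Q -> 0 < e ->
  exists2 d : R, 0 < d & forall (z : F 1%N) q r, sc_trace V 1 z ->
    `|z - y| < d -> Q q -> `|r| < d ->
    `|sc_D V g z (q + r) - sc_D V g y (q + r)| <= e.
Proof.
move=> [_ _ sT] Vy cQ e0.
(* Level 0 of the sc-continuity of [Tg] contains the joint continuity of [(z, a) |-> Dg(z) a] on
   [F 1 x F 0]. *)
have Dcont q : exists2 d : R, 0 < d & forall (z : F 1%N) a, sc_trace V 1 z ->
    `|z - y| < d -> `|a - q| < d -> `|sc_D V g z a - sc_D V g y q| < e / 2.
  have e20 : 0 < e / 2 by rewrite divr_gt0.
  have [|d d0 H] := @sc0_eps _ (sc_tangent F) _ _ _ _ 0 (y, q) _ sT _ e20.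
    exact: Vy.
  exists d => // z a Vz zy aq; have := H (z, a) Vz.
  rewrite !lift0 prod_normE /= gt_max zy aq => /(_ isT).
  by rewrite prod_normE gt_max => /andP[].
pose P (d : R) q := forall (z : F 1%N) r, sc_trace V 1 z -> `|z - y| < d ->
   `|r| < d -> `|sc_D V g z (q + r) - sc_D V g y (q + r)| <= e.
(* Near covering along [d -> 0+] turns a radius at each [q0] into one radius valid on all of [Q]. *)
have /compact_near_coveringP /(_ R (0 : R)^'+ P _) cov := cQ.
have : \forall d \near (0 : R)^'+, Q `<=` P d.
  apply: cov => q0 _; have [d d0 H] := Dcont q0.
  exists ([set q | `|q - q0| < d / 2], [set t | t < d / 2]) => /=.
    split.
      apply/nbhs_normP; exists (d / 2); first by rewrite /= divr_gt0.
      by move=> q /=; rewrite distrC.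
    by apply: nbhs_right_lt; rewrite divr_gt0.
  move=> [q t] [/= qq td] z r Vz zy rt.
  have d2 : d / 2 <= d by rewrite ler_pdivrMr // ler_pMr // ler1n.
  have a : `|q + r - q0| < d.
    rewrite [q + r]addrC -addrA [d]splitr; apply: le_lt_trans (ler_normD _ _) _.
    by apply: ltrD => //; exact: lt_trans td.
  have zd : `|z - y| < d by apply: lt_le_trans zy _; rewrite (le_trans _ d2) // ltW.
  have h1 := H z _ Vz zd a.
  have h2 := H y (q + r) Vy; rewrite subrr normr0 in h2.
  have {}h2 := h2 d0 a.
  apply: le_trans (ler_distD (sc_D V g y q0) _ _) _; rewrite [e]splitr.
  by apply: lerD; [exact: ltW|rewrite distrC; exact: ltW].
move=> QP; near (0 : R)^'+ => d; exists d => // z q r Vz zy Qq rd.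
by apply: (_ : Q `<=` P d) => //; near: d.
Unshelve. all: by end_near. Qed.

(** With [k = f(x + h) - f(x)], the error splits into [g(y + k) - g(y) - Dg(y) k], bounded by the
    mean value inequality on the segment from [y] to [y + k], and [Dg(y) (k - A h)], bounded by the
    norm of [Dg(y)]. *)
Lemma sc_derivative_comp E F G (U : set (E 0%N)) (V : set (F 0%N))
    (W : set (G 0%N)) (f : E 0%N -> F 0%N) (g : F 0%N -> G 0%N) (x : E 1%N) A :
  sc_domain V -> sc0 U V f -> sc1 V W g -> sc_trace U 1 x ->
  is_sc_derivative U f x A ->
  is_sc_derivative U (g \o f) x (sc_D V g (sc_lift 1 (f (sc_emb x))) \o A).
Proof.
move=> dV sf sg Ux /is_sc_derivativeP [lA cA HA].
set y := sc_lift 1 (f (sc_emb x)).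
have ey : sc_emb y = f (sc_emb x) by exact: sc0_emb sf Ux.
have V1 (z : F 1%N) : V (sc_emb z) ->
    is_sc_derivative V g z (sc_D V g z).
  by move=> Vz; apply: sc_DP; case: sg => _ + _; exact.
have Vy : sc_trace V 1 y by rewrite /sc_trace /= ey; exact: sc0_map sf Ux.
have /is_sc_derivativeP [lB cB _] := V1 _ Vy.
apply/is_sc_derivativeP; split; first exact: linear_comp.
  by move=> z; apply: continuous_comp; [exact: cA|exact: cB].
move=> e e0.
have [MB MB0 HB] := linear_bound lB cB.
(* The increments [h / |h|] lie in the unit ball of [E 1], so [A] sends them into this compact
   set. *)
pose Q := A @` closure (sc_incl E 0%N @` [set h | `|h| <= 1]).
have cQ : compact Q.
  apply: continuous_compact; last exact: sc_incl_compact.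
  by apply: continuous_subspaceT.
(* Two thirds of [e] go to the mean value inequality, one third to [Dg(y) (k - A h)]. *)
have e30 : 0 < e / 3 by rewrite divr_gt0.
have [d1 d10 unif] := sc_derivative_uniform sg Vy cQ e30.
have [d2 d20 seg] := sc_domain_segment dV Vy.
have [MF MF0 HF] := emb_bound F 1.
(* The first bound puts the part [r] of [k / |h|] outside [Q] below [d1]; the second pays for the
   norm [MB] of [Dg(y)]. *)
pose e1 := Num.min (d1 / 2) (e / 3 / MB).
have e10 : 0 < e1 by rewrite lt_min !divr_gt0.
have [d3 d30 {}HA] := HA _ e10.
pose e2 := Num.min d1 (d2 / MF).
have e20 : 0 < e2 by rewrite lt_min d10 divr_gt0.
have [d4 d40 f1c] := sc0_eps sf Ux e20.
exists (Num.min d3 d4); first by rewrite lt_min d30.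
move=> h; rewrite lt_min => /andP[hd3 hd4] Uh.
have [->|h0] := eqVneq h 0.
  by rewrite addr0 subrr emb0 /= (lin0 lA) (lin0 lB) subrr !normr0 mulr0.
have hp : 0 < `|h| by rewrite normr_gt0.
pose k1 : F 1%N := sc_lift 1 (f (sc_emb (x + h))) - y.
have ek1 : sc_emb k1 = f (sc_emb (x + h)) - f (sc_emb x).
  by rewrite embB ey; congr (_ - _); exact: sc0_emb sf Uh.
have k1e2 : `|k1| < e2 by apply: f1c => //; rewrite addrC addKr.
move: k1e2; rewrite lt_min => /andP[k1d1]; rewrite ltr_pdivlMr // => k1d2.
have ek1d2 : `|sc_emb k1| < d2.
  by apply: le_lt_trans (HF _) _; rewrite mulrC.
have Vyk1 : V (sc_emb y + sc_emb k1).
  by rewrite ek1 ey addrC subrK; exact: sc0_map sf Uh.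
have {}seg t : 0 <= t <= 1 -> sc_trace V 1 (y + t *: k1).
  by move=> t01; rewrite /sc_trace /= embD embZ; exact: seg.
pose q := `|h|^-1 *: A (sc_emb h).
have Qq : Q q.
  exists (`|h|^-1 *: sc_emb h); last by rewrite (linZ lA).
  apply: subset_closure; exists (`|h|^-1 *: h); last exact: (@embZ _ E 1).
  by rewrite /= normrZ ger0_norm ?invr_ge0 // mulVf ?gt_eqF.
pose r := `|h|^-1 *: (sc_emb k1 - A (sc_emb h)).
have hAk : `|sc_emb k1 - A (sc_emb h)| <= e1 * `|h| by rewrite ek1; exact: HA.
have rd1 : `|r| < d1.
  rewrite normrZ ger0_norm ?invr_ge0 // mulrC ltr_pdivrMr //.
  apply: le_lt_trans hAk _; rewrite ltr_pM2r //.
  by rewrite gt_min ltr_pdivrMr // mulr_natr mulr2n ltrDl d10.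
have qr : sc_emb k1 = `|h| *: (q + r).
  by rewrite /q /r -scalerDr scalerA divff ?gt_eqF // scale1r addrC subrK.
have unifk t : 0 <= t <= 1 ->
    `|sc_D V g (y + t *: k1) (sc_emb k1) - sc_D V g y (sc_emb k1)|
    <= e / 3 * `|h|.
  move=> t01; have /is_sc_derivativeP [lC _ _] := V1 _ (seg _ t01).
  rewrite qr (linZ lC) (linZ lB) -scalerBr normrZ normr_id mulrC ler_pM2r //.
  apply: unif => //; first exact: seg.
  rewrite addrC addKr normrZ; apply: le_lt_trans k1d1.
  by case/andP: t01 => t0 t1; rewrite ger0_norm // ler_piMl.
(* Removing the linear part leaves a curve with slope [(Dg(y + t k1) - Dg(y)) k] at [t], which
   [unifk] makes small. *)
pose u t : G 0%N := g (sc_emb (y + t *: k1)) - t *: sc_D V g y (sc_emb k1).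
have : `|u 1 - u 0| <= 2 * (e / 3) * `|h|.
  apply: mean_value_inequality => t t01.
  have /is_sc_derivativeP [lC _ HC] := V1 _ (seg _ t01).
  (* The [+ 1] avoids a separate case [k1 = 0]. *)
  have k1p : 0 < `|k1| + 1 by rewrite ltr_wpDl.
  have e'0 : 0 < e / 3 * `|h| / (`|k1| + 1).
    by rewrite divr_gt0 ?mulr_gt0.
  have [d d0 {}HC] := HC _ e'0.
  exists (d / (`|k1| + 1)); first by rewrite divr_gt0.
  move=> s s01; rewrite ltr_pdivlMr // => st.
  have sk : `|(s - t) *: k1| < d.
    by rewrite normrZ; apply: le_lt_trans st; rewrite ler_wpM2l // lerDl.
  have yst : y + t *: k1 + (s - t) *: k1 = y + s *: k1.
    by rewrite -addrA -scalerDl addrC [s - t]addrC addrA subrr add0r addrC.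
  have := HC _ sk; rewrite yst => /(_ (seg _ s01)).
  rewrite embZ (linZ lC); set C := sc_D V g (y + t *: k1) => hC.
  have -> : u s - u t = (g (sc_emb (y + s *: k1)) - g (sc_emb (y + t *: k1))
       - (s - t) *: C (sc_emb k1))
     + (s - t) *: (C (sc_emb k1) - sc_D V g y (sc_emb k1)).
    by rewrite /u [(s - t) *: (C _ - _)]scalerBr [RHS]addrA subrK scalerBl subrACA.
  apply: le_trans (ler_normD _ _) _.
  have -> : 2 * (e / 3) * `|h| * `|s - t| =
    e / 3 * `|h| * `|s - t| + `|s - t| * (e / 3 * `|h|) by ring.
  apply: lerD; last by rewrite normrZ ler_wpM2l //; exact: unifk.
  apply: le_trans hC _; rewrite normrZ -mulrA ler_wpM2l //.
    by rewrite mulr_ge0 // ltW.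
  rewrite mulrCA ler_piMr // mulrC ler_pdivrMr // mul1r.
  by rewrite lerDl.
have u0 : u 0 = g (f (sc_emb x)) by rewrite /u !scale0r subr0 addr0 ey.
have u1 : u 1 = g (f (sc_emb (x + h))) - sc_D V g y (sc_emb k1).
  by rewrite /u !scale1r embD ek1 ey subrKC.
have -> : (g \o f) (sc_emb (x + h)) - (g \o f) (sc_emb x) -
    (sc_D V g y \o A) (sc_emb h) =
    (u 1 - u 0) + sc_D V g y (sc_emb k1 - A (sc_emb h)).
  rewrite u0 u1 (linB lB) /=; move: (sc_D V g y (sc_emb k1)) => b.
  by rewrite [_ - b - _]addrAC [RHS]addrA subrK.
move=> mv; apply: le_trans (ler_normD _ _) _.
have -> : e * `|h| = 2 * (e / 3) * `|h| + e / 3 * `|h| by field.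
apply: lerD => //; apply: le_trans (HB _) _.
apply: le_trans (_ : MB * (e1 * `|h|) <= _); first by rewrite ler_pM2l.
by rewrite mulrA ler_pM2r // mulrC -ler_pdivlMr // ge_min lexx orbT.
Qed.

End chain_rule.

(** * Calculus of sc-smooth maps *)

Section sc0_constructions.
Context {R : realType}.
Implicit Types E F G : scBanach R.

Lemma sc0_levelwise E F (f : E 0%N -> F 0%N) (fm : forall m, E m -> F m) :
  (forall m x, sc_emb (fm m x) = f (sc_emb x)) -> (forall m, continuous (fm m)) ->
  sc0 setT setT f.
Proof.
move=> fmE cfm; apply/sc0P => m; exists (fm m); split;
  last exact: continuous_subspaceT (cfm m).
by move=> x _; split.
Qed.

Lemma sc0_id E : sc0 (E := E) setT setT id.
Proof. by apply: (sc0_levelwise (fm := fun m => id)) => // m x; exact: cvg_id. Qed.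

Lemma sc0_fst E F : sc0 (E := sc_sum E F) (F := E) setT setT fst.
Proof.
apply: (sc0_levelwise (E := sc_sum E F) (F := E) (fm := fun m => fst)).
  by move=> m x; rewrite emb_sum.
by move=> m x; exact: cvg_fst.
Qed.

Lemma sc0_snd E F : sc0 (E := sc_sum E F) (F := F) setT setT snd.
Proof.
apply: (sc0_levelwise (E := sc_sum E F) (F := F) (fm := fun m => snd)).
  by move=> m x; rewrite emb_sum.
by move=> m x; exact: cvg_snd.
Qed.

Lemma sc0_incl E : sc0 (E := sc_shift E) (F := E) setT setT (@sc_emb R E 1).
Proof.
apply: (sc0_levelwise (E := sc_shift E) (F := E) (fm := sc_incl E)).
  by move=> m x; rewrite emb_shift.
by move=> m x; exact: incl_continuous.
Qed.

Lemma sc0_pair E F G (U : set (E 0%N)) (V : set (F 0%N)) (W : set (G 0%N)) f g :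
  sc0 U V f -> sc0 U W g ->
  sc0 (F := sc_sum F G) U [set x : F 0%N * G 0%N | V x.1 /\ W x.2]
    (fun x => (f x, g x)).
Proof.
move=> /sc0P sf /sc0P sg; apply/sc0P => m.
have [fm [Hf /withinP cf]] := sf m; have [gm [Hg /withinP cg]] := sg m.
exists (fun x => (fm x, gm x)); split=> [x Ux|].
  have [Vf ef] := Hf _ Ux; have [Wg eg] := Hg _ Ux.
  by split => //; rewrite emb_sum ef eg.
apply/withinP => x Ux e e0.
have [d d0 {}cf] := cf _ Ux _ e0; have [d' d'0 {}cg] := cg _ Ux _ e0.
exists (Num.min d d'); first by rewrite lt_min d0.
move=> y Uy; rewrite lt_min => /andP[yd yd'].
by rewrite prod_normE gt_max cf // cg.
Qed.

Lemma sc0_shift E F (U : set (E 0%N)) (V : set (F 0%N)) f :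
  sc0 U V f ->
  sc0 (E := sc_shift E) (F := sc_shift F) [set x : E 1%N | U (sc_emb x)]
    [set x : F 1%N | V (sc_emb x)] (fun x : E 1%N => sc_lift 1 (f (sc_emb x))).
Proof.
move=> sf; have /sc0P sf' := sf; apply/sc0P => m; have [fm [H c]] := sf' m.+1.
have UE : sc_trace (E := sc_shift E) [set x : E 1%N | U (sc_emb x)] m
    = sc_trace U m.+1.
  by apply/seteqP; split=> x; rewrite /sc_trace /= (@emb_shift _ E m x).
exists fm; rewrite UE; split => // x Ux; have [Vf ef] := H x Ux.
have U1 : sc_trace U 1 (sc_emb (E := sc_shift E) (m := m) x).
  by rewrite /sc_trace /= (@emb_shift _ E m x).
have e1 := sc0_emb sf U1.
split; first by rewrite /mkset e1; exact: sc0_map sf U1.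
apply: (@emb_inj _ F 1); rewrite e1.
by rewrite (@emb_shift _ F m) (@emb_shift _ E m).
Qed.

Lemma sc0_shiftE E F (f : E 0%N -> F 0%N) (f1 : E 1%N -> F 1%N) :
  sc0 setT setT f -> (forall x, sc_emb (f1 x) = f (sc_emb x)) ->
  sc0 (E := sc_shift E) (F := sc_shift F) setT setT f1.
Proof.
move=> /sc0_shift sf f1E.
by apply: eq_sc0 sf => x _; exact: lift_eq (f1E x).
Qed.

Lemma sc0_add E F (U : set (E 0%N)) (V W : set (F 0%N)) f g :
  sc0 U V f -> sc0 U W g -> sc0 U setT (fun x => f x + g x).
Proof.
move=> sf sg; have sfg := sc0_pair sf sg.
suff sD : sc0 (E := sc_sum F F) (F := F) setT setT (fun x => x.1 + x.2).
  by apply: (sc0_comp sfg) (sc0_sub _ _ sD).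
apply: (sc0_levelwise (E := sc_sum F F) (F := F) (fm := fun m x => x.1 + x.2)).
  by move=> m x; rewrite embD emb_sum.
by move=> m x; apply: cvgD; [exact: cvg_fst|exact: cvg_snd].
Qed.

Lemma sc0_cst E F (U : set (E 0%N)) (c : F 0%N) :
  (forall m, sc_level F m c) -> sc0 U setT (fun=> c).
Proof.
move=> lc; apply/sc0P => m; have [y _ yc] := lc m.
exists (fun=> y); split => //; apply: continuous_subspaceT => x; exact: cvg_cst.
Qed.

Lemma sc0_pairT E F G (f : E 0%N -> F 0%N) (g : E 0%N -> G 0%N) :
  sc0 setT setT f -> sc0 setT setT g ->
  sc0 (F := sc_sum F G) setT setT (fun x => (f x, g x)).
Proof. by move=> sf sg; apply: sc0_sub (sc0_pair sf sg). Qed.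

Lemma sc0_local E F (U : set (E 0%N)) (V : set (F 0%N)) f :
  (forall x, U x -> exists N, [/\ open N, N x & sc0 (U `&` N) V f]) ->
  sc0 U V f.
Proof.
move=> H; apply/sc0P => m; exists (fun x => sc_lift m (f (sc_emb x))); split.
  move=> x Ux; have [N [oN Nx sf]] := H _ Ux.
  by split; [exact: sc0_map sf _|exact: sc0_emb sf _].
apply/withinP => x Ux e e0; have [N [oN Nx sf]] := H _ Ux.
have UNx : sc_trace (U `&` N) m x by [].
have [d d0 Hd] := sc0_eps sf UNx e0.
have [r r0 Nr] := open_ball oN Nx.
have [M M0 HM] := emb_bound E m.
exists (Num.min d (r / M)); first by rewrite lt_min d0 divr_gt0.
move=> y Uy; rewrite lt_min ltr_pdivlMr // => /andP[yd yr]; apply: Hd => //.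
split => //; apply: Nr; rewrite -embB.
by apply: le_lt_trans (HM _) _; rewrite mulrC.
Qed.

End sc0_constructions.

Section sck_theory.
Context {R : realType}.
Implicit Types E F G : scBanach R.

(** The definition tests the last iterate [T^k f]; peeling off the first tangent map instead allows
    induction on [k] with the spaces generalized. *)
Lemma sckS k E F (U : set (E 0%N)) (V : set (F 0%N)) f :
  sck k.+1 U V f <->
  sc1 U V f /\ sck k (tangent_set U) (tangent_set V) (tangent_map U f).
Proof.
elim: k E F U V f => [|k IH] E F U V f.
  by split=> [[s0 s1]|[s1 _]]; [case: (s1)|case: (s1)].
split=> [[/IH [s1 sk] s1']|[s1 [sk s1']]]; first by split.
by split => //; apply/IH.
Qed.

Lemma sck_sc0 k E F (U : set (E 0%N)) (V : set (F 0%N)) f :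
  sck k U V f -> sc0 U V f.
Proof. by elim: k => [//|k IH] [/IH]. Qed.

Lemma eq_tangent_map E F (U : set (E 0%N)) (f g : E 0%N -> F 0%N) :
  (forall x, U x -> f x = g x) ->
  forall xh, tangent_set U xh -> tangent_map U f xh = tangent_map U g xh.
Proof.
by move=> fg [x h] Ux; rewrite /tangent_map fg // (eq_sc_D Ux fg).
Qed.

Lemma eq_sc1 E F (U : set (E 0%N)) (V : set (F 0%N)) (f g : E 0%N -> F 0%N) :
  (forall x, U x -> f x = g x) -> sc1 U V f -> sc1 U V g.
Proof.
move=> fg [s0 s1 sT]; split; first exact: eq_sc0 fg s0.
  move=> x Ux; have [A dA] := s1 x Ux; exists A.
  exact: eq_is_sc_derivative fg dA.
by apply: eq_sc0 sT; exact: eq_tangent_map.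
Qed.

Lemma eq_sck k E F (U : set (E 0%N)) (V : set (F 0%N)) (f g : E 0%N -> F 0%N) :
  (forall x, U x -> f x = g x) -> sck k U V f -> sck k U V g.
Proof.
elim: k E F U V f g => [|k IH] E F U V f g fg; first exact: eq_sc0.
move=> /sckS [s1 sT]; apply/sckS; split; first exact: eq_sc1 fg s1.
by apply: IH sT; exact: eq_tangent_map.
Qed.

(** Restriction might change the chosen [sc_D]; uniqueness on [U'] shows that the derivative over
    [U] is still the chosen one, so the tangent maps agree and the induction passes to them. *)
Lemma sck_sub k E F (U U' : set (E 0%N)) (V V' : set (F 0%N)) f :
  sc_domain U' -> U' `<=` U -> (forall x, U' x -> V' (f x)) ->
  sck k U V f -> sck k U' V' f.
Proof.
elim: k E F U U' V V' f => [|k IH] E F U U' V V' f dU UU VV.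
  exact: sc0_sub.
move=> /sckS [[s0 s1 _] sT]; apply/sckS.
suff sT' : sck k (tangent_set U') (tangent_set V') (tangent_map U' f).
  split => //; split; [exact: sc0_sub s0| |exact: sck_sc0 sT'].
  move=> x Ux; have [A dA] := s1 x (UU _ Ux); exists A.
  exact: is_sc_derivative_sub dA.
have TE xh : tangent_set U' xh -> tangent_map U f xh = tangent_map U' f xh.
  case: xh => x h Ux; rewrite /tangent_map /=; congr (_, _ h).
  symmetry; apply: sc_D_eq => //; apply: (is_sc_derivative_sub UU).
  by apply: sc_DP; exact: s1 (UU _ Ux).
apply: eq_sck TE _; apply: IH sT.
- exact: sc_domain_tangent.
- by move=> [x h]; exact: UU.
- move=> [x h] Ux; rewrite /tangent_set /= (@sc0_emb _ _ _ U V) //; first exact: VV.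
  exact: UU.
Qed.

Lemma sck_subT k E F (U : set (E 0%N)) (V : set (F 0%N)) f :
  sck k U V f -> forall V' : set (F 0%N), sc_domain U ->
  (forall x, U x -> V' (f x)) -> sck k U V' f.
Proof. by move=> sf V' dU UV; apply: sck_sub sf. Qed.

(** A derivative over the trace of [N] on [U] is one over [U], and the points above [N] are open in
    the tangent space, so the tangent map inherits the hypothesis. *)
Lemma sck_local k E F (U : set (E 0%N)) (V : set (F 0%N)) f :
  sc_domain U ->
  (forall x, U x -> exists N, [/\ open N, N x & sck k (U `&` N) V f]) ->
  sck k U V f.
Proof.
elim: k E F U V f => [|k IH] E F U V f dU H; first exact: sc0_local.
have DE N x : open N -> sc_trace (U `&` N) 1 x -> sc1 (U `&` N) V f ->
    is_sc_derivative U f x (sc_D (U `&` N) f x).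
  move=> oN [Ux Nx] [_ s1 _]; apply: (is_sc_derivative_local oN) => //.
  by apply: sc_DP; exact: s1.
have sT : sck k (tangent_set U) (tangent_set V) (tangent_map U f).
  apply: IH; first exact: sc_domain_tangent.
  move=> [x h] Ux; have [N [oN Nx /sckS [s1 sT]]] := H _ Ux.
  exists [set xh | N (sc_emb (xh.1 : E 1%N))]; split => //.
    apply: (@open_comp _ _ (fun xh : E 1%N * E 0%N => sc_emb xh.1)) => // z _.
    by apply: continuous_comp; [exact: cvg_fst|exact: emb_continuous].
  apply: eq_sck sT => -[z a] Uz; rewrite /tangent_map /=; congr (_, _ a).
  by symmetry; apply: sc_D_eq => //; [case: Uz|exact: DE].
apply/sckS; split => //; split; last exact: sck_sc0 sT.
  by apply: sc0_local => x Ux; have [N [oN Nx /sck_sc0 s0]] := H _ Ux; exists N.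
move=> x Ux; have [N [oN Nx /sckS [s1 _]]] := H _ Ux.
by exists (sc_D (U `&` N) f x); apply: DE.
Qed.

(** By the chain rule [T(g o f) = Tg o Tf] on [TU], which reduces degree [k + 1] to degree [k] for
    the tangent maps. *)
Lemma sck_comp k E F G (U : set (E 0%N)) (V : set (F 0%N)) (W : set (G 0%N))
    (f : E 0%N -> F 0%N) (g : F 0%N -> G 0%N) :
  sc_domain U -> sc_domain V -> sck k U V f -> sck k V W g ->
  sck k U W (g \o f).
Proof.
elim: k E F G U V W f g => [|k IH] E F G U V W f g dU dV; first exact: sc0_comp.
move=> /sckS [sf sTf] /sckS [sg sTg]; apply/sckS.
have [f0 f1 _] := sf; have [g0 _ _] := sg.
have dgf x : sc_trace U 1 x -> is_sc_derivative U (g \o f) x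
    (sc_D V g (sc_lift 1 (f (sc_emb x))) \o sc_D U f x).
  move=> Ux; apply: (sc_derivative_comp dV f0 sg Ux).
  by apply: sc_DP; exact: f1.
suff sT : sck k (tangent_set U) (tangent_set W) (tangent_map U (g \o f)).
  split => //; split; [exact: sc0_comp g0| |exact: sck_sc0 sT].
  by move=> x Ux; exists (sc_D V g (sc_lift 1 (f (sc_emb x))) \o sc_D U f x);
    exact: dgf.
apply: eq_sck (IH _ _ _ _ _ _ _ _ _ _ sTf sTg); last exact: sc_domain_tangent.
  move=> [x h] Ux; rewrite /tangent_map /= (sc0_emb f0 Ux).
  by congr (_, _); rewrite (sc_D_eq dU Ux (dgf _ Ux)).
exact: sc_domain_tangent.
Qed.

End sck_theory.

Section sck_constructions.
Context {R : realType}.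
Implicit Types E F G : scBanach R.

Lemma operator_continuous E F (A : E 0%N -> F 0%N) :
  sc_operator A -> continuous A.
Proof.
move=> [lA sA] x; have /withinP H := (sA 0%N).2; apply/cvgrPdist_lt => e e0.
have [d d0 Hd] := H x I e e0; apply/nbhs_normP; exists d => //= y xy.
by have := Hd y I; rewrite !lift0 distrC [`|A y - _|]distrC; exact.
Qed.

Lemma operator_derivative E F (U : set (E 0%N)) (A : E 0%N -> F 0%N)
    (x : E 1%N) :
  sc_operator A -> is_sc_derivative U A x A.
Proof.
move=> oA; have cA := operator_continuous oA; case: oA => lA _.
apply/is_sc_derivativeP; split => // e e0; exists 1 => // h _ _.
by rewrite embD (linD lA) [A _ + _]addrC addrK subrr normr0 mulr_ge0 // ltW.
Qed.

Lemma tangent_operator E F (A : E 0%N -> F 0%N) : sc_operator A ->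
  sc_operator (tangent_map setT A).
Proof.
move=> oA; have [lA sA] := oA.
have DA (x : E 1%N) : sc_D setT A x = A.
  by apply: sc_D_eq; [exact: sc_domainT| |exact: operator_derivative].
have ek (x : E 1%N) : sc_emb (sc_lift 1 (A (sc_emb x))) = A (sc_emb x).
  exact: sc0_emb sA I.
split.
  move=> t [x h] [y k]; rewrite /tangent_map /= !DA; apply: (congr2 pair); last exact: lA.
  move: (x : E 1%N) (y : E 1%N) => {}x {}y.
  apply: (@emb_inj _ F 1); rewrite ek embD embZ lA.
  change (t *: A (sc_emb x) + A (sc_emb y) = sc_emb
    (t *: sc_lift 1 (A (sc_emb x)) + sc_lift 1 (A (sc_emb y)) : F 1%N)).
  by rewrite embD embZ !ek.
have s1 := sc0_shiftE sA ek.
have := sc0_pairT (sc0_comp (@sc0_fst _ (sc_shift E) E) s1)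
  (sc0_comp (@sc0_snd _ (sc_shift E) E) sA).
by apply: eq_sc0 => -[x h] _; rewrite /tangent_map /= DA.
Qed.

Lemma tangent_setT E : tangent_set (E := E) setT = setT.
Proof. by apply/seteqP. Qed.

Lemma sck_operator k E F (A : E 0%N -> F 0%N) :
  sc_operator A -> sck k setT setT A.
Proof.
elim: k E F A => [|k IH] E F A oA; first by case: oA.
have [_ sT] := tangent_operator oA; apply/sckS; rewrite !tangent_setT; split.
  split; [by case: oA| |by rewrite !tangent_setT].
  by move=> x _; exists A; exact: operator_derivative.
by apply: IH; exact: tangent_operator.
Qed.

Lemma operator_fst E F : sc_operator (E := sc_sum E F) (F := E) fst.
Proof. by split; [move=> t [a b] [c d]|exact: sc0_fst]. Qed.

Lemma operator_snd E F : sc_operator (E := sc_sum E F) (F := F) snd.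
Proof. by split; [move=> t [a b] [c d]|exact: sc0_snd]. Qed.

Lemma operator_incl E : sc_operator (E := sc_shift E) (F := E) (@sc_emb R E 1).
Proof. by split; [exact: (@emb_linear _ E 1)|exact: sc0_incl]. Qed.

Lemma operator_pair E F G (A : E 0%N -> F 0%N) (B : E 0%N -> G 0%N) :
  sc_operator A -> sc_operator B ->
  sc_operator (F := sc_sum F G) (fun x => (A x, B x)).
Proof.
move=> [lA sA] [lB sB]; split; last exact: sc0_pairT.
by move=> t x y; rewrite lA lB.
Qed.

Lemma operator_comp E F G (A : E 0%N -> F 0%N) (B : F 0%N -> G 0%N) :
  sc_operator A -> sc_operator B -> sc_operator (B \o A).
Proof. by move=> [lA sA] [lB sB]; split; [exact: linear_comp|exact: sc0_comp sB]. Qed.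

Lemma operator_shift E F (A : E 0%N -> F 0%N) (A1 : E 1%N -> F 1%N) :
  sc_operator A -> (forall x, sc_emb (A1 x) = A (sc_emb x)) ->
  sc_operator (E := sc_shift E) (F := sc_shift F) A1.
Proof.
move=> [lA sA] A1E; split; last exact: sc0_shiftE sA A1E.
by move=> t x y; apply: (@emb_inj _ F 1); rewrite A1E !embD !embZ !A1E lA.
Qed.

Lemma operator_add E : sc_operator (E := sc_sum E E) (F := E) (fun x => x.1 + x.2).
Proof.
split; last exact: sc0_add (@sc0_fst _ E E) (@sc0_snd _ E E).
by move=> t [a b] [c d] /=; rewrite scalerDr addrACA.
Qed.

(** [TF (+) TG] and [T(F (+) G)] differ only in the order of their four components; the two shuffles
    relate pairs of tangent maps to tangent maps on sums. *)
Definition tangent_of_sum F G (x : sc_sum (sc_tangent F) (sc_tangent G) 0%N) :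
  sc_tangent (sc_sum F G) 0%N := ((x.1.1, x.2.1), (x.1.2, x.2.2)).

Definition sum_of_tangent F G (x : sc_tangent (sc_sum F G) 0%N) :
  sc_sum (sc_tangent F) (sc_tangent G) 0%N := ((x.1.1, x.2.1), (x.1.2, x.2.2)).

Lemma operator_id E : sc_operator (E := E) id.
Proof. by split => //; exact: sc0_id. Qed.

(** The two sc-spaces have the same levels, but their embeddings into level 0 are composed
    differently and have to be compared. *)
Lemma operator_shift_pair F G :
  sc_operator (E := sc_sum (sc_shift F) (sc_shift G)) (F := sc_shift (sc_sum F G)) id.
Proof.
split=> //; apply: (sc0_levelwise (E := sc_sum (sc_shift F) (sc_shift G))
  (F := sc_shift (sc_sum F G)) (fm := fun m x => x)).
  move=> m x; apply: (@emb_inj _ (sc_sum F G) 1).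
  rewrite (@emb_shift _ (sc_sum F G) m x) !emb_sum /=.
  by congr (_, _).
by move=> m x; exact: cvg_id.
Qed.

Lemma operator_fst1 F G :
  sc_operator (E := sc_shift (sc_sum F G)) (F := sc_shift F) fst.
Proof. by apply: operator_shift (operator_fst F G) _ => x; rewrite emb_sum. Qed.

Lemma operator_snd1 F G :
  sc_operator (E := sc_shift (sc_sum F G)) (F := sc_shift G) snd.
Proof. by apply: operator_shift (operator_snd F G) _ => x; rewrite emb_sum. Qed.

Lemma operator_tangent_of_sum F G : sc_operator (@tangent_of_sum F G).
Proof.
pose E := sc_sum (sc_tangent F) (sc_tangent G).
have o1 : sc_operator (E := E) (F := sc_tangent F) fst by exact: operator_fst.
have o2 : sc_operator (E := E) (F := sc_tangent G) snd by exact: operator_snd.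
have p1 := operator_comp o1 (operator_fst (sc_shift F) F).
have p2 := operator_comp o1 (operator_snd (sc_shift F) F).
have q1 := operator_comp o2 (operator_fst (sc_shift G) G).
have q2 := operator_comp o2 (operator_snd (sc_shift G) G).
apply: operator_pair; last exact: operator_pair.
exact: operator_comp (operator_pair p1 q1) (operator_shift_pair F G).
Qed.

Lemma operator_sum_of_tangent F G : sc_operator (@sum_of_tangent F G).
Proof.
pose E := sc_tangent (sc_sum F G).
have o1 : sc_operator (E := E) (F := sc_shift (sc_sum F G)) fst.
  exact: operator_fst.
have o2 : sc_operator (E := E) (F := sc_sum F G) snd by exact: operator_snd.
have p1 := operator_comp o1 (operator_fst1 F G).
have p2 := operator_comp o1 (operator_snd1 F G).
have q1 := operator_comp o2 (operator_fst F G).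
have q2 := operator_comp o2 (operator_snd F G).
by apply: operator_pair; exact: operator_pair.
Qed.

Lemma sc_derivative_pair E F G (U : set (E 0%N)) (f : E 0%N -> F 0%N)
    (g : E 0%N -> G 0%N) (x : E 1%N) A B :
  is_sc_derivative U f x A -> is_sc_derivative U g x B ->
  is_sc_derivative (F := sc_sum F G) U (fun x => (f x, g x)) x
    (fun h => (A h, B h)).
Proof.
move=> /is_sc_derivativeP [lA cA HA] /is_sc_derivativeP [lB cB HB].
apply/is_sc_derivativeP; split.
- by move=> t y z; rewrite lA lB.
- by move=> y; apply: cvg_pair; [exact: cA|exact: cB].
move=> e e0; have [d d0 {}HA] := HA _ e0; have [d' d'0 {}HB] := HB _ e0.
exists (Num.min d d'); first by rewrite lt_min d0.
move=> h; rewrite lt_min => /andP[hd hd'] Uh.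
by rewrite prod_normE ge_max HA // HB.
Qed.

Lemma sck_pair k E F G (U : set (E 0%N)) (V : set (F 0%N)) (W : set (G 0%N)) f g :
  sc_domain U -> sc_domain V -> sc_domain W -> sck k U V f -> sck k U W g ->
  sck k (F := sc_sum F G) U [set x : F 0%N * G 0%N | V x.1 /\ W x.2]
    (fun x => (f x, g x)).
Proof.
elim: k E F G U V W f g => [|k IH] E F G U V W f g dU dV dW.
  exact: sc0_pair.
move=> /sckS [[f0 f1 _] fT] /sckS [[g0 g1 _] gT].
have Dfg x : sc_trace U 1 x ->
    is_sc_derivative (F := sc_sum F G) U (fun x => (f x, g x)) x
      (fun h => (sc_D U f x h, sc_D U g x h)).
  move=> Ux; apply: sc_derivative_pair; apply: sc_DP; [exact: f1|exact: g1].
apply/sckS.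
set TVW := tangent_set (E := sc_sum F G) _.
have sT : sck k (tangent_set U) TVW
    (tangent_map (F := sc_sum F G) U (fun x => (f x, g x))).
  have dT := sc_domain_prod (sc_domain_tangent dV) (sc_domain_tangent dW).
  have sfg := IH _ _ _ _ _ _ _ _ (sc_domain_tangent dU) (sc_domain_tangent dV)
    (sc_domain_tangent dW) fT gT.
  have sR := sck_operator k (operator_tangent_of_sum F G).
  have sR' := sck_sub dT (fun _ _ => I) _ sR.
  apply: eq_sck (sck_comp (sc_domain_tangent dU) dT sfg (sR' TVW _)).
    move=> [x h] Ux; rewrite /tangent_map /tangent_of_sum /=; congr (_, _).
      symmetry; apply: (@lift_eq _ (sc_sum F G) 1 (_, _)).
      by rewrite emb_sum /= (sc0_emb f0 Ux) (sc0_emb g0 Ux).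
    by rewrite (sc_D_eq dU Ux (Dfg _ Ux)).
  by move=> [[x h] [y l]] [Vx Wy].
split=> //; split; [exact: sc0_pair| |exact: sck_sc0 sT].
by move=> x Ux; exists (fun h => (sc_D U f x h, sc_D U g x h)); exact: Dfg.
Qed.

Lemma sck_pairT k E F G (U : set (E 0%N)) (f : E 0%N -> F 0%N)
    (g : E 0%N -> G 0%N) :
  sc_domain U -> sck k U setT f -> sck k U setT g ->
  sck k (F := sc_sum F G) U setT (fun x => (f x, g x)).
Proof.
move=> dU sf sg.
apply: (sck_subT (sck_pair dU (sc_domainT F) (sc_domainT G) sf sg)) => //.
Qed.

Lemma sck_add k E F (U : set (E 0%N)) (f g : E 0%N -> F 0%N) :
  sc_domain U -> sck k U setT f -> sck k U setT g ->
  sck k U setT (fun x => f x + g x).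
Proof.
move=> dU sf sg; have := sck_pairT dU sf sg => sfg.
exact: sck_comp (sc_domainT _) sfg (sck_operator k (operator_add F)).
Qed.

(** A constant map is sc-continuous only if its value lies on every level; its tangent map is then
    the constant [(c, 0)], again of this kind. *)
Lemma sck_cst k E F (U : set (E 0%N)) (c : F 0%N) : sc_domain U ->
  (forall m, sc_level F m c) -> sck k U setT (fun=> c).
Proof.
elim: k E F U c => [|k IH] E F U c dU lc; first exact: sc0_cst.
have Dc x : is_sc_derivative (E := E) (F := F) U (fun=> c) x (fun=> 0).
  apply/is_sc_derivativeP; split => [t a b|a|e e0].
  - by rewrite scaler0 addr0.
  - exact: cvg_cst.
  - by exists 1 => // h _ _; rewrite !subrr normr0 mulr_ge0 // ltW.
apply/sckS; rewrite tangent_setT.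
have sT : sck k (tangent_set U) setT (tangent_map (F := F) U (fun=> c)).
  have := IH (sc_tangent E) (sc_tangent F) (tangent_set U) (sc_lift 1 c, 0).
  move=> /(_ (sc_domain_tangent dU)) IHk; apply: eq_sck (IHk _).
    by move=> [x h] Ux; rewrite /tangent_map (sc_D_eq dU Ux (Dc _)).
  move=> m; apply/level_sum; split; last by exists 0 => //; rewrite emb0.
  by apply/level_shift; rewrite emb_lift //; exact: lc.
split => //; split; [exact: sc0_cst| |rewrite tangent_setT; exact: sck_sc0 sT].
by move=> x Ux; exists (fun=> 0); exact: Dc.
Qed.

End sck_constructions.

(** * Bounded bilinear maps and real-valued functions *)

Section bilinear.
Context {R : realType}.
Implicit Types E F G : scBanach R.

Definition sc_bilinear E F G (B : sc_sum E F 0%N -> G 0%N) :=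
  [/\ forall z, linear (fun x => B (x, z)), forall x, linear (fun z => B (x, z)) &
      sc0 setT setT B].

Lemma bilinear_bound (V W Z : normedModType R) (B : V * W -> Z) (d : R) :
  (forall z, linear (fun x => B (x, z))) ->
  (forall x, linear (fun z => B (x, z))) -> 0 < d ->
  (forall a b, `|a| < d -> `|b| < d -> `|B (a, b)| <= 1) ->
  exists2 M : R, 0 < M & forall a b, `|B (a, b)| <= M * (`|a| * `|b|).
Proof.
(* Both arguments are rescaled to norm [d / 2]; each contributes a factor [2 / d]. *)
move=> lB rB d0 Bd; exists ((2 / d) ^+ 2); first by rewrite exprn_gt0 ?divr_gt0.
move=> a b.
have [->|a0] := eqVneq a 0.
  by rewrite (lin0 (lB b)) !normr0 mul0r mulr0.
have [->|b0] := eqVneq b 0.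
  by rewrite (lin0 (rB a)) !normr0 !mulr0.
have ap : 0 < `|a| by rewrite normr_gt0.
have bp : 0 < `|b| by rewrite normr_gt0.
have small (U : normedModType R) (c : U) : 0 < `|c| ->
    `|d / 2 / `|c| *: c| < d.
  move=> c0; rewrite normrZ gtr0_norm ?divr_gt0 // divfK ?gt_eqF //.
  by rewrite ltr_pdivrMr // ltr_pMr // ltr1n.
have := Bd _ _ (small _ _ ap) (small _ _ bp).
rewrite (linZ (lB _)) (linZ (rB _)) scalerA normrZ gtr0_norm; last first.
  by rewrite !mulr_gt0 // invr_gt0.
rewrite -ler_pdivlMl; last by rewrite !mulr_gt0 // invr_gt0.
rewrite mulr1 => h; apply: le_trans h _; rewrite le_eqVlt; apply/orP; left.
by apply/eqP; field; rewrite !gt_eqF.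
Qed.

Lemma sc_bilinear_bound E F G (B : sc_sum E F 0%N -> G 0%N) : sc_bilinear B ->
  exists2 M : R, 0 < M & forall a b, `|B (a, b)| <= M * (`|a| * `|b|).
Proof.
move=> [lB rB sB].
have [d d0 Hd] := @sc0_eps _ (sc_sum E F) _ _ _ _ 0 (0, 0) 1 sB I ltr01.
apply: bilinear_bound d0 _ => // a b ad bd.
have := Hd (a, b) I; rewrite !lift0.
change (sc_emb ((a, b) : sc_sum E F 0%N)) with (a, b).
change (sc_emb ((0, 0) : sc_sum E F 0%N)) with ((0, 0) : E 0%N * F 0%N).
rewrite (lin0 (lB 0)) !subr0 => h; apply/ltW/h.
by rewrite prod_normE gt_max ad.
Qed.

(** The remainder is exactly [B] applied to the two components of [h], which is quadratic in the
    level 1 norm. *)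
Lemma bilinear_derivative E F G (B : sc_sum E F 0%N -> G 0%N)
    (x : sc_sum E F 1%N) : sc_bilinear B ->
  is_sc_derivative (E := sc_sum E F) setT B x
    (fun h => B (sc_emb x.1, h.2) + B (h.1, sc_emb x.2)).
Proof.
move=> bB; have [M M0 HM] := sc_bilinear_bound bB; have [lB rB sB] := bB.
apply/is_sc_derivativeP.
have lD : linear (fun h : sc_sum E F 0%N =>
    B (sc_emb x.1, h.2) + B (h.1, sc_emb x.2)).
  move=> t [a b] [c d] /=; rewrite (rB _) (lB _).
  by rewrite scalerDr addrACA.
split => //.
  pose N : R := M * `|sc_emb x.1| + M * `|sc_emb x.2|.
  apply: (linear_continuous_of_bound (M := N)) => // -[a b] /=.
  apply: le_trans (ler_normD _ _) _; rewrite mulrDl; apply: lerD.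
    apply: le_trans (HM _ _) _; rewrite mulrA ler_wpM2l ?mulr_ge0 // ?(ltW M0) //.
    by rewrite prod_normE le_max lexx orbT.
  apply: le_trans (HM _ _) _; rewrite mulrCA mulrC ler_wpM2l ?mulr_ge0 //.
    exact: ltW.
  by rewrite prod_normE le_max lexx.
move=> e e0; have [ME ME0 HE] := emb_bound E 1; have [MF MF0 HF] := emb_bound F 1.
exists (e / (M * ME * MF)); first by rewrite divr_gt0 // !mulr_gt0.
move=> h hd _; case: x h hd {lD} => a b [h k] hd; rewrite !emb_sum /= !embD.
have -> : B (sc_emb a + sc_emb h, sc_emb b + sc_emb k) - B (sc_emb a, sc_emb b) -
    (B (sc_emb a, sc_emb k) + B (sc_emb h, sc_emb b)) = B (sc_emb h, sc_emb k).
  rewrite (linD (lB _)) !(linD (rB _)).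
  move: (B (sc_emb a, sc_emb b)) (B (sc_emb a, sc_emb k))
    (B (sc_emb h, sc_emb b)) (B (sc_emb h, sc_emb k)) => p q r s.
  apply/eqP; rewrite !subr_eq; apply/eqP.
  by rewrite [s + _]addrC [RHS]addrC !addrA.
apply: le_trans (HM _ _) _.
set n := `|(h, k)| in hd *.
have hn : `|h| <= n by rewrite /n prod_normE le_max lexx.
have kn : `|k| <= n by rewrite /n prod_normE le_max lexx orbT.
have n0 : 0 <= n by rewrite /n.
have hk : `|sc_emb h| * `|sc_emb k| <= (ME * n) * (MF * n).
  apply: ler_pM => //.
    by apply: le_trans (HE _) _; rewrite ler_pM2l.
  by apply: le_trans (HF _) _; rewrite ler_pM2l.
apply: le_trans (_ : M * ((ME * n) * (MF * n)) <= _); first by rewrite ler_pM2l.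
have -> : M * ((ME * n) * (MF * n)) = (n * (M * ME * MF)) * n by ring.
apply: ler_wpM2r => //; apply: ltW; rewrite -ltr_pdivlMr //.
by rewrite !mulr_gt0.
Qed.

(** This is [TB] read through the shuffle. As a function of the pairs [(a, h)] and [(b, l)] it is
    again bilinear, which closes the induction in [sck_bilinear]. *)
Definition bilinear_tangent E F G (B : sc_sum E F 0%N -> G 0%N)
    (x : sc_sum (sc_tangent E) (sc_tangent F) 0%N) : sc_tangent G 0%N :=
  let a : E 1%N := x.1.1 in let b : F 1%N := x.2.1 in
  (sc_lift 1 (B (sc_emb a, sc_emb b)),
   B (sc_emb a, x.2.2) + B (x.1.2, sc_emb b)).

Lemma sc_bilinear_tangent E F G (B : sc_sum E F 0%N -> G 0%N) :
  sc_bilinear B -> sc_bilinear (bilinear_tangent B).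
Proof.
move=> [lB rB sB].
have ek (a : E 1%N) (b : F 1%N) :
    sc_emb (sc_lift 1 (B (sc_emb a, sc_emb b))) = B (sc_emb a, sc_emb b).
  have := @sc0_emb _ (sc_sum E F) _ _ _ _ 1 (a, b) sB I.
  by rewrite emb_sum.
split.
- move=> [z k] t [x h] [y l]; rewrite /bilinear_tangent /=.
  move: (z : F 1%N) (x : E 1%N) (y : E 1%N) => {}z {}x {}y.
  apply: (congr2 pair).
    apply: (@emb_inj _ G 1); rewrite ek embD embZ lB.
    change (t *: B (sc_emb x, sc_emb z) + B (sc_emb y, sc_emb z) = sc_emb
      (t *: sc_lift 1 (B (sc_emb x, sc_emb z)) +
       sc_lift 1 (B (sc_emb y, sc_emb z)) : G 1%N)).
    by rewrite embD embZ !ek.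
  by rewrite embD embZ !lB /= scalerDr addrACA.
- move=> [z k] t [x h] [y l]; rewrite /bilinear_tangent /=.
  move: (z : E 1%N) (x : F 1%N) (y : F 1%N) => {}z {}x {}y.
  apply: (congr2 pair).
    apply: (@emb_inj _ G 1); rewrite ek embD embZ rB.
    change (t *: B (sc_emb z, sc_emb x) + B (sc_emb z, sc_emb y) = sc_emb
      (t *: sc_lift 1 (B (sc_emb z, sc_emb x)) +
       sc_lift 1 (B (sc_emb z, sc_emb y)) : G 1%N)).
    by rewrite embD embZ !ek.
  by rewrite embD embZ !rB /= scalerDr addrACA.
pose TEF := sc_sum (sc_tangent E) (sc_tangent F).
have o1 : sc0 (E := TEF) (F := sc_tangent E) setT setT fst by exact: sc0_fst.
have o2 : sc0 (E := TEF) (F := sc_tangent F) setT setT snd by exact: sc0_snd.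
have p1 := sc0_comp o1 (@sc0_fst _ (sc_shift E) E).
have p2 := sc0_comp o1 (@sc0_snd _ (sc_shift E) E).
have q1 := sc0_comp o2 (@sc0_fst _ (sc_shift F) F).
have q2 := sc0_comp o2 (@sc0_snd _ (sc_shift F) F).
have p0 := sc0_comp p1 (@sc0_incl _ E).
have q0 := sc0_comp q1 (@sc0_incl _ F).
apply: sc0_pairT; last first.
  exact: sc0_add (sc0_comp (sc0_pairT p0 q2) sB) (sc0_comp (sc0_pairT p2 q0) sB).
have s1 := sc0_comp (sc0_pairT p1 q1) (operator_shift_pair E F).2.
have := sc0_comp s1 (sc0_shift sB).
by apply: eq_sc0 => -[[x h] [y l]] _ /=; rewrite emb_sum.
Qed.

Lemma sck_bilinear k E F G (B : sc_sum E F 0%N -> G 0%N) :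
  sc_bilinear B -> sck k (E := sc_sum E F) setT setT B.
Proof.
elim: k E F G B => [|k IH] E F G B bB; first by case: bB.
have [lB rB sB] := bB.
have dEF := sc_domainT (sc_sum E F).
have DB x := sc_D_eq dEF (I : sc_trace setT 1 x) (bilinear_derivative x bB).
have sT : sck k (E := sc_tangent (sc_sum E F)) setT setT
    (tangent_map (E := sc_sum E F) setT B).
  have := sck_comp (sc_domainT _) (sc_domainT _)
    (sck_operator k (operator_sum_of_tangent E F)) (IH _ _ _ _ (sc_bilinear_tangent bB)).
  apply: eq_sck => -[[a b] [h l]] _.
  rewrite /tangent_map /sum_of_tangent /bilinear_tangent /= DB /=.
  by rewrite (@emb_sum _ E F 1).
apply/sckS; rewrite !tangent_setT; split => //; split => //.
  by move=> x _; exists (fun h => B (sc_emb x.1, h.2) + B (h.1, sc_emb x.2));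
    exact: bilinear_derivative.
by rewrite !tangent_setT; exact: sck_sc0 sT.
Qed.

Lemma sck_bilinear2 k E F G (Z : scBanach R) (U : set (Z 0%N))
    (B : sc_sum E F 0%N -> G 0%N) f g :
  sc_bilinear B -> sc_domain U -> sck k U setT f -> sck k U setT g ->
  sck k U setT (fun x => B (f x, g x)).
Proof.
move=> bB dU sf sg; have sfg := sck_pairT dU sf sg.
exact: sck_comp (sc_domainT _) sfg (sck_bilinear k bB).
Qed.

(** All levels of [sc_real] are the same space, so continuity on level 0 restricts to every level of
    [E]. *)
Lemma sc0_real E (U : set (E 0%N)) (f : E 0%N -> R) :
  {within U, continuous f} -> sc0 (F := sc_real) U setT f.
Proof.
move=> cf; apply/sc0P => m; exists (f \o sc_emb); split.
  by move=> x _; split => //; rewrite emb_const.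
apply: (within_comp (B := U)) cf => //; apply: continuous_subspaceT.
exact: emb_continuous.
Qed.

Definition real_mul (x : @sc_sum R sc_real sc_real 0%N) : @sc_real R 0%N :=
  (x.1 : R) * (x.2 : R).

Lemma sc_bilinear_mul : sc_bilinear real_mul.
Proof.
split.
- by move=> z t x y; rewrite /real_mul /= mulrDl scalerAl.
- by move=> z t x y; rewrite /real_mul /= mulrDr scalerAr.
- apply: sc0_real; apply: continuous_subspaceT => x.
  by apply: cvgM; [exact: cvg_fst|exact: cvg_snd].
Qed.

Lemma sck_mul k E (U : set (E 0%N)) (f g : E 0%N -> R) : sc_domain U ->
  sck k (F := sc_real) U setT f -> sck k (F := sc_real) U setT g ->
  sck k (F := sc_real) U setT (fun x => f x * g x).
Proof. exact: sck_bilinear2 sc_bilinear_mul. Qed.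

Lemma sck_cst_real k E (U : set (E 0%N)) (c : R) : sc_domain U ->
  sck k (F := sc_real) U setT (fun=> c).
Proof. by move=> dU; apply: sck_cst => // m; exact: level_const. Qed.

Lemma sck_add_real k E (U : set (E 0%N)) (f g : E 0%N -> R) : sc_domain U ->
  sck k (F := sc_real) U setT f -> sck k (F := sc_real) U setT g ->
  sck k (F := sc_real) U setT (fun x => f x + g x).
Proof. exact: sck_add. Qed.

End bilinear.

(** * Flat functions *)

Section real_functions.
Context {R : realType}.

Definition has_slope (f : R -> R) (t a : R) := forall e : R, 0 < e ->
  exists2 d : R, 0 < d & forall h, `|h| < d ->
    `|f (t + h) - f t - h * a| <= e * `|h|.

Lemma is_derive_slope (f : R -> R) (t a : R) :
  is_derive t 1 f a -> has_slope f t a.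
Proof.
case=> df fa e e0.
have : h^-1 *: (f (h *: 1 + t) - f t) @[h --> (0 : R)^'] --> a.
  by rewrite -fa; exact: df.
move=> /cvgrPdist_le /(_ _ e0); rewrite near_withinE => /nbhs_normP [d /= d0 H].
exists d => // h hd.
have [->|h0] := eqVneq h 0; first by rewrite addr0 subrr mul0r subrr !normr0 mulr0.
have := H h; rewrite /= sub0r normrN => /(_ hd h0).
have -> : f (t + h) - f t - h * a =
    - (h * (a - h^-1 * (f (h * 1 + t) - f t))).
  by rewrite mulrBr mulVKf // mulr1 [h + t]addrC opprB.
by rewrite normrN normrM mulrC ler_pM2r // normr_gt0.
Qed.

Lemma slope_continuous (f : R -> R) :
  (forall t, exists a, has_slope f t a) -> continuous f.
Proof.
move=> H t; have [a fa] := H t; apply/cvgrPdist_lt => e e0.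
have [d d0 Hd] := fa 1 ltr01.
apply/nbhs_normP; exists (Num.min d (e / (2 + `|a|))).
  by rewrite /= lt_min d0 divr_gt0 // ltr_wpDr.
move=> s /=; rewrite distrC lt_min ltr_pdivlMr ?ltr_wpDr // => /andP[sd se].
have := Hd (s - t) sd; rewrite subrKC mul1r => h.
rewrite distrC; apply: le_lt_trans se.
have -> : f s - f t = (f s - f t - (s - t) * a) + (s - t) * a by rewrite subrK.
apply: le_trans (ler_normD _ _) _; rewrite normrM mulrDr lerD2r.
by apply: le_trans h _; rewrite ler_peMr // ler1n.
Qed.

Lemma has_slope_sc (f : R -> R) (t a : R) : has_slope f t a ->
  is_sc_derivative (E := sc_real) (F := sc_real) setT f t (fun h : R^o => h * a).
Proof.
move=> H; apply/is_sc_derivativeP; split=> [c x y|x|e e0].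
- by rewrite mulrDl -scalerAl.
- by apply: cvgMl; exact: cvg_id.
have [d d0 Hd] := H e e0; exists d => // h hd _.
by rewrite !(@emb_const R _ real_unit_ball_compact 1); exact: Hd.
Qed.

(** [Tf(x, h) = (f x, h * g x)] is built from [f] and [g] by operators and a product, so degree [k]
    of both suffices. *)
Lemma sck_real_S k (f g : R -> R) : (forall t, has_slope f t (g t)) ->
  sck k (E := sc_real) (F := sc_real) setT setT f ->
  sck k (E := sc_real) (F := sc_real) setT setT g ->
  sck k.+1 (E := sc_real) (F := sc_real) setT setT f.
Proof.
move=> fg sf sg; pose E := @sc_real R.
have Df (x : E 1%N) : sc_D (E := E) (F := E) setT f x = (fun h : R^o => h * g x).
  apply: sc_D_eq => //; first exact: sc_domainT.
  exact: has_slope_sc (fg x).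
have dT : sc_domain (E := sc_tangent E) setT by exact: sc_domainT.
have s1 : sck k (E := sc_tangent E) (F := E) setT setT
    (@sc_emb R E 1 \o fst).
  apply: sck_operator; apply: operator_comp (operator_incl E).
  exact: operator_fst.
have s2 : sck k (E := sc_tangent E) (F := E) setT setT snd.
  by apply: sck_operator; exact: operator_snd.
have oJ : sc_operator (E := E) (F := sc_shift E) id.
  split=> //; apply: (sc0_levelwise (E := E) (F := sc_shift E) (fm := fun m x => x)).
    move=> m x; apply: (@emb_inj _ E 1); rewrite (@emb_shift _ E m x).
    by rewrite !(@emb_const R _ real_unit_ball_compact).
  by move=> m x; exact: cvg_id.
have sT : sck k (E := sc_tangent E) (F := sc_tangent E) setT setT
    (tangent_map (E := E) (F := E) setT f).
  have sf1 := sck_comp dT (sc_domainT E) (sck_comp dT (sc_domainT E) s1 sf)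
    (sck_operator k oJ).
  have sg1 := sck_mul dT s2 (sck_comp dT (sc_domainT E) s1 sg).
  apply: eq_sck (sck_pairT dT sf1 sg1) => -[x h] _.
  rewrite /tangent_map Df /=; congr (_, _).
  by symmetry; exact: (@lift_eq _ E 1).
apply/sckS; rewrite !tangent_setT; split => //; split.
- exact: sck_sc0 sf.
- by move=> x _; exists (fun h : R^o => h * g x); exact: has_slope_sc (fg x).
- by rewrite !tangent_setT; exact: sck_sc0 sT.
Qed.

(** [t^-m exp(-1/t)] for [t > 0]; this family is closed under differentiation
    up to linear combinations, and [flat 0] is the usual smooth function that is
    flat at [0] and positive exactly on [t > 0]. *)
Definition flat m (t : R) : R := if 0 < t then t^-1 ^+ m * expR (- t^-1) else 0.

Lemma flat_le0 m (t : R) : t <= 0 -> flat m t = 0.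
Proof. by rewrite /flat ltNge => ->. Qed.

Lemma flat_ge0 m (t : R) : 0 <= flat m t.
Proof.
rewrite /flat; case: ifP => // t0.
by rewrite mulr_ge0 ?expR_ge0 // exprn_ge0 // invr_ge0 ltW.
Qed.

Lemma flat_gt0 m (t : R) : (0 < flat m t) = (0 < t).
Proof.
rewrite /flat; case: ifP => t0; last exact: ltxx.
by rewrite mulr_gt0 ?expR_gt0 // exprn_gt0 // invr_gt0.
Qed.

(** The term of degree [m + 2] of the exponential series bounds [t^-(m+2)] by a multiple of
    [exp(1/t)]. The quadratic bound forces slope 0 at the origin. *)
Lemma flat_bound m (t : R) : 0 < t -> flat m t <= (m.+2)`!%:R * t ^+ 2.
Proof.
move=> t0; rewrite /flat t0 expRN.
have ti : 0 < t^-1 by rewrite invr_gt0.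
rewrite ler_pdivrMr ?expR_gt0 //.
have := @expR_ge1Dxn R t^-1 m.+1 (ltW ti).
have F0 : 0 < (m.+2)`!%:R :> R by rewrite ltr0n fact_gt0.
move=> h; have {}h : t^-1 ^+ m.+2 <= (m.+2)`!%:R * expR t^-1.
  rewrite -ler_pdivrMl // mulrC; apply: le_trans h; rewrite lerDr //.
have -> : t^-1 ^+ m = t ^+ 2 * t^-1 ^+ m.+2.
  by rewrite -(addn2 m) exprD mulrCA -exprMn divff ?expr1n ?mulr1 // gt_eqF.
by rewrite [X in _ <= X]mulrAC [X in X <= _]mulrC ler_pM2r // exprn_gt0.
Qed.

(** For [t > 0] this is the product rule, [(t^-(m+2) - m t^-(m+1)) exp(-1/t)]; for [t < 0] the
    function vanishes near [t]; at 0 [flat_bound] applies. *)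
Lemma flat_slope m (t : R) : has_slope (flat m) t (flat m.+2 t - m%:R * flat m.+1 t).
Proof.
have [t0|t0|->] := ltgtP t 0.
- move=> e e0; exists (- t); first by rewrite oppr_gt0.
  move=> h ht; rewrite !flat_le0 ?(ltW t0) //; last first.
    have := ler_norm h; lra.
  by rewrite !(mulr0, subr0) normr0 mulr_ge0 // ltW.
- apply: is_derive_slope.
  apply: (@near_eq_is_derive R R^o R^o (fun t : R => t^-1 ^+ m * expR (- t^-1))).
    near=> s; rewrite /flat ifT //; near: s.
    by apply: lt_nbhsr.
  have t'0 : t != 0 by rewrite gt_eqF.
  have dV : is_derive t 1 (fun s : R => s^-1) (- t ^- 2).
    have := @is_deriveV _ id t 1 1 t'0 (is_derive_id _ _).
    by move=> H; apply: is_derive_eq H _; exact: mulr1.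
  have dVm := @is_deriveX _ _ (fun s : R => s^-1) m t 1 _ dV.
  have dN := @is_deriveN _ _ _ (fun s : R => s^-1) t 1 _ dV.
  have dE := @is_derive1_comp _ expR _ t _ _ (is_derive_expR (- t^-1)) dN.
  have := @is_deriveM _ _ _ _ t 1 _ _ dVm dE.
  rewrite (_ : _ * _ = fun s : R => s^-1 ^+ m * expR (- s^-1)); last first.
    by apply/funext => s; rewrite !fctE.
  move=> H; apply: is_derive_eq H _.
  rewrite /flat t0 /= !fctE.
  change (t^-1 ^+ m * (expR (- t^-1) * - - t ^- 2) +
    expR (- t^-1) * ((m%:R * t^-1 ^+ m.-1) * - t ^- 2) =
    t^-1 ^+ m.+2 * expR (- t^-1) - m%:R * (t^-1 ^+ m.+1 * expR (- t^-1))).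
  rewrite -exprVn; move: (expR (- t^-1)) => E; move: (t^-1) => u.
  by case: m {dVm} => [|m] /=; rewrite !exprS; ring.
- move=> e e0.
  have F0 : 0 < (m.+2)`!%:R :> R by rewrite ltr0n fact_gt0.
  exists (e / (m.+2)`!%:R); first by rewrite divr_gt0.
  move=> h; rewrite ltr_pdivlMr // => he.
  rewrite !(flat_le0 _ (lexx 0)) !(mulr0, subr0) add0r ger0_norm ?flat_ge0 //.
  have [h0|h0] := leP h 0.
    by rewrite flat_le0 // mulr_ge0 // ltW.
  apply: le_trans (flat_bound _ h0) _.
  rewrite (gtr0_norm h0) in he *.
  by rewrite expr2 mulrA ler_pM2r // mulrC ltW.
Unshelve. all: by end_near. Qed.

(** The index [m] is generalized in the induction because differentiation raises it. *)
Lemma sck_flat k m : sck k (E := sc_real) (F := sc_real) setT setT (flat m).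
Proof.
elim: k m => [|k IH] m.
  apply: sc0_real; apply: continuous_subspaceT; apply: slope_continuous => t.
  by exists (flat m.+2 t - m%:R * flat m.+1 t); exact: flat_slope.
have dT : sc_domain (E := @sc_real R) setT by exact: sc_domainT.
apply: sck_real_S (flat_slope m) (IH m) _.
apply: eq_sck (sck_add_real dT (IH m.+2)
  (sck_mul dT (sck_cst_real k (- m%:R) dT) (IH m.+1))) => t _.
by rewrite mulNr.
Qed.

End real_functions.

(** * Topology and charts of M-polyfolds *)

Section regularity.
Variable T : topologicalType.

Lemma open_finite_bigcap (s : seq (set T)) (p : T) (A : set T -> set T) :
  (forall B, B \in s -> open (A B) /\ A B p) ->
  exists N, [/\ open N, N p & forall B, B \in s -> N `<=` A B].
Proof.
elim: s => [|B s IH] H; first by exists setT; split => //; exact: openT.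
have [|N [oN Np NA]] := IH.
  by move=> C Cs; apply: H; rewrite inE Cs orbT.
have [oB Bp] := H B (mem_head _ _).
exists (A B `&` N); split; [exact: openI|by []|].
move=> C; rewrite inE => /orP[/eqP ->|Cs]; first exact: subIsetl.
by apply: subset_trans (NA _ Cs); exact: subIsetr.
Qed.

Lemma paracompact_regular (p : T) (V : set T) :
  paracompact T -> hausdorff_space T -> open V -> V p ->
  exists N, [/\ open N, N p & closure N `<=` V].
Proof.
move=> pT; rewrite open_hausdorff => hT oV Vp.
pose sep (B : set T) A := [/\ open A, A p & A `&` B = set0].
have [||W [oW cW rW fW]] := pT [set B | open B /\ (B = V \/ exists A, sep B A)].
- by move=> B [].
- apply/seteqP; split => // q _; have [Vq|Vq] := pselect (V q).
    by exists V => //; split => //; left.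
  have pq : p != q by apply: contra_notN Vq => /eqP <-.
  have [[A B] /= [Ap Bq] [oA oB /eqP AB]] := hT _ _ pq.
  exists B; last by rewrite -in_setE.
  by split => //; right; exists A; split => //; rewrite -in_setE.
have [N nN /finite_seqP [s sE]] := fW p.
pose A B := get [set A | sep B A].
have sepA B : (exists A, sep B A) -> sep B (A B).
  by move=> [C sC]; apply: (@getPex _ [set A | sep B A]); exists C.
pose s' := [seq B <- s | `[< exists A, sep B A >]].
have [|M [oM Mp MA]] := @open_finite_bigcap s' p A.
  move=> B; rewrite mem_filter => /andP[/asboolP /sepA [oA Ap _] _].
  by split.
exists (M `&` N^°); split.
- by apply: openI => //; exact: open_interior.
- by split => //; exact: nbhs_singleton (nbhs_interior nN).
move=> q qcl; apply: contrapT => Vq.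
have [B WB Bq] : (\bigcup_(B in W) B) q by rewrite cW.
have [C [oC [CV|[A0 sA]]] BC] := rW _ WB; first by apply: Vq; rewrite -CV; exact: BC.
have sB : exists A, sep B A.
  exists A0; case: sA => oA Ap AC; split => //.
  by apply/seteqP; split => // t [At Bt]; rewrite -AC; split => //; exact: BC.
have [t [[Mt Nt] Bt]] := qcl B (open_nbhs_nbhs (conj (oW _ WB) Bq)).
have Bs : B \in s'.
  rewrite mem_filter; apply/andP; split; first exact/asboolP.
  have : [set` s] B.
    by rewrite -sE; split => //; exists t; split => //; exact: interior_subset.
  by [].
have [_ _ AB] := sepA _ sB.
by have : (A B `&` B) t; [split => //; exact: MA Bs _ Mt|rewrite AB].
Qed.

End regularity.

Lemma read_throughE (Y A : Type) (B : pointedType) (D : Y -> Prop)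
    (phi : Y -> A) (f : Y -> B) (y : Y) :
  D y -> (forall z, D z -> phi z = phi y -> f z = f y) ->
  read_through D phi f (phi y) = f y.
Proof.
move=> Dy H; rewrite /read_through.
have : [set b | exists z, [/\ D z, phi z = phi y & b = f z]] (f y) by exists y.
by case: xgetP => [_ -> [z [Dz zy ->]] _|/(_ (f y)) //]; exact: H.
Qed.

Lemma sc_cone_quadrant {R : realType} (E : scBanach R) (C : set (E 0%N)) :
  partial_quadrant C -> sc_cone C.
Proof.
move=> [_ _ [n [W [L [[[lL sL] [L' [[lL' sL'] LK LK']]] LC]]]]].
have CE x : C x <-> forall i, 0 <= (L x).1 ord0 i.
  have -> : (forall i, 0 <= (L x).1 ord0 i) = (L @` C) (L x) by rewrite LC.
  by split=> [Cx|[y Cy /(can_inj LK) <-]]; [exists x|].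
split.
- move=> x y /CE Cx /CE Cy; apply/CE => i; rewrite (linD lL) mxE.
  by rewrite addr_ge0 ?Cx ?Cy.
- move=> t x t0 /CE Cx; apply/CE => i; rewrite (linZ lL) mxE.
  by rewrite mulr_ge0 ?Cx.
move=> m x.
pose y : sc_sum (sc_rV n) W m := sc_lift m (L (sc_emb x)).
have ey : sc_emb y = L (sc_emb x) by exact: sc0_emb sL I.
(* Positive and negative parts of the quadrant coordinates, taken on level [m]; the [W] component is
   unconstrained and goes entirely into [a]. *)
pose pos : 'rV[R]_n := \row_i Num.max (y.1 ord0 i) 0.
pose neg : 'rV[R]_n := \row_i Num.max (- y.1 ord0 i) 0.
pose b : sc_sum (sc_rV n) W m := (neg, 0).
pose a : sc_sum (sc_rV n) W m := (pos, y.2).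
have ab : a - b = y.
  have e1 : pos - neg = y.1.
    apply/rowP => i; rewrite !mxE /Num.max; move: (y.1 ord0 i) => u.
    by case: ifP => h1; case: ifP => h2; lra.
  by rewrite [RHS]surjective_pairing -e1 -[y.2 in RHS]subr0.
have e' (z : sc_sum (sc_rV n) W m) :
    sc_emb (sc_lift m (L' (sc_emb z))) = L' (sc_emb z) by exact: sc0_emb sL' I.
exists (sc_lift m (L' (sc_emb a))), (sc_lift m (L' (sc_emb b))); split.
- apply/CE => i; rewrite e' LK' emb_sum /= emb_const mxE.
  by rewrite le_max lexx orbT.
- apply/CE => i; rewrite e' LK' emb_sum /= emb_const mxE.
  by rewrite le_max lexx orbT.
apply: emb_inj; rewrite embB !e' -(linB lL') -embB ab ey; exact/esym/LK.
Qed.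

Section charts_theory.
Context {R : realType}.
Variable X : Mpolyfold R.
Implicit Types (c : chart R X) (p : X).

Lemma sc_domain_odom c : sc_domain (odom c).
Proof.
exists (quadrant c); first exact: sc_cone_quadrant (quadrantP c).
exact: odom_open.
Qed.

Lemma retraction_odom c x : odom c x -> odom c (retraction c x).
Proof. by move=> ox; exact: (sc0_map (retraction_smooth c 0) ox). Qed.

Lemma rimage_odom c x : rimage c x -> odom c x.
Proof. by case=> y oy <-; exact: retraction_odom. Qed.

Lemma rimage_fixed c x : rimage c x -> retraction c x = x.
Proof. by case=> y oy <-; rewrite retraction_idem. Qed.

Lemma retraction_rimage c x : odom c x -> rimage c (retraction c x).
Proof. by exists x. Qed.

Lemma ccoord_rimage c p : cdom c p -> rimage c (ccoord c p).
Proof. by case: (ccoord_bij c) => + _ _; apply. Qed.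

Lemma ccoord_inj c p q :
  cdom c p -> cdom c q -> ccoord c p = ccoord c q -> p = q.
Proof.
by case: (ccoord_bij c) => _ + _ => H cp cq; apply: H; rewrite inE.
Qed.

Lemma ccoord_surj c x : rimage c x -> exists2 p, cdom c p & ccoord c p = x.
Proof. by case: (ccoord_bij c) => _ _; apply. Qed.

Lemma ccoord_odom c p : cdom c p -> odom c (ccoord c p).
Proof. by move=> cp; exact/rimage_odom/ccoord_rimage. Qed.

Lemma ccoord_fixed c p : cdom c p -> retraction c (ccoord c p) = ccoord c p.
Proof. by move=> cp; exact/rimage_fixed/ccoord_rimage. Qed.

Lemma odom_point c x : odom c x ->
  exists2 p, cdom c p & ccoord c p = retraction c x.
Proof. by move=> ox; apply: ccoord_surj; exact: retraction_rimage. Qed.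

Lemma read_chart (B : pointedType) c (f : X -> B) p : cdom c p ->
  read_through (cdom c) (ccoord c) f (ccoord c p) = f p.
Proof. by move=> cp; apply: read_throughE => // q cq /(ccoord_inj cq cp) ->. Qed.

(** Precomposing with the retraction extends the transition map to a relatively open subset of the
    quadrant, where sc-derivatives are unique. *)
Definition tmap c c' : ambient c 0%N -> ambient c' 0%N :=
  transition c c' \o retraction c.

Arguments tmap c c' _ : clear implicits.

Lemma overlap_domP c c' x : overlap_dom c c' x <->
  odom c x /\ exists p, [/\ cdom c p, cdom c' p & ccoord c p = retraction c x].
Proof.
split=> [[ox [p [cp cp'] e]]|[ox [p [cp cp' e]]]].
  by split => //; exists p.
by split => //; exists p.
Qed.

Lemma tmapE c c' x p : cdom c p -> cdom c' p -> ccoord c p = retraction c x ->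
  tmap c c' x = ccoord c' p.
Proof.
move=> cp cp' e; rewrite /tmap /= -e; apply: read_throughE => //.
by move=> q [cq _] /(ccoord_inj cq cp) ->.
Qed.

Lemma overlap_dom_coord c c' p : cdom c p -> cdom c' p ->
  overlap_dom c c' (ccoord c p).
Proof.
move=> cp cp'; apply/overlap_domP; split; first exact: ccoord_odom.
by exists p; split => //; rewrite ccoord_fixed.
Qed.

Lemma tmap_coord c c' p : cdom c p -> cdom c' p ->
  tmap c c' (ccoord c p) = ccoord c' p.
Proof. by move=> cp cp'; apply: tmapE; rewrite ?ccoord_fixed. Qed.

Lemma sc0_preimage (E F : scBanach R) (U : set (E 0%N)) (V : set (F 0%N))
    (f : E 0%N -> F 0%N) N :
  sc0 U V f -> open N ->
  exists2 M, open M & forall x, U x -> M x <-> N (f x).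
Proof.
move=> sf oN.
(* [f] is controlled on [U] only, so the open set consists of the centres of balls whose points in
   [U] are sent into [N]. *)
exists [set x | exists2 d : R, 0 < d & forall y, `|y - x| < d -> U y -> N (f y)].
  apply: ball_openP => x [d d0 H]; exists (d / 2); first by rewrite divr_gt0.
  move=> y yx; exists (d / 2); first by rewrite divr_gt0.
  move=> z zy; apply: H; apply: le_lt_trans (ler_distD y _ _) _.
  by rewrite [d]splitr ltrD.
move=> x Ux; split=> [[d d0]|Nfx]; first by apply => //; rewrite subrr normr0.
have [r r0 Nr] := open_ball oN Nfx.
have [d d0 Hd] := @sc0_eps _ _ _ _ _ _ 0 x _ sf Ux r0.
exists d => // y yx Uy; apply: Nr; have := Hd y Uy yx.
by rewrite !lift0.
Qed.

Lemma overlap_dom_open c c' : atlas c -> atlas c' ->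
  exists2 N, open N & overlap_dom c c' = odom c `&` N.
Proof.
move=> ac ac'; have [[[N oN NE] _] _] := atlas_compatible ac ac'.
have [M oM ME] := sc0_preimage (retraction_smooth c 0) oN.
exists M => //; apply/seteqP; split=> x [ox].
  rewrite /preimage /= NE => -[_ Nx]; split => //; exact/ME.
move=> Mx; split => //; rewrite /preimage /= NE; split; last exact/ME.
exact: retraction_rimage.
Qed.

Lemma sc_domain_overlap c c' : atlas c -> atlas c' ->
  sc_domain (overlap_dom c c').
Proof.
move=> ac ac'; have [N oN ->] := overlap_dom_open ac ac'.
by apply: sc_domainI => //; exact: sc_domain_odom.
Qed.

Lemma tmap_smooth k c c' : atlas c -> atlas c' ->
  sck k (overlap_dom c c') (odom c') (tmap c c').
Proof. by move=> ac ac'; have [[_ H] _] := atlas_compatible ac ac'; exact: H. Qed.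

(** A basic neighbourhood is a finite intersection of chart domains, each relatively open in the
    coordinates of [c] by compatibility. In other words, the inverse of [ccoord c] is continuous. *)
Lemma chart_nbhs c p (N : set X) : atlas c -> cdom c p ->
  nbhs (p : chart_space (@atlas R X)) N ->
  exists O, [/\ open O, O (ccoord c p) &
    forall q, cdom c q -> O (ccoord c q) -> N q].
Proof.
move=> ac cp; rewrite nbhsE => -[B [[D sD <-] [A DA Ap]] BN].
have [F FA AE] := sD _ DA.
have fin (s : seq (set X)) :
   (forall V, V \in s -> V p /\ exists2 c', atlas c' & V = cdom c') ->
   exists O, [/\ open O, O (ccoord c p) &
     forall q, cdom c q -> O (ccoord c q) -> forall V, V \in s -> V q].
  elim: s => [|V s IH] H; first by exists setT; split => //; exact: openT.
  have [|O [oO Op HO]] := IH.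
    by move=> W Ws; apply: H; rewrite inE Ws orbT.
  have [Vp [c' ac' VE]] := H V (mem_head _ _).
  have [[[N1 oN NE] _] _] := atlas_compatible ac ac'.
  exists (O `&` N1); split; first exact: openI.
    split => //; have : @overlap R X c c' (ccoord c p).
      by exists p => //; split => //; rewrite -VE.
    by rewrite NE => -[].
  move=> q cq [Oq Nq] W; rewrite inE => /orP[/eqP ->|]; last exact: HO.
  have : @overlap R X c c' (ccoord c q).
    by rewrite NE; split => //; exact: ccoord_rimage.
  by case=> q' [cq' cq''] /(ccoord_inj cq' cq) <-; rewrite VE.
have [|O [oO Op HO]] := fin (finmap.enum_fset F).
  move=> V VF; split; last by have := FA _ VF; rewrite inE.
  by move: Ap; rewrite -AE; exact.
exists O; split => // q cq Oq.
have Aq : (A : set X) q by rewrite -AE => V VF; exact: (HO q cq Oq V).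
by apply: BN; exists A.
Qed.

End charts_theory.

Arguments tmap {R X} c c' _.

Lemma fsum_seq {R : realType} (I : choiceType) (r : seq I) (F : I -> R) :
  (forall i, i \notin r -> F i = 0) ->
  \sum_(i \in [set: I]) F i = \sum_(i <- undup r) F i.
Proof.
move=> H; rewrite (fsbigE (undup r)) ?undup_uniq //.
  by apply: eq_bigl => i; rewrite in_setT.
by move=> i _; rewrite mem_undup; exact: H.
Qed.

(** * Sc-smooth functions on an M-polyfold *)

Section smooth_functions.
Context {R : realType}.
Variable X : Mpolyfold R.
Implicit Types (c : chart R X) (p : X) (f : X -> R).

Definition in_chart c f (x : ambient c 0%N) : R :=
  read_through (cdom c) (ccoord c) f (retraction c x).

Arguments in_chart c f x : clear implicits.

Lemma in_chartE c f x p : cdom c p -> ccoord c p = retraction c x ->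
  in_chart c f x = f p.
Proof. by move=> cp e; rewrite /in_chart -e read_chart. Qed.

Definition smooth_fun f := forall c, atlas c ->
  sc_smooth (F := sc_real) (odom c) setT (in_chart c f).

(** The neighbourhood is taken in the ambient space around [x], which need not lie on the retract,
    and [P] is tested at the points with coordinates [r y]; this is the form that [sck_local]
    consumes. *)
Definition chart_near c (x : ambient c 0%N) (P : X -> Prop) :=
  exists N, [/\ open N, N x & forall y p, odom c y -> N y -> cdom c p ->
    ccoord c p = retraction c y -> P p].

Arguments chart_near c x P : clear implicits.

Lemma chart_near_and c x (P Q : X -> Prop) :
  chart_near c x P -> chart_near c x Q -> chart_near c x (fun p => P p /\ Q p).
Proof.
move=> [N [oN Nx HN]] [M [oM Mx HM]]; exists (N `&` M); split => //.
  exact: openI.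
by move=> y p oy [Ny My] cp e; split; [exact: HN e|exact: HM e].
Qed.

Lemma chart_near_imp c x (P Q : X -> Prop) : (forall p, P p -> Q p) ->
  chart_near c x P -> chart_near c x Q.
Proof.
by move=> PQ [N [oN Nx H]]; exists N; split => // y p oy Ny cp e; exact/PQ/(H y).
Qed.

Lemma chart_near_nbhs c x p (N : set X) : atlas c -> odom c x -> cdom c p ->
  ccoord c p = retraction c x -> nbhs (p : chart_space (@atlas R X)) N ->
  chart_near c x N.
Proof.
move=> ac ox cp e nN; have [K [oO Op HO]] := chart_nbhs ac cp nN.
have [M oM ME] := sc0_preimage (retraction_smooth c 0) oO.
exists M; split => //; first by apply/ME; rewrite // -e.
by move=> y q oy My cq eq; apply: HO => //; rewrite eq; apply/ME.
Qed.

Lemma chart_near_self c x p (P : X -> Prop) : odom c x -> cdom c p ->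
  ccoord c p = retraction c x -> chart_near c x P -> P p.
Proof. by move=> ox cp e [N [oN Nx H]]; exact: H e. Qed.

Lemma smooth_cst (a : R) : smooth_fun (fun=> a).
Proof.
move=> c ac k; apply: eq_sck (sck_cst_real k a (sc_domain_odom c)) => x ox.
by have [p cp e] := odom_point ox; rewrite (in_chartE _ cp e).
Qed.

Lemma smooth_mul f g : smooth_fun f -> smooth_fun g ->
  smooth_fun (fun p => f p * g p).
Proof.
move=> sf sg c ac k; have dU := sc_domain_odom c.
apply: eq_sck (sck_mul dU (sf c ac k) (sg c ac k)) => x ox.
by have [p cp e] := odom_point ox; rewrite !(in_chartE _ cp e).
Qed.

Lemma smooth_add f g : smooth_fun f -> smooth_fun g ->
  smooth_fun (fun p => f p + g p).
Proof.
move=> sf sg c ac k; have dU := sc_domain_odom c.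
apply: eq_sck (sck_add_real dU (sf c ac k) (sg c ac k)) => x ox.
by have [p cp e] := odom_point ox; rewrite !(in_chartE _ cp e).
Qed.

Lemma smooth_flat f : smooth_fun f -> smooth_fun (fun p => flat 0 (f p)).
Proof.
move=> sf c ac k; have dU := sc_domain_odom c.
apply: eq_sck (sck_comp dU (sc_domainT sc_real) (sf c ac k) (sck_flat k 0)).
by move=> x ox; have [p cp e] := odom_point ox; rewrite /= !(in_chartE _ cp e).
Qed.

Lemma smooth_sum (I : Type) (s : seq I) (f : I -> X -> R) :
  (forall i, smooth_fun (f i)) -> smooth_fun (fun p => \sum_(i <- s) f i p).
Proof.
move=> sf; elim: s => [|i s IH].
  by under [X in smooth_fun X]funext do rewrite big_nil; exact: smooth_cst.
under [X in smooth_fun X]funext do rewrite big_cons.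
exact: smooth_add.
Qed.

Lemma smooth_prod (I : Type) (s : seq I) (f : I -> X -> R) :
  (forall i, smooth_fun (f i)) -> smooth_fun (fun p => \prod_(i <- s) f i p).
Proof.
move=> sf; elim: s => [|i s IH].
  by under [X in smooth_fun X]funext do rewrite big_nil; exact: smooth_cst.
under [X in smooth_fun X]funext do rewrite big_cons.
exact: smooth_mul.
Qed.

Lemma smooth_local f :
  (forall c x, atlas c -> odom c x ->
     exists2 g, smooth_fun g & chart_near c x (fun p => f p = g p)) ->
  smooth_fun f.
Proof.
move=> H c ac k; apply: sck_local; first exact: sc_domain_odom.
move=> x ox; have [g sg [N [oN Nx fg]]] := H c x ac ox; exists N; split => //.
have dN := sc_domainI (sc_domain_odom c) oN.
have sgN := sck_sub (V' := setT) dN (@subIsetl _ _ _) (fun _ _ => I) (sg c ac k).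
apply: eq_sck sgN => y [oy Ny]; have [p cp e] := odom_point oy.
by rewrite !(in_chartE _ cp e) (fg y p).
Qed.

Definition locally_finite_family (I : eqType) (f : I -> X -> R) :=
  forall c x, atlas c -> odom c x -> exists s : seq I,
    chart_near c x (fun p => forall i, i \notin s -> f i p = 0).

Lemma smooth_fsum (I : choiceType) (f : I -> X -> R) :
  (forall i, smooth_fun (f i)) -> locally_finite_family f ->
  smooth_fun (fun p => \sum_(i \in [set: I]) f i p).
Proof.
move=> sf lf; apply: smooth_local => c x ac ox; have [s Hs] := lf c x ac ox.
exists (fun p => \sum_(i <- undup s) f i p); first exact: smooth_sum.
by apply: chart_near_imp Hs => p; exact: fsum_seq.
Qed.

Lemma chart_point p : exists c, [/\ atlas c, cdom c p, odom c (ccoord c p) &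
  ccoord c p = retraction c (ccoord c p)].
Proof.
have [c ac cp] := atlas_cover p; exists c; split => //; first exact: ccoord_odom.
by rewrite ccoord_fixed.
Qed.

Lemma locally_finite_at (I : eqType) (f : I -> X -> R) p :
  locally_finite_family f -> exists s : seq I, forall i, i \notin s -> f i p = 0.
Proof.
move=> lf; have [c [ac cp op e]] := chart_point p.
have [s Hs] := lf c _ ac op; exists s; exact: chart_near_self Hs.
Qed.

Lemma smooth_gt c x f p (a : R) : smooth_fun f -> atlas c -> odom c x -> cdom c p ->
  ccoord c p = retraction c x -> a < f p -> chart_near c x (fun q => a < f q).
Proof.
move=> sf ac ox cp e afp.
have [M oM ME] := sc0_preimage (sf c ac 0%N)
  (@open_gt _ a : open ([set t | a < t] : set R^o)).
exists M; split => //; first by apply/ME; rewrite //= (in_chartE _ cp e).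
by move=> y q oy My cq eq; rewrite -(in_chartE f cq eq); apply/ME.
Qed.

End smooth_functions.

Arguments in_chart {R X} c f x.
Arguments chart_near {R X} c x P.

(** * Countable families of balls and Hilbert bump functions *)

Section separability.
Context {R : realType}.
Implicit Types E : scBanach R.

Lemma compact_net (V : normedModType R) (K : set V) (e : R) : compact K -> 0 < e ->
  exists s : seq V, forall x, K x -> exists2 y, y \in s & `|x - y| < e.
Proof.
rewrite compact_cover => cK e0.
have [|x Kx|D _ KD] := cK V setT (fun y => [set x | `|x - y| < e]).
- move=> y _; apply: ball_openP => x /= xy; exists (e - `|x - y|).
    by rewrite subr_gt0.
  move=> z; rewrite ltrBrDr => zx; apply: le_lt_trans zx.
  exact: ler_distD.
- by exists x => //=; rewrite subrr normr0.
exists (finmap.enum_fset D) => x /KD [y Dy xy]; by exists y.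
Qed.

(** The finite nets [s m] of the image of the unit ball of [E 1], multiplied by all naturals,
    approximate every point coming from [E 1]. *)
Lemma sc_dense_sequence E : exists u : nat -> E 0%N,
  forall x (e : R), 0 < e -> exists k, `|x - u k| < e.
Proof.
have cK := @sc_incl_compact _ E 0.
have net m : exists s : seq (E 0%N), forall x : E 1%N, `|x| <= 1 ->
    exists2 y, y \in s & `|sc_emb x - y| < m.+1%:R^-1.
  have [|s Hs] := compact_net (e := m.+1%:R^-1) cK; first by rewrite invr_gt0.
  by exists s => x x1; apply: Hs; apply: subset_closure; exists x.
pose s m := projT1 (cid (net m)).
have sP m (x : E 1%N) : `|x| <= 1 ->
    exists2 y, y \in s m & `|sc_emb x - y| < m.+1%:R^-1.
  exact: (projT2 (cid (net m)) x).
exists (fun k => if unpickle k is Some (n, m, j) then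
  (n%:R : R) *: nth 0 (s m) j else 0).
move=> x e e0.
have e20 : 0 < e / 2 by rewrite divr_gt0.
have [||x' [/= xy /(_ 1%N) [y _ yE]]] := @level_densely _ E [set z | `|x - z| < e / 2].
- by exists x; rewrite /= subrr normr0.
- apply: ball_openP => z /= xz; exists (e / 2 - `|x - z|); first by rewrite subr_gt0.
  move=> t; rewrite ltrBrDr => tz; apply: le_lt_trans tz.
  rewrite distrC [`|x - z|]distrC; exact: ler_distD.
rewrite -yE in xy.
(* Dividing by [n + 1] brings [y] into the unit ball; the net must be finer than [e / 2] by the same
   factor. *)
have [n yn] : exists n : nat, `|y| < n.+1%:R.
  by exists (Num.trunc `|y|); apply: truncnS_gt.
have n0 : 0 < n.+1%:R :> R by rewrite ltr0n.
have [m mE] : exists m : nat, m.+1%:R^-1 < e / 2 / n.+1%:R.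
  have h : 0 < e / 2 / n.+1%:R by rewrite divr_gt0.
  exists (Num.trunc (e / 2 / n.+1%:R)^-1).
  by rewrite -[X in _ < X]invrK ltf_pV2 ?posrE ?invr_gt0 // truncnS_gt.
have [|z zs yz] := sP m (n.+1%:R^-1 *: y).
  by rewrite normrZ ger0_norm ?invr_ge0 // mulrC ler_pdivrMr // mul1r ltW.
exists (pickle (n.+1, m, index z (s m))); rewrite pickleK nth_index //.
apply: le_lt_trans (ler_distD (sc_emb y) _ _) _.
rewrite [e]splitr; apply: ltrD => //.
have -> : sc_emb y - n.+1%:R *: z = n.+1%:R *: (sc_emb (n.+1%:R^-1 *: y) - z).
  by rewrite embZ scalerBr scalerA mulfV ?gt_eqF // scale1r.
rewrite normrZ gtr0_norm // mulrC -ltr_pdivlMr //.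
exact: lt_trans yz _.
Qed.

(** Arbitrarily small radii are available at every point so that some ball containing it fits into a
    given neighbourhood. *)
Lemma sc_ball_sequence E : exists (d : nat -> E 0%N) (q : nat -> R),
  (forall k, 0 < q k) /\
  forall x (e : R), 0 < e -> exists2 k, `|x - d k| < q k & q k < e.
Proof.
have [u Hu] := sc_dense_sequence E.
exists (fun k => if (unpickle k : option (nat * nat)) is Some (i, _)
  then u i else 0 : E 0%N).
exists (fun k => if (unpickle k : option (nat * nat)) is Some (_, j)
  then j.+1%:R^-1 else 1 : R).
split=> [k|x e e0].
  by case: unpickle => [[i j]|] //; rewrite invr_gt0 ltr0n.
have j0 : 0 < (Num.trunc e^-1).+1%:R :> R by rewrite ltr0n.
have [|i xi] := Hu x (Num.trunc e^-1).+1%:R^-1; first by rewrite invr_gt0.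
exists (pickle (i : nat, Num.trunc e^-1)); rewrite pickleK //.
by rewrite -[X in _ < X]invrK ltf_pV2 ?posrE ?invr_gt0 // truncnS_gt.
Qed.

End separability.

Section bump.
Context {R : realType}.
Implicit Types E : scBanach R.

Lemma hilbert_polarization (V : completeNormedModType R) (ip : V -> V -> R) :
  (forall k x y z, ip (k *: x + y) z = k * ip x z + ip y z) ->
  (forall x y, ip x y = ip y x) -> (forall x, ip x x = `|x| ^+ 2) ->
  forall x y, ip x y = (`|x + y| ^+ 2 - `|x - y| ^+ 2) / 4.
Proof.
move=> l s n x y.
have D a b z : ip (a + b) z = ip a z + ip b z by rewrite -[a in LHS]scale1r l mul1r.
have N a z : ip (- a) z = - ip a z.
  have := l (-1) a 0 z; rewrite addr0 scaleN1r => ->.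
  have := D 0 0 z; rewrite addr0 => h.
  have -> : ip 0 z = 0 by lra.
  by rewrite addr0 mulN1r.
have S a b : ip (a + b) (a + b) = ip a a + 2 * ip a b + ip b b.
  by rewrite D (s a) (s b) !D (s b a); lra.
by rewrite -!n !S (s x (- y)) !N (s y (- y)) N (s y x); lra.
Qed.

(** [hilbert_space] asks for no continuity of the inner product; polarization derives it from that
    of the norm. *)
Lemma sc_bilinear_ip E (ip : E 0%N -> E 0%N -> R) :
  (forall k x y z, ip (k *: x + y) z = k * ip x z + ip y z) ->
  (forall x y, ip x y = ip y x) -> (forall x, ip x x = `|x| ^+ 2) ->
  sc_bilinear (E := E) (F := E) (G := sc_real) (fun xy => ip xy.1 xy.2).
Proof.
move=> l s n; split.
- by move=> z k x y /=; rewrite l.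
- by move=> z k x y /=; rewrite s l !(s z).
apply: sc0_real; apply: continuous_subspaceT.
have -> : (fun xy : sc_sum E E 0%N => ip xy.1 xy.2) =
    (fun xy : E 0%N * E 0%N => (`|xy.1 + xy.2| ^+ 2 - `|xy.1 - xy.2| ^+ 2) / 4).
  by apply/funext => xy; rewrite (hilbert_polarization l s n).
move=> xy; apply: cvgM; last exact: cvg_cst.
have c2 (f : E 0%N * E 0%N -> R) : {for xy, continuous f} ->
   {for xy, continuous (fun z => f z ^+ 2)}.
  move=> cf; have -> : (fun z => f z ^+ 2) = (fun z => f z * f z).
    by apply/funext => z; rewrite expr2.
  exact: cvgM.
apply: cvgB; apply: c2; apply: cvg_norm.
  by apply: cvgD; [exact: cvg_fst|exact: cvg_snd].
by apply: cvgB; [exact: cvg_fst|exact: cvg_snd].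
Qed.

(** The argument is expanded as [q^2 - <d, d> - <x, x> + 2 <x, d>]. The translation [x - d] would
    not be an sc-map, as [d] need not lie in [E_oo], whereas [<., d>] is an operator into the reals
    for every [d] in [E 0]. *)
Lemma sck_hilbert_ball k E (d : E 0%N) (q : R) : hilbert_space (E 0%N) ->
  sck k (F := sc_real) setT setT (fun x : E 0%N => flat 0 (q ^+ 2 - `|x - d| ^+ 2)).
Proof.
move=> [ip [l s n]]; have dT := sc_domainT E.
have bip := sc_bilinear_ip l s n; have [lB _ _] := bip.
have [M M0 HM] := sc_bilinear_bound bip.
have oid := operator_id E.
have sid := sck_operator k oid.
have o1 : sc_operator (E := E) (F := sc_real) (fun x => ip x d).
  split; first exact: lB.
  apply: sc0_real; apply: continuous_subspaceT.
  apply: (linear_continuous_of_bound (W := R^o) (M := M * `|d|)); first exact: lB.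
  by move=> x; apply: le_trans (HM x d) _; rewrite [`|x| * _]mulrC mulrA.
have s1 := sck_operator k o1.
have s2 := sck_bilinear2 bip dT sid sid.
have s3 := sck_add_real dT (sck_cst_real k (q ^+ 2 - ip d d) dT)
  (sck_add_real dT (sck_mul dT (sck_cst_real k (-1) dT) s2)
     (sck_mul dT (sck_cst_real k 2 dT) s1)).
apply: eq_sck (sck_comp dT (sc_domainT _) s3 (sck_flat k 0)) => x _ /=.
congr (flat 0 _); rewrite -n.
have E1 : ip (x - d) (x - d) = ip x x - 2 * ip x d + ip d d.
  have L w : ip (x - d) w = ip x w - ip d w.
    by have := l (-1) d x w; rewrite scaleN1r addrC => ->; rewrite mulN1r addrC.
  rewrite L // !(s _ (x - d)) !L // (s d x); lra.
rewrite E1; lra.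
Qed.

End bump.

(** * Locally finite smooth weights *)

Section partition.
Context {R : realType}.
Variable X : Mpolyfold R.
Implicit Types (c : chart R X) (p : X) (f : X -> R).

Definition chart_bump c (d : ambient c 0%N) (q : R) p : R :=
  if `[< cdom c p >] then flat 0 (q ^+ 2 - `|ccoord c p - d| ^+ 2) else 0.

Lemma chart_bump_ge0 c d q p : 0 <= @chart_bump c d q p.
Proof. by rewrite /chart_bump; case: ifP => // _; exact: flat_ge0. Qed.

Lemma chart_bump_gt0 c (d : ambient c 0%N) (q : R) p : 0 < q ->
  (0 < chart_bump d q p) <-> cdom c p /\ `|ccoord c p - d| < q.
Proof.
move=> q0; rewrite /chart_bump; case: asboolP => cp; last first.
  by rewrite ltxx; split=> // -[].
rewrite flat_gt0 subr_gt0 ltr_pXn2r ?nnegrE ?(ltW q0) //.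
by split => [|[]].
Qed.

(** Near a point of [cdom c] this is a Hilbert bump composed with a transition map; near any other
    point it is 0, since it vanishes off [W] and the closure of [W] stays inside [cdom c]. *)
Lemma chart_bump_smooth c (d : ambient c 0%N) (q : R) (W : set X) :
  atlas c -> hilbert_space (ambient c 0%N) -> 0 < q ->
  closure (W : set (chart_space (@atlas R X))) `<=` cdom c ->
  (forall p, cdom c p -> `|ccoord c p - d| < q -> W p) ->
  smooth_fun (chart_bump d q).
Proof.
move=> ac hc q0 Wc dW c' ac' k; apply: sck_local; first exact: sc_domain_odom.
move=> x ox; have [p cp' e] := odom_point ox.
have [cp|cp] := pselect (cdom c p).
  have [N oN NE] := overlap_dom_open ac' ac.
  have Nx : (odom c' `&` N) x.
    by rewrite -NE; apply/overlap_domP; split => //; exists p.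
  exists N; split => //; first by case: Nx.
  rewrite -NE.
  have tT := sck_subT (V' := setT) (tmap_smooth k ac' ac)
    (sc_domain_overlap ac' ac) (fun _ _ => I).
  have := sck_comp (sc_domain_overlap ac' ac) (sc_domainT _) tT
    (sck_hilbert_ball k d q hc).
  apply: eq_sck => y /overlap_domP [oy [r [cr' cr er]]] /=.
  rewrite (in_chartE _ cr' er) (tmapE cr' cr er) /chart_bump.
  by rewrite (asboolT cr).
have nW : nbhs (p : chart_space (@atlas R X))
    (~` closure (W : set (chart_space (@atlas R X)))).
  apply: open_nbhs_nbhs; split; first exact/closed_openC/closed_closure.
  by move=> /Wc.
have [N [oN Nx HN]] := chart_near_nbhs ac' ox cp' e nW.
have dN := sc_domainI (sc_domain_odom c') oN.
exists N; split => //; apply: eq_sck (sck_cst_real k 0 dN) => y [oy Ny].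
have [r cr er] := odom_point oy; rewrite (in_chartE _ cr er).
have Wr : ~ W r by move=> Wr; apply: (HN y r oy Ny cr er); exact: subset_closure.
apply/eqP; rewrite eq_sym eq_le chart_bump_ge0 andbT leNgt; apply/negP.
by move=> /(chart_bump_gt0 _ _ q0) [cr' rd]; apply: Wr; exact: dW.
Qed.

(** Regularity shrinks Hilbert chart domains to open sets with closure still inside; the closure
    condition survives refinement. *)
Lemma hilbert_cover (p0 : X) : Hilbert_Mpolyfold X ->
  exists (V : set (set X)) (cV : set X -> chart R X),
  [/\ forall B, V B -> open (B : set (chart_space (@atlas R X))),
      \bigcup_(B in V) B = setT,
      forall B, V B -> [/\ atlas (cV B), hilbert_space (ambient (cV B) 0%N) &
        closure (B : set (chart_space (@atlas R X))) `<=` cdom (cV B)] &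
      forall p, exists2 N, nbhs (p : chart_space (@atlas R X)) N &
        finite_set [set B | V B /\ B `&` N !=set0]].
Proof.
move=> hX; pose Y := chart_space (@atlas R X).
pose good (B : set Y) c := [/\ atlas c, hilbert_space (ambient c 0%N) &
  closure B `<=` cdom c].
have cdom_open c : atlas c -> open (cdom c : set Y).
  move=> ac; exists [set (cdom c : set Y)]; last by rewrite bigcup_set1.
  move=> _ ->; exists (finmap.fset1 (cdom c)).
    by move=> V; rewrite finmap.inE => /eqP ->; rewrite inE; exists c.
  apply/seteqP; split=> p /= H; first by apply: H; rewrite /= finmap.inE.
  by move=> V /=; rewrite finmap.inE => /eqP ->.
have [||V [oV cV rV fV]] := @Mpolyfold_paracompact R X
    [set B : set Y | open B /\ exists c, good B c].
- by move=> B [].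
- apply/seteqP; split => // p _; have [c [ac cp hc]] := hX p.
  have [N [oN Np Nc]] := paracompact_regular (@Mpolyfold_paracompact R X)
    (@Mpolyfold_hausdorff R X) (cdom_open c ac) cp.
  by exists N => //; split => //; exists c.
(* Charts are too large to index the cover, so they are attached to its members by choice; a set
   outside [V] receives an arbitrary chart around [p0]. *)
have ch B : exists c, V B -> good B c.
  have [VB|nVB] := pselect (V B); last first.
    by have [c _ _] := atlas_cover p0; exists c.
  have [A [oA [c [ac hc Ac]]] BA] := rV _ VB; exists c => _; split => //.
  by apply: subset_trans Ac; exact: closureS.
by exists V, (fun B => projT1 (cid (ch B))); split => // B; exact: projT2 (cid (ch B)).
Qed.

(** Milnor's trick: with [b n = \sum_B f B n], the functions [f B n] multiplied
    by a cutoff that vanishes as soon as some [b i], [i < n], exceeds [1/(n+1)]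
    still cover [X], but any point where [b k] is positive has a neighbourhood on
    which they vanish for all large [n]. *)
Lemma smooth_partition (p0 : X) : Hilbert_Mpolyfold X ->
  exists (I : choiceType) (ch : I -> chart R X) (a : I -> X -> R),
  [/\ forall i, [/\ atlas (ch i), hilbert_space (ambient (ch i) 0%N) &
        closure ([set p | 0 < a i p] : set (chart_space (@atlas R X)))
          `<=` cdom (ch i)],
      forall i, smooth_fun (a i),
      forall i p, 0 <= a i p,
      locally_finite_family a &
      forall p, exists i, 0 < a i p].
Proof.
move=> hX; have [V [cV [oV covV VP fV]]] := hilbert_cover p0 hX.
pose bs B := cid (sc_ball_sequence (ambient (cV B))).
pose d B : nat -> ambient (cV B) 0%N := projT1 (bs B).
pose qs B := cid (projT2 (bs B)).
pose q B : nat -> R := projT1 (qs B).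
have q0 B n : 0 < q B n by exact: (projT2 (qs B)).1.
have dqP B (x : ambient (cV B) 0%N) (e : R) : 0 < e ->
    exists2 n, `|x - d B n| < q B n & q B n < e.
  exact: (projT2 (qs B)).2.
(* Only balls whose points in the chart lie in [B] are kept; the other indices contribute the zero
   function, so the family is indexed by all of [set X * nat]. *)
pose adm B n := V B /\
  forall p, cdom (cV B) p -> `|ccoord (cV B) p - d B n| < q B n -> B p.
pose f (B : set X) n p : R :=
  if `[< adm B n >] then chart_bump (d B n) (q B n) p else 0.
have f0 B n p : 0 <= f B n p.
  by rewrite /f; case: ifP => // _; exact: chart_bump_ge0.
have fB B n p : 0 < f B n p -> V B /\ B p.
  rewrite /f; case: asboolP => [[VB H]|]; last by rewrite ltxx.
  by move=> /(chart_bump_gt0 _ _ (q0 B n)) [cp pd]; split => //; exact: H.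
have f_smooth B n : smooth_fun (f B n).
  rewrite /f; case: asboolP => [[VB H]|_]; last exact: smooth_cst.
  have [ac hc Bc] := VP _ VB.
  exact: (chart_bump_smooth ac hc (q0 B n) Bc H).
have f_cover p : exists B n, 0 < f B n p.
  have [B VB Bp] : (\bigcup_(B in V) B) p by rewrite covV.
  have [ac hc Bc] := VP _ VB.
  have cp : cdom (cV B) p by apply: Bc; exact: subset_closure.
  have nB : nbhs (p : chart_space (@atlas R X)) B.
    by apply: open_nbhs_nbhs; split => //; exact: oV.
  have [K [oK Kp KB]] := chart_nbhs ac cp nB.
  have [r r0 Kr] := open_ball oK Kp.
  have r20 : 0 < r / 2 by rewrite divr_gt0.
  have [n pd qr] := dqP B (ccoord (cV B) p) _ r20.
  exists B, n; rewrite /f asboolT; first by apply/chart_bump_gt0.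
  split => // s cs sd; apply: KB => //; apply: Kr.
  apply: le_lt_trans (ler_distD (d B n) _ _) _; rewrite [r]splitr.
  by apply: ltrD; [exact: lt_trans qr|rewrite distrC; exact: lt_trans qr].
have f_lf c x : atlas c -> odom c x -> exists s : seq (set X),
    chart_near c x (fun p => forall B n, B \notin s -> f B n p = 0).
  move=> ac ox; have [p cp e] := odom_point ox.
  have [N nN /finite_seqP [s sE]] := fV p; exists s.
  apply: chart_near_imp (chart_near_nbhs ac ox cp e nN) => r Nr B n Bs.
  apply/eqP; rewrite eq_le f0 andbT leNgt; apply/negP => /fB [VB Br].
  move/negP: Bs; apply; change ([set` s] B); rewrite -sE.
  by split => //; exists r.
pose b n p := \sum_(B \in [set: set X]) f B n p.
have b_smooth n : smooth_fun (b n).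
  apply: smooth_fsum => // c x ac ox; have [s Hs] := f_lf c x ac ox.
  by exists s; apply: chart_near_imp Hs => p H B; exact: H.
have b_gt0 B n p : 0 < f B n p -> 0 < b n p.
  move=> fp; have [c [ac cp op e]] := chart_point p.
  have [s Hs] := f_lf c _ ac op.
  have {}Hs := chart_near_self op cp e Hs.
  have Bs : B \in s by apply: contraT => /Hs h; rewrite h ltxx in fp.
  rewrite /b (fsum_seq (r := s)); last by move=> C; exact: Hs.
  rewrite (bigD1_seq B) ?undup_uniq ?mem_undup //=.
  by rewrite ltr_pwDl // sumr_ge0.
pose cut n p := \prod_(i < n) flat 0 (n.+1%:R^-1 - b i p).
pose a (i : set X * nat) p := f i.1 i.2 p * cut i.2 p.
have cut0 n p : 0 <= cut n p by apply: prodr_ge0 => i _; exact: flat_ge0.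
have cut_smooth n : smooth_fun (cut n).
  apply: smooth_prod => i; apply: smooth_flat.
  have -> : (fun p => n.+1%:R^-1 - b i p) = (fun p => n.+1%:R^-1 + (-1) * b i p).
    by apply/funext => p; rewrite mulN1r.
  apply: smooth_add; first exact: smooth_cst.
  by apply: smooth_mul; first exact: smooth_cst.
have aB i p : 0 < a i p -> V i.1 /\ i.1 p.
  rewrite /a => h; apply: (fB _ i.2); rewrite lt_neqAle f0 andbT.
  by apply: contraTN h => /eqP <-; rewrite mul0r ltxx.
have [Bdflt [ndflt /fB [VBdflt _]]] := f_cover p0.
(* An index outside [V] has zero weight but still needs a Hilbert chart. *)
pose ch (i : set X * nat) := cV (if `[< V i.1 >] then i.1 else Bdflt).
exists (set X * nat)%type, ch, a; split.
- move=> i; rewrite /ch; case: asboolP => [Vi|nVi].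
    have [ac hc Bc] := VP _ Vi; split => //; apply: subset_trans Bc.
    by apply: closureS => p /= /aB [].
  have [ac hc _] := VP _ VBdflt; split => //.
  have -> : [set p | 0 < a i p] = set0.
    by apply/seteqP; split => p //= /aB [].
  by rewrite closure0.
- by move=> i; exact: smooth_mul.
- by move=> i p; rewrite mulr_ge0.
- move=> c x ac ox; have [p cp e] := odom_point ox.
  have [B0 [n0 fp]] := f_cover p; have bp := b_gt0 _ _ _ fp.
  have bp2 : b n0 p / 2 < b n0 p by rewrite ltr_pdivrMr // ltr_pMr // ltr1n.
  have near1 := smooth_gt (b_smooth n0) ac ox cp e bp2.
  have [s Hs] := f_lf c x ac ox.
  (* For [n >= N] the index [n0] occurs in the cutoff, and [1 / (n + 1)] is below [b n0 p / 2],
     hence below [b n0] near [p]. *)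
  pose N := maxn n0.+1 (Num.trunc (b n0 p / 2)^-1).+1.
  exists [seq (B, n) | B <- s, n <- iota 0 N].
  apply: chart_near_imp (chart_near_and near1 Hs) => r [br fr] [B n] Bn.
  rewrite /a /=.
  have [Bs|/fr ->] := boolP (B \in s); last by rewrite mul0r.
  have Nn : (N <= n)%N.
    rewrite leqNgt; apply: contra Bn => nN.
    by apply/allpairsP; exists (B, n); rewrite mem_iota.
  have n0n : (n0 < n)%N by apply: leq_trans Nn; rewrite leq_max leqnn.
  rewrite /cut (bigD1 (Ordinal n0n)) //= flat_le0 ?mul0r ?mulr0 //.
  rewrite subr_le0; apply: ltW; apply: lt_trans br.
  have tn : (Num.trunc (b n0 p / 2)^-1 < n)%N.
    by apply: leq_trans Nn; rewrite leq_max leqnn orbT.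
  have b20 : 0 < b n0 p / 2 by rewrite divr_gt0.
  rewrite -[X in _ < X]invrK ltf_pV2 ?posrE ?invr_gt0 ?ltr0n //.
  by apply: lt_trans (truncnS_gt _) _; rewrite ltr_nat ltnS.
- move=> p; have [B0 [n0 fp]] := f_cover p.
  have ex : exists n, 0 < b n p by exists n0; exact: b_gt0 fp.
  (* For the first [n] with [b n p > 0] all earlier [b i p] vanish, so every factor of the cutoff is
     positive at [p]. *)
  pose n := ex_minn (P := fun n => 0 < b n p) ex.
  have [bn minn] : 0 < b n p /\ forall m, (m < n)%N -> b m p <= 0.
    rewrite /n; case: ex_minnP => m bm Hm; split => // k km.
    by rewrite leNgt; apply: contraTN km => /Hm; rewrite -leqNgt.
  have [B fBp] : exists B, 0 < f B n p.
    apply: contrapT => /forallNP H; move: bn; rewrite /b fsbig1 ?ltxx // => B _.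
    apply/eqP; rewrite eq_le f0 andbT leNgt; exact/negP/H.
  exists (B, n); rewrite /a /= mulr_gt0 //; apply: prodr_gt0 => i _.
  rewrite flat_gt0 subr_gt0; apply: le_lt_trans (minn _ (ltn_ord i)) _.
  by rewrite invr_gt0.
Qed.

End partition.

(** * Tangent spaces *)

Section tangent_spaces.
Context {R : realType}.
Variable X : Mpolyfold R.
Implicit Types (c : chart R X) (p : X).

Lemma level_coord c c' m p : atlas c -> atlas c' -> cdom c p -> cdom c' p ->
  sc_level (ambient c) m (ccoord c p) -> sc_level (ambient c') m (ccoord c' p).
Proof.
move=> ac ac' cp cp' lp; rewrite -(tmap_coord cp cp').
exact: sc0_level (tmap_smooth 0 ac ac') (overlap_dom_coord cp cp') lp.
Qed.

Lemma emb_coord1 c p : in_level 1 p -> atlas c -> cdom c p ->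
  sc_emb (coord1 c p) = ccoord c p.
Proof.
move=> [c0 [ac0 cp0 lp]] ac cp; apply: emb_lift.
exact: level_coord ac0 ac cp0 cp lp.
Qed.

Definition tdiff c c' (x : ambient c 1%N) : ambient c 0%N -> ambient c' 0%N :=
  sc_D (overlap_dom c c') (tmap c c') x.

Arguments tdiff c c' x _ : clear implicits.

Lemma tdiffP c c' x : atlas c -> atlas c' -> overlap_dom c c' (sc_emb x) ->
  is_sc_derivative (overlap_dom c c') (tmap c c') x (tdiff c c' x).
Proof.
move=> ac ac' ox; apply: sc_DP.
have /sckS [[_ H _] _] := tmap_smooth 1 ac ac'; exact: H.
Qed.

(** [x] need not lie on the retract: for [c' = c] this gives [D(tmap c c'')(x) = D(tmap c c'')(r x)
    o Dr(x)]. The maps themselves compose on the common part of the two overlap domains, and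
    derivatives are unique there. *)
Lemma tdiff_comp c c' c'' (x : ambient c 1%N) p :
  atlas c -> atlas c' -> atlas c'' -> odom c (sc_emb x) ->
  cdom c p -> cdom c' p -> cdom c'' p -> ccoord c p = retraction c (sc_emb x) ->
  tdiff c c'' x = tdiff c' c'' (coord1 c' p) \o tdiff c c' x.
Proof.
move=> ac ac' ac'' ox cp cp' cp'' e.
have o1 : overlap_dom c c' (sc_emb x) by apply/overlap_domP; split => //; exists p.
have o2 : overlap_dom c c'' (sc_emb x) by apply/overlap_domP; split => //; exists p.
have [N oN NE] := overlap_dom_open ac ac''.
pose U := overlap_dom c c' `&` N.
have dU : sc_domain U by apply: sc_domainI => //; exact: sc_domain_overlap.
have Ux : sc_trace U 1 x by split => //; move: o2; rewrite NE => -[].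
have U2 : U `<=` overlap_dom c c''.
  by move=> y [/overlap_domP [oy _] Ny]; rewrite NE.
have UP y : U y -> exists q, [/\ cdom c q, cdom c' q, cdom c'' q &
    ccoord c q = retraction c y].
  move=> Uy; have [/overlap_domP [oy [q [cq cq' eq]]] _] := Uy.
  have /overlap_domP [_ [q' [cq1 cq'' eq']]] := U2 _ Uy.
  have qq : q' = q by apply: (ccoord_inj cq1 cq); rewrite eq.
  by exists q; split => //; rewrite -qq.
have f0 : sc0 U (overlap_dom c' c'') (tmap c c').
  apply: sc0_sub (tmap_smooth 0 ac ac'); first exact: subIsetl.
  move=> y /UP [q [cq cq' cq'' eq]]; rewrite (tmapE cq cq' eq).
  exact: overlap_dom_coord.
have /sckS [g1 _] := tmap_smooth 1 ac' ac''.
have D1 := is_sc_derivative_sub (@subIsetl _ _ _ : U `<=` _) (tdiffP ac ac' o1).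
have D2 := is_sc_derivative_sub U2 (tdiffP ac ac'' o2).
have D12 := sc_derivative_comp (sc_domain_overlap ac' ac'') f0 g1 Ux D1.
apply: (sc_derivative_unique dU Ux D2).
rewrite (tmapE cp cp' e) in D12.
apply: eq_is_sc_derivative D12 => // y /UP [q [cq cq' cq'' eq]] /=.
by rewrite (tmapE cq cq' eq) (tmapE cq cq'' eq) tmap_coord.
Qed.

Lemma tdiff_self c (x : ambient c 1%N) : odom c (sc_emb x) ->
  tdiff c c x = sc_D (odom c) (retraction c) x.
Proof.
move=> ox; have oc : overlap_dom c c = odom c.
  apply/seteqP; split=> y; first by move=> /overlap_domP [].
  move=> oy; have [p cp e] := odom_point oy.
  by apply/overlap_domP; split => //; exists p.
rewrite /tdiff oc; apply: eq_sc_D => // y oy.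
by have [p cp e] := odom_point oy; rewrite (tmapE cp cp e).
Qed.

Section at_point.
Variables (p : X) (hp : in_level 1 p).

(** By [tdiff_comp] these maps form a cocycle; [tlin c c] is the projection [Dr] at the coordinates
    of [p]. *)
Definition tlin c c' : ambient c 0%N -> ambient c' 0%N := tdiff c c' (coord1 c p).

Arguments tlin c c' _ : clear implicits.

Lemma coord1_odom c : atlas c -> cdom c p -> odom c (sc_emb (coord1 c p)).
Proof. by move=> ac cp; rewrite emb_coord1 //; exact: ccoord_odom. Qed.

Lemma coord1_fixed c : atlas c -> cdom c p ->
  ccoord c p = retraction c (sc_emb (coord1 c p)).
Proof. by move=> ac cp; rewrite emb_coord1 // ccoord_fixed. Qed.

Lemma tlin_comp c c' c'' v : atlas c -> atlas c' -> atlas c'' ->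
  cdom c p -> cdom c' p -> cdom c'' p ->
  tlin c c'' v = tlin c' c'' (tlin c c' v).
Proof.
move=> ac ac' ac'' cp cp' cp''; rewrite /tlin (tdiff_comp ac ac' ac'' _ cp cp' cp'') //.
  exact: coord1_odom.
exact: coord1_fixed.
Qed.

Lemma tlin_derivative c c' : atlas c -> atlas c' -> cdom c p -> cdom c' p ->
  is_sc_derivative (overlap_dom c c') (tmap c c') (coord1 c p) (tlin c c').
Proof.
move=> ac ac' cp cp'; apply: tdiffP => //.
by rewrite emb_coord1 //; exact: overlap_dom_coord.
Qed.

Lemma rtangentE c : atlas c -> cdom c p ->
  rtangent c (coord1 c p) = range (tlin c c).
Proof.
by move=> ac cp; rewrite /rtangent /tlin tdiff_self //; exact: coord1_odom.
Qed.

Lemma tlin_rtangent c c' v : atlas c -> atlas c' -> cdom c p -> cdom c' p ->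
  rtangent c' (coord1 c' p) (tlin c c' v).
Proof.
move=> ac ac' cp cp'; rewrite rtangentE //.
by exists (tlin c c' v) => //; rewrite -tlin_comp.
Qed.

Lemma tlin_id c v : atlas c -> cdom c p -> rtangent c (coord1 c p) v ->
  tlin c c v = v.
Proof.
by move=> ac cp; rewrite rtangentE // => -[w _ <-]; rewrite -tlin_comp.
Qed.

(** As the fixed points of a continuous linear map the tangent space is closed; the Riesz argument
    takes it in this form. *)
Lemma rtangentP c v : atlas c -> cdom c p ->
  rtangent c (coord1 c p) v <-> tlin c c v = v.
Proof.
move=> ac cp; split; first exact: tlin_id.
by move=> <-; exact: tlin_rtangent.
Qed.

Lemma tangent_origin (t : tangent p) : exists c0 v0,
  [/\ atlas c0, cdom c0 p & forall c v, atlas c -> cdom c p ->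
    sval t (existT _ c v) <-> v = tlin c0 c v0].
Proof.
case: t => S [[c0 v0] [ac0 cp0 v0T] SE]; exists c0, v0; split => // c v ac cp.
rewrite /sval SE.
split=> [[_ ->] //|->]; split => //; split => //; exact: tlin_rtangent.
Qed.

Lemma tangent_coordE c0 v0 (t : tangent p) c :
  (forall c v, atlas c -> cdom c p -> sval t (existT _ c v) <-> v = tlin c0 c v0) ->
  atlas c -> cdom c p -> tangent_coord c t = tlin c0 c v0.
Proof.
move=> H ac cp; rewrite /tangent_coord; apply/(H c) => //.
by apply: (@getPex _ [set v | sval t (existT _ c v)]); exists (tlin c0 c v0); apply/H.
Qed.

Lemma tangent_coord_change c c' (t : tangent p) : atlas c -> atlas c' ->
  cdom c p -> cdom c' p -> tangent_coord c' t = tlin c c' (tangent_coord c t).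
Proof.
move=> ac ac' cp cp'; have [c0 [v0 [ac0 cp0 H]]] := tangent_origin t.
by rewrite !(tangent_coordE H) // -tlin_comp.
Qed.

Lemma tangent_coord_surj c v : atlas c -> cdom c p ->
  rtangent c (coord1 c p) v -> exists t : tangent p, tangent_coord c t = v.
Proof.
move=> ac cp vT.
pose a : chart_vector X := existT _ c v.
pose S b := vector_at p b /\ same_vector p a b.
have exS : exists2 a, vector_at p a &
  S = (fun b => vector_at p b /\ same_vector p a b) by exists a.
exists (exist (fun S => exists2 a, vector_at p a &
  S = (fun b => vector_at p b /\ same_vector p a b)) S exS).
rewrite (tangent_coordE (c0 := c) (v0 := v)) //; first exact: tlin_id.
move=> c' v' ac' cp' /=; split=> [[_ ->] //|->]; split => //.
by split => //; exact: tlin_rtangent.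
Qed.

(** A class is recovered from its representative in a single chart, because the cocycle yields all
    the others. *)
Lemma tangent_coord_inj c (t t' : tangent p) : atlas c -> cdom c p ->
  tangent_coord c t = tangent_coord c t' -> t = t'.
Proof.
move=> ac cp e.
have tE (s : tangent p) b : sval s b <->
    vector_at p b /\ projT2 b = tlin c (projT1 b) (tangent_coord c s).
  have [c0 [v0 [ac0 cp0 H]]] := tangent_origin s.
  have vs b' : sval s b' -> vector_at p b'
    by case: s {H} => S [a' va' SE]; rewrite /sval SE => -[].
  case: b => c' v'; split=> [sb|[[ac' cp' _] /= ->]].
    have vb := vs _ sb; split => //; case: vb => ac' cp' _.
    by move/H: sb => -> //; rewrite (tangent_coordE H) // -tlin_comp.
  by apply/H => //; rewrite /= (tangent_coordE H) // -tlin_comp.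
have Es : sval t = sval t'.
  by apply/funext => b; apply/propext; rewrite !tE e.
case: t t' {e tE} Es => [S HS] [S' HS'] /= Es; subst S'; congr exist.
exact: Prop_irrelevance.
Qed.

End at_point.

End tangent_spaces.

Arguments tdiff {R X} c c' x _.
Arguments tlin {R X} p c c' _.

(** * Smooth functions on [TX (+) TX] *)

Section double_tangent_functions.
Context {R : realType}.
Variable X : Mpolyfold R.
Implicit Types (c : chart R X) (p : X) (t : double_tangent X)
  (g : double_tangent X -> R).

Lemma double_coord_inj c t t' : atlas c -> double_dom c t -> double_dom c t' ->
  double_coord c t = double_coord c t' -> t = t'.
Proof.
case: t t' => [p hp v w] [p' hp' v' w'] ac; rewrite /double_dom /double_coord /=.
move=> cp cp' [ex ev ew].
have pp : p = p'.
  by apply: (ccoord_inj cp cp'); rewrite -!emb_coord1 // ex.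
subst p'; have hh : hp = hp' by exact: Prop_irrelevance.
by rewrite hh (tangent_coord_inj hp ac cp ev) (tangent_coord_inj hp ac cp ew).
Qed.

(** The induced chart reaches every value of the double retraction: [Dr(x) u] is tangent at [r x]
    because [Dr(x) = Dr(r x) o Dr(x)]. *)
Lemma double_point c (xvw : double_model c 0%N) : atlas c -> double_odom xvw ->
  exists t, [/\ double_dom c t, double_coord c t = double_retraction xvw &
    ccoord c (foot t) = retraction c (sc_emb (xvw.1.1 : ambient c 1%N))].
Proof.
case: xvw => [[x v] w] ac; rewrite /double_odom /=; move: (x : ambient c 1%N) => {}x ox.
have [p cp e] := odom_point ox.
have hp : in_level 1 p.
  exists c; split => //; rewrite e.
  exact: sc0_level (retraction_smooth c 0) ox (level_emb x).
have DT u : rtangent c (coord1 c p) (sc_D (odom c) (retraction c) x u).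
  rewrite (rtangentP hp) // -!tdiff_self //.
  by rewrite [RHS](congr1 (fun f => f u) (tdiff_comp ac ac ac ox cp cp cp e)).
have [v' ev] := tangent_coord_surj hp ac cp (DT v).
have [w' ew] := tangent_coord_surj hp ac cp (DT w).
exists (DoubleTangent hp v' w'); split => //.
by rewrite /double_coord /= ev ew /coord1 e.
Qed.

Definition in_double c g (xvw : double_model c 0%N) : R :=
  read_through (@double_dom _ _ c) (@double_coord _ _ c) g (double_retraction xvw).

Arguments in_double c g xvw : clear implicits.

Lemma in_doubleE c g xvw t : atlas c -> double_dom c t ->
  double_coord c t = double_retraction xvw -> in_double c g xvw = g t.
Proof.
move=> ac ct e; rewrite /in_double -e read_throughE // => s cs es.
by rewrite (double_coord_inj ac cs ct es).
Qed.

Lemma sc_domain_double c : sc_domain (@double_odom _ _ c).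
Proof.
have := sc_domain_prod (sc_domain_tangent (sc_domain_odom c)) (sc_domainT (ambient c)).
by congr sc_domain; apply/seteqP; split => x /=; rewrite /double_odom /=; tauto.
Qed.

Lemma double_cst (a : R) : double_smooth (fun _ : double_tangent X => a).
Proof.
move=> c ac k; apply: eq_sck (sck_cst_real k a (sc_domain_double c)) => z oz.
by have [t [ct e _]] := double_point ac oz;
  rewrite -[RHS]/(in_double c _ z) (in_doubleE _ ac ct e).
Qed.

Lemma double_add g h : double_smooth g -> double_smooth h ->
  double_smooth (fun t => g t + h t).
Proof.
move=> sg sh c ac k; have dU := sc_domain_double c.
apply: eq_sck (sck_add_real dU (sg c ac k) (sh c ac k)) => z oz.
have [t [ct e _]] := double_point ac oz.
rewrite -[RHS]/(in_double c _ z) (in_doubleE _ ac ct e); congr (_ + _).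
  exact: (in_doubleE g ac ct e).
exact: (in_doubleE h ac ct e).
Qed.

Lemma double_sum (I : Type) (s : seq I) (g : I -> double_tangent X -> R) :
  (forall i, double_smooth (g i)) -> double_smooth (fun t => \sum_(i <- s) g i t).
Proof.
move=> sg; elim: s => [|i s IH].
  by under [X in double_smooth X]funext do rewrite big_nil; exact: double_cst.
under [X in double_smooth X]funext do rewrite big_cons.
exact: double_add.
Qed.

Lemma double_nbhs_open c (N : set (ambient c 0%N)) : open N ->
  open [set xvw : double_model c 0%N | N (sc_emb (xvw.1.1 : ambient c 1%N))].
Proof.
move=> oN; apply: (@open_comp _ _ (fun xvw : ambient c 1%N * ambient c 0%N *
  ambient c 0%N => sc_emb xvw.1.1)) => // z _.
apply: (@continuous_comp _ _ _ (fst \o fst) (@sc_emb R (ambient c) 1)).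
  by apply: continuous_comp; exact: cvg_fst.
exact: emb_continuous.
Qed.

Lemma double_local g :
  (forall c x, atlas c -> odom c x -> exists2 h, double_smooth h &
     chart_near c x (fun p => forall t, foot t = p -> g t = h t)) ->
  double_smooth g.
Proof.
move=> H c ac k; apply: sck_local; first exact: sc_domain_double.
move=> z oz; have [h sh [N [oN Nx gh]]] := H c _ ac oz.
exists [set xvw : double_model c 0%N | N (sc_emb (xvw.1.1 : ambient c 1%N))].
split => //; first exact: double_nbhs_open.
have dN := sc_domainI (sc_domain_double c) (double_nbhs_open oN).
have shN := sck_sub (V' := setT) dN (@subIsetl _ _ _) (fun _ _ => I) (sh c ac k).
apply: eq_sck shN => y [oy Ny]; have [t [ct e ef]] := double_point ac oy.
rewrite -[RHS]/(in_double c g y) (in_doubleE g ac ct e).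
transitivity (h t); first exact: (in_doubleE h ac ct e).
by rewrite (gh _ (foot t) oy Ny ct ef).
Qed.

Definition chart_metric c (ip : ambient c 0%N -> ambient c 0%N -> R) t : R :=
  ip (tangent_coord c (vec1 t)) (tangent_coord c (vec2 t)).

(** Where [c0] is available the function reads [f(r x) * ip (D tmap(x) v) (D tmap(x) w)]; elsewhere
    it vanishes locally. *)
Lemma chart_metric_smooth (f : X -> R) c0 (ip : _ -> _ -> R) : atlas c0 ->
  (forall k x y z, ip (k *: x + y) z = k * ip x z + ip y z) ->
  (forall x y, ip x y = ip y x) -> (forall x, ip x x = `|x| ^+ 2) ->
  smooth_fun f -> (forall p, 0 <= f p) ->
  closure ([set p | 0 < f p] : set (chart_space (@atlas R X))) `<=` cdom c0 ->
  double_smooth (fun t => f (foot t) * @chart_metric c0 ip t).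
Proof.
move=> ac0 l s n sf f0 clf c ac k.
apply: sck_local; first exact: sc_domain_double.
move=> [[x0 v0] w0]; rewrite {1}/double_odom /=.
move: (x0 : ambient c 1%N) => {}x0 ox0.
have [p cp e] := odom_point ox0.
have [cp0|ncp0] := pselect (cdom c0 p); last first.
  have nW : nbhs (p : chart_space (@atlas R X))
      (~` closure ([set p | 0 < f p] : set (chart_space (@atlas R X)))).
    apply: open_nbhs_nbhs; split; first exact/closed_openC/closed_closure.
    by move=> /clf.
  have [N [oN Nx HN]] := chart_near_nbhs ac ox0 cp e nW.
  exists [set xvw : double_model c 0%N | N (sc_emb (xvw.1.1 : ambient c 1%N))].
  split => //; first exact: double_nbhs_open.
  have dN := sc_domainI (sc_domain_double c) (double_nbhs_open oN).
  apply: eq_sck (sck_cst_real k 0 dN) => y [oy Ny].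
  have [t [ct et ef]] := double_point ac oy.
  rewrite -[RHS]/(in_double c _ y) (in_doubleE _ ac ct et).
  suff -> : f (foot t) = 0 by rewrite mul0r.
  apply/eqP; rewrite eq_le f0 andbT leNgt; apply/negP => ft.
  by apply: (HN _ (foot t) oy Ny ct ef); exact: subset_closure.
have [N oN NE] := overlap_dom_open ac ac0.
have o0 : overlap_dom c c0 (sc_emb x0) by apply/overlap_domP; split => //; exists p.
exists [set xvw : double_model c 0%N | N (sc_emb (xvw.1.1 : ambient c 1%N))].
split; [exact: double_nbhs_open|by move: o0; rewrite NE => -[]|].
pose U : set (double_model c 0%N) := @double_odom _ _ c `&`
  [set xvw : double_model c 0%N | N (sc_emb (xvw.1.1 : ambient c 1%N))].
have dU : sc_domain U := sc_domainI (sc_domain_double c) (double_nbhs_open oN).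
have dO := sc_domain_overlap ac ac0.
have U2 z : U z -> overlap_dom c c0 (sc_emb (z.1.1 : ambient c 1%N)).
  by move=> [oz Nz]; rewrite NE.
pose E := ambient c; pose M := @double_model R X c.
have oT : sc_operator (E := M) (F := sc_tangent E) fst by exact: operator_fst.
have oV := operator_comp oT (operator_fst (sc_shift E) E).
have oX := operator_comp oV (operator_incl E).
have oW : sc_operator (E := M) (F := E) snd by exact: operator_snd.
have oXW := operator_pair oV oW.
have sU (A : M 0%N -> E 0%N) (V : set (E 0%N)) : sc_operator A ->
    (forall z, U z -> V (A z)) -> sck k U V A.
  by move=> oA UV; apply: sck_sub dU _ UV (sck_operator k oA).
have sUT (A : M 0%N -> sc_tangent E 0%N) (V : set (sc_tangent E 0%N)) :
    sc_operator A -> (forall z, U z -> V (A z)) -> sck k U V A.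
  by move=> oA UV; apply: sck_sub dU _ UV (sck_operator k oA).
have sfx := sck_comp dU (sc_domain_odom c) (sU _ (odom c) oX _) (sf c ac k).
have {}sfx := sfx (fun z Uz => Uz.1).
(* One degree is spent: the differential is the second component of [T(tmap c c0)]. *)
have /sckS [_ sT] := tmap_smooth k.+1 ac ac0.
have sT' := sck_subT (V' := setT) sT (sc_domain_tangent dO) (fun _ _ => I).
have oS := operator_snd (sc_shift (ambient c0)) (ambient c0).
have sS := sck_operator k oS.
have sDT := sck_comp (sc_domain_tangent dO) (sc_domainT _) sT' sS.
have s1 := sck_comp dU (sc_domain_tangent dO)
  (sUT _ (tangent_set (overlap_dom c c0)) oT U2) sDT.
have s2 := sck_comp dU (sc_domain_tangent dO)
  (sUT _ (tangent_set (overlap_dom c c0)) oXW U2) sDT.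
have s3 := sck_mul dU sfx (sck_bilinear2 (sc_bilinear_ip l s n) dU s1 s2).
apply: eq_sck s3 => -[[x v] w] Uz; have [oz _] := Uz.
have [t [ct et ef]] := double_point ac oz.
rewrite -[RHS]/(in_double c _ (x, v, w)) (in_doubleE _ ac ct et) /=.
rewrite (in_chartE f ct ef); congr (_ * _).
have /overlap_domP [oe [q [cq cq0 eq]]] := U2 _ Uz.
have ft : q = foot t by apply: (ccoord_inj cq ct); rewrite eq.
rewrite ft in cq0 eq; move: et; rewrite /double_coord /= => -[_ ev ew].
have hp := foot_level t.
rewrite /chart_metric !(tangent_coord_change hp _ ac ac0 ct cq0) ev ew.
rewrite -!(tdiff_self oe) /tlin.
(* In [c] the vectors have coordinates [Dr(x) v] and [Dr(x) w] at [r x]; the cocycle absorbs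
   [Dr(x)]. *)
have TC u := congr1 (fun f => f u) (tdiff_comp ac ac ac0 oe ct ct cq0 eq).
by congr ip; rewrite -[RHS](TC _).
Qed.

End double_tangent_functions.

Arguments in_double {R X} c g xvw.
Arguments chart_metric {R X} c ip t.

(** * Coercive forms *)

Section riesz.
Context {R : realType}.
Variable V : completeNormedModType R.

Definition bounded_form (G : V -> V -> R) :=
  [/\ forall k x y z, G (k *: x + y) z = k * G x z + G y z,
      forall x y, G x y = G y x &
      exists2 M : R, 0 < M & forall x y, `|G x y| <= M * (`|x| * `|y|)].

Lemma bounded_form0 : bounded_form (fun _ _ => 0).
Proof.
split=> // [k x y z|]; first by rewrite mulr0 addr0.
by exists 1 => // x y; rewrite normr0 mul1r mulr_ge0.
Qed.

Lemma bounded_formD G H : bounded_form G -> bounded_form H ->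
  bounded_form (fun x y => G x y + H x y).
Proof.
move=> [lG sG [M M0 HM]] [lH sH [N N0 HN]]; split.
- by move=> k x y z; rewrite lG lH; ring.
- by move=> x y; rewrite sG sH.
- exists (M + N); first exact: addr_gt0.
  move=> x y; apply: le_trans (ler_normD _ _) _.
  by rewrite mulrDl lerD.
Qed.

Lemma bounded_form_sum (I : eqType) (s : seq I) (G : I -> V -> V -> R) :
  (forall i, i \in s -> bounded_form (G i)) ->
  bounded_form (fun x y => \sum_(i <- s) G i x y).
Proof.
elim: s => [|i s IH] H.
  have -> : (fun x y => \sum_(i <- [::]) G i x y) = fun _ _ => 0.
    by apply/funext => x; apply/funext => y; rewrite big_nil.
  exact: bounded_form0.
have -> : (fun x y => \sum_(j <- i :: s) G j x y) =
    fun x y => G i x y + \sum_(j <- s) G j x y.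
  by apply/funext => x; apply/funext => y; rewrite big_cons.
apply: bounded_formD; first by apply: H; exact: mem_head.
by apply: IH => j js; apply: H; rewrite inE js orbT.
Qed.

Section form_theory.
Variables (S : set V) (P : V -> V) (G : V -> V -> R) (m : R).
Hypotheses (lP : linear P) (cP : continuous P) (SP : forall v, S v <-> P v = v)
  (PS : forall v, S (P v))
  (bG : bounded_form G) (m0 : 0 < m)
  (coer : forall v, S v -> m * `|v| ^+ 2 <= G v v).

Let lG k x y z : G (k *: x + y) z = k * G x z + G y z.
Proof. by have [+ _ _] := bG; apply. Qed.

Let sG x y : G x y = G y x.
Proof. by have [_ + _] := bG; apply. Qed.

Let linG z : linear (fun x => G x z : R^o).
Proof. by move=> k x y; rewrite lG. Qed.

Lemma formD x y z : G (x + y) z = G x z + G y z.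
Proof. exact: linD (linG z) x y. Qed.

Lemma formB x y z : G (x - y) z = G x z - G y z.
Proof. exact: linB (linG z) x y. Qed.

Lemma formZ k x z : G (k *: x) z = k * G x z.
Proof. exact: linZ (linG z) k x. Qed.

Lemma subspaceD k x y : S x -> S y -> S (k *: x + y).
Proof. by move=> /SP Sx /SP Sy; apply/SP; rewrite lP Sx Sy. Qed.

Lemma subspaceZ k x : S x -> S (k *: x).
Proof. by move=> /SP Sx; apply/SP; rewrite (linZ lP) Sx. Qed.

Lemma subspace0 : S 0.
Proof. by apply/SP; rewrite (lin0 lP). Qed.

Lemma subspaceB x y : S x -> S y -> S (x - y).
Proof. by move=> /SP Sx /SP Sy; apply/SP; rewrite (linB lP) Sx Sy. Qed.

Lemma subspace_limit v :
  (forall e : R, 0 < e -> exists2 y, S y & `|v - y| < e) -> S v.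
Proof.
move=> H; apply/SP; have [M M0 HM] := linear_bound lP cP.
apply/eqP; rewrite -subr_eq0 -normr_le0; apply/ler_addgt0Pr => e e0.
rewrite add0r; have [|y /SP Sy vy] := H (e / (M + 1)).
  by rewrite divr_gt0 // addr_gt0.
have -> : P v - v = P (v - y) - (v - y).
  by rewrite (linB lP) Sy opprB addrA subrK.
apply: le_trans (ler_normB _ _) _.
apply: le_trans (_ : (M + 1) * `|v - y| <= _).
  by rewrite mulrDl mul1r lerD2r.
by rewrite mulrC -ler_pdivlMr ?addr_gt0 // ltW.
Qed.

(** Minimization of [G v v - 2 l v] over [S]. *)
Lemma riesz_representation (l : V -> R) (L : R) :
  (forall k x y, l (k *: x + y) = k * l x + l y) -> 0 < L ->
  (forall x, S x -> `|l x| <= L * `|x|) ->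
  exists2 v, S v & forall w, S w -> G v w = l w.
Proof.
move=> ll L0 lL.
have lin_l : linear (l : V -> R^o) by [].
pose J v := G v v - 2 * l v.
pose A := J @` S.
(* Completing the square: [J v >= m |v|^2 - 2 L |v| >= - L^2 / m]. *)
have Alb : lbound A (- (L ^+ 2 / m)).
  move=> _ [v Sv <-]; rewrite /J.
  have h1 := coer Sv; have h2 := lL _ Sv; have h3 := ler_norm (l v).
  have h4 : 0 <= (m * `|v| - L) ^+ 2 / m by rewrite divr_ge0 ?sqr_ge0 // ltW.
  have h5 : (m * `|v| - L) ^+ 2 / m = m * `|v| ^+ 2 - 2 * L * `|v| + L ^+ 2 / m.
    by field; rewrite gt_eqF.
  lra.
have Ainf : has_inf A.
  by split; [exists (J 0), 0; [exact: subspace0|]|exists (- (L ^+ 2 / m))].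
pose j := inf A.
have jJ v : S v -> j <= J v.
  by move=> Sv; apply: ge_inf; [case: Ainf|exists v].
have approx e : 0 < e -> exists2 v, S v & J v < j + e.
  by move=> e0; have [_ [v Sv <-] vj] := inf_adherent e0 Ainf; exists v.
(* Parallelogram law for [G], with [J] at least [j] at the midpoint of [u] and [v]. *)
have para u v (e : R) : S u -> S v -> J u < j + e -> J v < j + e ->
    m * `|u - v| ^+ 2 <= 4 * e.
  move=> Su Sv Ju Jv; have Suv := subspaceZ 2^-1 (subspaceD 1 Su Sv).
  have h1 := jJ _ Suv; have h2 := coer (subspaceB Su Sv).
  have h3 : G (u - v) (u - v) = 2 * J u + 2 * J v - 4 * J (2^-1 *: (1 *: u + v)).
    rewrite /J scale1r (linZ lin_l) (linD lin_l) /= formB formZ.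
    rewrite (sG u (u - v)) (sG v (u - v)) !formB.
    rewrite (sG (u + v) (_ *: _)) !formZ formD (sG u (u + v)) (sG v (u + v)).
    by rewrite !formD (sG v u) -[_ *: (l u + l v)]/(_ * (l u + l v)); field.
  lra.
(* The sets of near-minimizers generate a filter that [para] makes Cauchy; its limit is the
   representing vector. *)
pose F := filter_from [set e : R | 0 < e] (fun e => [set v | S v /\ J v < j + e]).
have FF : ProperFilter F.
  apply: filter_from_proper; last by move=> e /= /approx [v Sv Jv]; exists v.
  apply: filter_from_filter; first by exists 1 => /=.
  move=> e1 e2 /= e10 e20; exists (Num.min e1 e2); first by rewrite /= lt_min e10.
  move=> v [Sv Jv]; split; split => //; apply: lt_le_trans Jv _;
    by rewrite lerD2l ge_min lexx ?orbT.
have Fc : cauchy F.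
  apply: cauchy_exP => e e0.
  have e'0 : 0 < m * e ^+ 2 / 8 by rewrite divr_gt0 // mulr_gt0 // exprn_gt0.
  have [u Su Ju] := approx _ e'0; exists u; exists (m * e ^+ 2 / 8) => //.
  move=> v [Sv Jv]; rewrite -ball_normE /ball_ /=.
  have := para _ _ _ Su Sv Ju Jv.
  have -> : 4 * (m * e ^+ 2 / 8) = m * (e ^+ 2 / 2) by field.
  rewrite ler_pM2l // => h; rewrite -(ltr_pXn2r (n := 2)) ?nnegrE ?(ltW e0) //.
  apply: le_lt_trans h _; have := exprn_gt0 2 e0; lra.
have Fcv : cvg F by exact: cauchy_cvg.
pose v : V := lim F; have Fv : F --> v by [].
have near_v (e : R) : 0 < e -> exists y, [/\ S y, J y < j + e & `|v - y| < e].
  move=> e0; have F1 : F [set y | `|v - y| < e].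
    by apply: Fv; apply/nbhs_normP; exists e.
  have F2 : F [set v | S v /\ J v < j + e] by exists e.
  by have [y [vy [Sy Jy]]] := filter_ex (filterI F1 F2); exists y.
have Sv : S v.
  by apply: subspace_limit => e /near_v [y [Sy _ vy]]; exists y.
exists v => // w Sw.
have [_ _ [M M0 HM]] := bG.
(* Near-minimality replaces minimality: moving [y] by [t w] lowers [J] by at least
   [b^2 / (G w w + 1)], which cannot exceed [e]. The [+ 1] covers [w = 0]. *)
have small y (e : R) : 0 < e -> S y -> J y < j + e ->
    (G y w - l w) ^+ 2 <= e * (G w w + 1).
  move=> e0 Sy Jy; pose b := G y w - l w.
  have g0 : 0 <= G w w.
    by apply: le_trans (coer Sw); rewrite mulr_ge0 ?exprn_ge0 // ltW.
  pose t := - b / (G w w + 1).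
  have gp : 0 < G w w + 1 by rewrite ltr_wpDl.
  have h1 := jJ _ (subspaceD t Sw Sy).
  have h2 : J (t *: w + y) = J y + 2 * t * b + t ^+ 2 * G w w.
    rewrite /J ll lG (sG w (_ + _)) (sG y (_ + _)) !lG (sG w y) /b; ring.
  have h3 : 2 * t * b + t ^+ 2 * G w w =
      - (b ^+ 2 / (G w w + 1)) - b ^+ 2 / (G w w + 1) ^+ 2.
    by rewrite /t; field; rewrite gt_eqF.
  have h4 : 0 <= b ^+ 2 / (G w w + 1) ^+ 2 by rewrite divr_ge0 ?sqr_ge0.
  have h5 : b ^+ 2 / (G w w + 1) <= e by lra.
  by rewrite -ler_pdivrMr.
apply/eqP; rewrite -subr_eq0 -sqrf_eq0 eq_le sqr_ge0 andbT leNgt; apply/negP.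
set B := (_ ^+ 2) => B0.
have g0 : 0 <= G w w.
  by apply: le_trans (coer Sw); rewrite mulr_ge0 ?exprn_ge0 // ltW.
(* Chosen so that a near-minimizer within [e] of [v] gives [B <= e * C <= B / 2], against
   [B > 0]. *)
pose C := 2 * (M * `|w|) ^+ 2 + 2 * (G w w + 1).
have C0 : 0 < C by have := sqr_ge0 (M * `|w|); rewrite /C; lra.
pose e := Num.min 1 (B / 2 / C).
have e0 : 0 < e by rewrite lt_min ltr01 !divr_gt0.
have e1 : e <= 1 by rewrite ge_min lexx.
have eB : e <= B / 2 / C by rewrite ge_min lexx orbT.
have [y [Sy Jy vy]] := near_v _ e0.
have h1 := small _ _ e0 Sy Jy.
have h2 : G (v - y) w ^+ 2 <= e * (M * `|w|) ^+ 2.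
  rewrite -real_normK ?num_real //.
  have h : `|G (v - y) w| <= e * (M * `|w|).
    apply: le_trans (HM _ _) _; rewrite mulrCA ler_wpM2r //; last exact: ltW.
    by rewrite mulr_ge0 // ltW.
  apply: le_trans (_ : (e * (M * `|w|)) ^+ 2 <= _).
    by rewrite ler_pXn2r ?nnegrE // mulr_ge0 ?mulr_ge0 // ltW.
  rewrite exprMn ler_wpM2r ?sqr_ge0 // expr2 ler_piMl //; exact: ltW.
have h3 : B <= 2 * G (v - y) w ^+ 2 + 2 * (G y w - l w) ^+ 2.
  have -> : B = (G (v - y) w + (G y w - l w)) ^+ 2 by rewrite /B formB addrA subrK.
  have := sqr_ge0 (G (v - y) w - (G y w - l w)).
  rewrite sqrrB sqrrD; lra.
have h4 : e * C <= B / 2 by rewrite -ler_pdivlMr.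
have h5 : e * C = 2 * (e * (M * `|w|) ^+ 2) + 2 * (e * (G w w + 1)).
  by rewrite /C; ring.
lra.
Qed.

Lemma dual_norm_le (f : V -> R) (N : R) :
  (forall w, S w -> `|w| <= 1 -> `|f w| <= N) -> dual_norm S f <= N.
Proof.
move=> fN; apply: ge_sup; last by move=> _ [w [Sw w1] <-]; exact: fN.
by exists `|f 0|, 0 => //; split; [exact: subspace0|rewrite /= normr0].
Qed.

(** Test [f] on [u / |u|] and use coercivity. This yields continuity of the inverse of
    [v |-> G(v, .)]. *)
Lemma dual_norm_form (u : V) (f : V -> R) : S u ->
  (forall w, S w -> f w = G u w) -> m * `|u| <= dual_norm S f.
Proof.
move=> Su fG; have [_ _ [M M0 HM]] := bG.
have ub w : S w -> `|w| <= 1 -> `|f w| <= M * `|u|.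
  move=> Sw w1; rewrite fG //; apply: le_trans (HM _ _) _.
  by rewrite ler_pM2l // ler_piMr.
have f_le w : S w -> `|w| <= 1 -> `|f w| <= dual_norm S f.
  move=> Sw w1; apply: ub_le_sup; last by exists w.
  by exists (M * `|u|) => _ [z [Sz z1] <-]; exact: ub.
have [->|u0] := eqVneq u 0.
  rewrite normr0 mulr0; apply: le_trans (f_le 0 subspace0 _) => //.
  by rewrite normr0.
have up : 0 < `|u| by rewrite normr_gt0.
have Sw := subspaceZ `|u|^-1 Su.
have := f_le _ Sw; rewrite normrZ ger0_norm ?invr_ge0 // mulVf ?gt_eqF //.
move=> /(_ (lexx _)); apply: le_trans; rewrite fG // sG formZ normrM.
rewrite normfV normr_id [leRHS]mulrC ler_pdivlMr // -mulrA -expr2.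
by apply: le_trans (coer Su) _; exact: ler_norm.
Qed.

Lemma form_dual_iso (H : V * V -> R) :
  (forall v w, S v -> S w -> H (v, w) = G v w) -> dual_iso S H.
Proof.
move=> HG; have [_ _ [M M0 HM]] := bG.
have HB v v' w : S v -> S v' -> S w -> H (v', w) - H (v, w) = G (v' - v) w.
  by move=> Sv Sv' Sw; rewrite !HG // formB.
split.
- move=> v Sv; split.
    move=> k x y Sx Sy; rewrite !HG //; last exact: subspaceD.
    by rewrite !(sG v) lG.
  apply/(@withinP R V R^o) => x Sx e e0.
  have d0 : 0 < M * `|v| + 1 by rewrite ltr_wpDl // mulr_ge0 // ltW.
  exists (e / (M * `|v| + 1)); first by rewrite divr_gt0.
  move=> y Sy; rewrite ltr_pdivlMr // => yx.
  rewrite !HG // !(sG v) -formB sG; apply: le_lt_trans (HM _ _) _.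
  apply: le_lt_trans yx; rewrite mulrA mulrC ler_wpM2l //.
  by rewrite lerDl.
- move=> v v' Sv Sv' e; have Su := subspaceB Sv Sv'.
  have := coer Su; rewrite formB -!HG // e // subrr => h.
  apply/eqP; rewrite -subr_eq0 -normr_eq0 -sqrf_eq0 eq_le sqr_ge0 andbT.
  by rewrite -(pmulr_rle0 _ m0).
- move=> l [ll cl].
  have /(@withinP R V R^o) cl' := cl.
  have [d d0 Hd] := cl' 0 subspace0 1 ltr01.
  have l0 : l 0 = 0.
    by have := ll 1 0 0 subspace0 subspace0; rewrite scale1r addr0 => h; lra.
  have lZ k x : S x -> l (k *: x) = k * l x.
    by move=> Sx; have := ll k x 0 Sx subspace0; rewrite l0 !addr0.
  (* [l] is linear on [S] only; composing with the projection makes it linear on all of [V] with the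
     same values on [S]. *)
  have lP1 k x y : l (P (k *: x + y)) = k * l (P x) + l (P y).
    by rewrite lP ll.
  have [||v Sv Gv] := @riesz_representation (l \o P) (2 / d) lP1.
  - by rewrite divr_gt0.
  - move=> x Sx /=; have /SP -> := Sx.
    have [->|x0] := eqVneq x 0; first by rewrite l0 !normr0 mulr0.
    have xp : 0 < `|x| by rewrite normr_gt0.
    have nx : `|d / 2 / `|x| *: x - 0| < d.
      rewrite subr0 normrZ gtr0_norm ?divr_gt0 // divfK ?gt_eqF //.
      by rewrite ltr_pdivrMr // ltr_pMr // ltr1n.
    have := Hd _ (subspaceZ _ Sx) nx.
    rewrite l0 subr0 lZ // normrM gtr0_norm ?divr_gt0 // => h.
    have {}h : `|l x| < (d / 2 / `|x|)^-1 by rewrite -[ltRHS]mulr1 ltr_pdivlMl ?divr_gt0.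
    apply: le_trans (ltW h) _.
    by rewrite (_ : _^-1 = 2 / d * `|x|) //; field; rewrite !gt_eqF.
  by exists v => // w Sw; rewrite HG // Gv //=; have /SP -> := Sw.
- move=> v Sv e e0; exists (e / M / 2); first by rewrite !divr_gt0.
  move=> v' Sv' vv; apply: le_lt_trans (_ : M * `|v' - v| < e).
    apply: dual_norm_le => w Sw w1; rewrite HB //.
    by apply: le_trans (HM _ _) _; rewrite ler_pM2l // ler_piMr.
  rewrite mulrC -ltr_pdivlMr //; apply: lt_trans vv _.
  by rewrite ltr_pdivrMr // ltr_pMr ?divr_gt0 // ltr1n.
- move=> v Sv e e0; exists (m * e); first exact: mulr_gt0.
  move=> v' Sv' h; rewrite -(ltr_pM2l m0); apply: le_lt_trans h.
  by apply: dual_norm_form; [exact: subspaceB|move=> w Sw; exact: HB].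
Qed.

Lemma form_continuous (H : V * V -> R) :
  (forall v w, S v -> S w -> H (v, w) = G v w) -> {within S `*` S, continuous H}.
Proof.
move=> HG; have [_ _ [M M0 HM]] := bG.
apply/(@withinP R (V * V)%type R^o) => -[x y] [/= Sx Sy] e e0.
have C0 : 0 < `|x| + `|y| + 1 by rewrite ltr_wpDl // addr_ge0.
exists (Num.min 1 (e / M / (`|x| + `|y| + 1))); first by rewrite lt_min ltr01 !divr_gt0.
move=> -[x' y'] [/= Sx' Sy']; rewrite prod_normE gt_max !lt_min /=.
move=> /andP[/andP[x1 xe] /andP[y1 ye]]; rewrite !HG //.
have -> : G x' y' - G x y = G (x' - x) y' + G x (y' - y).
  by rewrite formB (sG x (y' - y)) formB !(sG _ x) addrA subrK.
have y'b : `|y'| <= `|y| + 1.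
  have -> : y' = y + (y' - y) by rewrite subrKC.
  by apply: le_trans (ler_normD _ _) _; rewrite lerD2l ltW.
apply: le_lt_trans (ler_normD _ _) _.
set d := e / M / _ in xe ye.
have d0 : 0 <= d by rewrite !divr_ge0 // ltW.
have h1 : `|G (x' - x) y'| <= M * (`|x' - x| * (`|y| + 1)).
  by apply: le_trans (HM _ _) _; rewrite ler_pM2l // ler_wpM2l.
have h2 := HM x (y' - y).
have h3 : `|x' - x| * (`|y| + 1) < d * (`|y| + 1).
  by rewrite ltr_pM2r // ltr_wpDl.
have h4 : `|x| * `|y' - y| <= `|x| * d by rewrite ler_wpM2l // ltW.
have h5 : M * (d * (`|y| + 1)) + M * (`|x| * d) = e.
  by rewrite /d; field; rewrite !gt_eqF.
have h6 : M * (`|x' - x| * (`|y| + 1)) < M * (d * (`|y| + 1)) by rewrite ltr_pM2l.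
have h7 : M * (`|x| * `|y' - y|) <= M * (`|x| * d) by rewrite ler_pM2l.
lra.
Qed.

End form_theory.
End riesz.

(** * The metric *)

Section metric.
Context {R : realType}.
Variable X : Mpolyfold R.

Definition inner_product (V : completeNormedModType R) (ip : V -> V -> R) :=
  [/\ forall k x y z, ip (k *: x + y) z = k * ip x z + ip y z,
      forall x y, ip x y = ip y x & forall x, ip x x = `|x| ^+ 2].

Lemma bounded_form_ip (E : scBanach R) (V : completeNormedModType R)
    (ip : E 0%N -> E 0%N -> R) (A : V -> E 0%N) (a : R) :
  inner_product ip -> linear A -> continuous A -> 0 <= a ->
  bounded_form (fun v w => a * ip (A v) (A w)).
Proof.
move=> [l s n] lA cA a0; split.
- by move=> k x y z; rewrite lA l; ring.
- by move=> x y; rewrite s.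
have [M M0 HM] := sc_bilinear_bound (sc_bilinear_ip l s n).
have [N N0 HN] := linear_bound lA cA.
(* [a + 1] because the bound must be positive while [a] may be 0. *)
exists ((a + 1) * (M * (N * N))); first by rewrite !mulr_gt0 // ltr_wpDl.
move=> x y; rewrite normrM ger0_norm // -mulrA; apply: ler_pM => //.
  by rewrite lerDl.
apply: le_trans (HM _ _) _; rewrite -mulrA ler_pM2l // mulrACA.
by apply: ler_pM.
Qed.

Section construction.
Variables (I : choiceType) (ch : I -> chart R X) (a : I -> X -> R).
Variable (ip : forall i, ambient (ch i) 0%N -> ambient (ch i) 0%N -> R).
Hypotheses (ac : forall i, atlas (ch i)) (ipP : forall i, inner_product (@ip i))
  (acl : forall i, closure ([set p | 0 < a i p] : set (chart_space (@atlas R X)))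
     `<=` cdom (ch i))
  (a_smooth : forall i, smooth_fun (a i)) (a0 : forall i p, 0 <= a i p)
  (a_lf : locally_finite_family a) (a_cover : forall p, exists i, 0 < a i p).

Definition sum_metric (t : double_tangent X) : R :=
  \sum_(i \in [set: I]) a i (foot t) * chart_metric (ch i) (@ip i) t.

Lemma sum_metric_smooth : double_smooth sum_metric.
Proof.
apply: double_local => c x acc ox; have [s Hs] := a_lf acc ox.
exists (fun t => \sum_(i <- undup s) a i (foot t) * chart_metric (ch i) (@ip i) t).
  apply: double_sum => i; have [l sy n] := ipP i.
  exact: (chart_metric_smooth (ac i) l sy n (a_smooth i) (a0 i) (acl (i := i))).
apply: chart_near_imp Hs => p Hp t tp; apply: fsum_seq => i is_.
by rewrite tp Hp // mul0r.
Qed.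

(** Coercivity comes from one index [i0] with [a i0 p > 0]: [v] is the image of [A i0 v] under the
    transition differential back to [c], which is bounded by [K], whence the constant
    [a i0 p / K^2]. *)
Lemma sum_metric_fiber p (hp : in_level 1 p) (c : chart R X) :
  atlas c -> cdom c p ->
  let S := rtangent c (coord1 c p) in
  exists (G : ambient c 0%N -> ambient c 0%N -> R) (m : R),
  [/\ bounded_form G, 0 < m, forall v, S v -> m * `|v| ^+ 2 <= G v v &
      forall v w, S v -> S w -> fiber_form sum_metric hp (c := c) (v, w) = G v w].
Proof.
move=> acc cp S.
have [s Hs] := locally_finite_at p a_lf.
(* For indices of positive weight [p] lies in the domain of [ch i], so that [A i] is a genuine
   differential. *)
pose s' := [seq i <- undup s | 0 < a i p].
have s'P i : i \in s' -> cdom (ch i) p.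
  rewrite mem_filter => /andP[ai _]; apply: acl; exact: subset_closure.
pose A i := tlin p c (ch i).
have AP i : cdom (ch i) p -> linear (A i) /\ continuous (A i).
  move=> ci; have [lA cA _] := tlin_derivative hp acc (ac i) cp ci.
  by split.
pose T i v w := a i p * @ip i (A i v) (A i w).
have [i0 ai0] := a_cover p.
have i0s : i0 \in s'.
  rewrite mem_filter ai0 mem_undup /=; apply: contraT => /Hs h.
  by rewrite h ltxx in ai0.
have ci0 := s'P _ i0s.
have [lB cB _] := tlin_derivative hp (ac i0) acc ci0 cp.
have [K K0 HK] := linear_bound lB cB.
exists (fun v w => \sum_(i <- s') T i v w), (a i0 p / K ^+ 2); split.
- apply: bounded_form_sum => i is'; have [lA cA] := AP _ (s'P _ is').
  exact: bounded_form_ip.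
- by rewrite divr_gt0 // exprn_gt0.
- move=> v Sv; rewrite (bigD1_seq i0) ?filter_uniq ?undup_uniq //=.
  apply: le_trans (_ : T i0 v v <= _); last first.
    rewrite lerDl sumr_ge0 // => i _; have [_ _ n] := ipP i.
    by rewrite /T n mulr_ge0 // exprn_ge0.
  have [_ _ n] := ipP i0; rewrite /T n -mulrA ler_pM2l //.
  rewrite ler_pdivrMl ?exprn_gt0 // -exprMn.
  have Av : v = tlin p (ch i0) c (A i0 v).
    by rewrite -(tlin_comp hp _ acc (ac i0) acc cp ci0 cp) (tlin_id hp).
  rewrite ler_pXn2r ?nnegrE ?mulr_ge0 ?(ltW K0) // {1}Av; exact: HK.
move=> v w Sv Sw.
have [v' v'E] := tangent_coord_surj hp acc cp Sv.
have [w' w'E] := tangent_coord_surj hp acc cp Sw.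
have -> : fiber_form sum_metric hp (c := c) (v, w) =
    sum_metric (DoubleTangent hp v' w').
  rewrite /fiber_form -v'E -w'E.
  rewrite (read_throughE (y := (v', w'))) //= => -[v1 w1] _ /= [e1 e2].
  by rewrite (tangent_coord_inj hp acc cp e1) (tangent_coord_inj hp acc cp e2).
rewrite /sum_metric (fsum_seq (r := s)); last by move=> i /Hs /= ->; rewrite mul0r.
rewrite /s' big_filter [RHS]big_mkcond /=; apply: eq_bigr => i _.
case: ifPn => [ai|]; last first.
  by rewrite -leNgt => ai; rewrite (_ : a i p = 0) ?mul0r //;
    apply/eqP; rewrite eq_le ai a0.
have ci : cdom (ch i) p by apply: acl; exact: subset_closure.
rewrite /T /chart_metric /=.
by rewrite !(tangent_coord_change hp _ acc (ac i) cp ci) v'E w'E.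
Qed.

Lemma sum_metric_strong : strong_Riemannian_metric sum_metric.
Proof.
split; first exact: sum_metric_smooth.
move=> p hp c acc cp S G.
have [G0 [m [bG m0 coer GE']]] := sum_metric_fiber hp acc cp.
have {GE'}GE v w : S v -> S w -> G (v, w) = G0 v w by exact: GE'.
have [lP cP _] := tlin_derivative hp acc acc cp cp.
have SP v : S v <-> tlin p c c v = v by exact: rtangentP.
have PS v : S (tlin p c c v) by exact: tlin_rtangent.
have [lG sG _] := bG.
have SD k x y : S x -> S y -> S (k *: x + y) by exact: (subspaceD lP SP).
split.
- split=> k x y z Sx Sy Sz; first by rewrite !GE ?lG //; exact: SD.
  by rewrite !GE // ?(sG x (_ + _)) ?lG ?(sG _ x) //; exact: SD.
- by apply: sc0_real; exact: (form_continuous bG GE).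
- by move=> v w Sv Sw; rewrite !GE.
- exact: (form_dual_iso lP cP SP PS bG m0 coer GE).
- move=> v Sv v0; rewrite GE //; apply: lt_le_trans (coer _ Sv).
  by rewrite mulr_gt0 // exprn_gt0 // normr_gt0.
Qed.

End construction.
End metric.

Theorem theorem3p4 (R : realType) (X : Mpolyfold R)
    (reflX : reflexive_Mpolyfold X) (hilbX : Hilbert_Mpolyfold X) :
  exists g : double_tangent X -> R, strong_Riemannian_metric g.
Proof.
(* The point [p0] supplies default charts; on an empty [X] the fibre conditions are vacuous for the
   zero function. *)
have [[p0 _]|noX] := pselect (exists p0 : X, True); last first.
  exists (fun=> 0); split; first exact: double_cst.
  by move=> p; case: noX; exists p.
have [I [ch [a [chP sa a0 lfa cova]]]] := smooth_partition p0 hilbX.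
have ipP i : exists ip : ambient (ch i) 0%N -> ambient (ch i) 0%N -> R,
    inner_product ip by have [_ [ip ipP] _] := chP i; exists ip.
exists (sum_metric a (fun i => projT1 (cid (ipP i)))).
by apply: sum_metric_strong => // i; have [] := chP i => // *;
  exact: projT2 (cid (ipP i)).
Qed.
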